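(* Let $\rho:\Gamma\to GL_p(\mathbb{C})$ be a representation with $\rho(S^2)=\epsilon I_p$, $\epsilon=\pm1$, such that $\rho(T)=\mathrm{diag}(J_{m_1,\lambda_1},\dots,J_{m_t,\lambda_t})$ with $|\lambda_r|=1$, $\lambda_r=e^{2\pi i\mu_r}$, $\mu_r\in\mathbb{R}$. Let $\underline{\nu}\in\mathbb{Z}^t$. Then there is $K$ such that for all $\underline{k}=(k_1,\dots,k_p)\in\mathbb{Z}^p$ with $\min_i k_i\ge K$, the Poincaré series $P_{\underline{k}}(\underline{\nu},\tau)$ is a meromorphic matrix-valued modular form of weight $\underline{k}$ for $\rho$. Moreover, if $\epsilon=(-1)^{k_n}$ for all $n$, then exactly one of the following holds: (a) $\nu_r+\mu_r>0$ for all $r$, and $P_{\underline{k}}(\underline{\nu},\tau)$ is a cuspidal matrix-valued modular form (possibly zero); (b) $\nu_r+\mu_r\ge0$ for all $r$ with equality for some $r$, and $P_{\underline{k}}(\underline{\nu},\tau)$ is a nonzero holomorphic matrix-valued modular form of weight $\underline{k}$; (c) $\nu_r+\mu_r<0$ for some $r$, and $P_{\underline{k}}(\underline{\nu},\tau)$ is a nonzero meromorphic matrix-valued modular form of weight $\underline{k}$. If $\epsilon\ne(-1)^{k_n}$, then the $n$th column of $P_{\underline{k}}(\underline{\nu},\tau)$ vanishes identically.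
   Context: $\Gamma=SL_2(\mathbb{Z})$ acts on the upper half-plane $\mathfrak{H}$ by Möbius transformations; $S=\begin{pmatrix}0&-1\\1&0\end{pmatrix}$, $T=\begin{pmatrix}1&1\\0&1\end{pmatrix}$; $q^x=e^{2\pi i x\tau}$; $\binom{x}{t}=x(x-1)\cdots(x-t+1)/t!$, $\binom{x}{0}=1$, $\binom{x}{t}=0$ for $t<0$. $J_{m,\lambda}$ is the $m\times m$ matrix with $\lambda$ on the diagonal and on the subdiagonal (entries $(i,i)$ and $(i+1,i)$) and $0$ elsewhere; $m_1+\dots+m_t=p$. $B_m(x)$ is the $m\times m$ matrix with $(i,j)$ entry $(-1)^{i-j}\binom{x+i-j-1}{i-j}$ (zero for $i<j$); its inverse has $(i,j)$ entry $\binom{x}{i-j}$. $B_\rho(x)=\mathrm{diag}(B_{m_1}(x),\dots,B_{m_t}(x))$, $\Lambda_\rho(z_1,\dots,z_t)=\mathrm{diag}(z_1I_{m_1},\dots,z_tI_{m_t})$, $J_{\underline{k}}(\gamma,\tau)=\mathrm{diag}((c\tau+d)^{k_1},\dots,(c\tau+d)^{k_p})$ for $\gamma=\begin{pmatrix}a&b\\c&d\end{pmatrix}$. The Poincaré series is $P_{\underline{k}}(\underline{\nu},\tau)=\frac12\sum_M\rho(M)^{-1}\Lambda_\rho(e^{2\pi i(\nu_1+\mu_1)M\tau},\dots,e^{2\pi i(\nu_t+\mu_t)M\tau})B_\rho(M\tau)^{-1}J_{\underline{k}}(M,\tau)^{-1}$, $M$ running over a set of representatives of the right cosets $\langle T\rangle\backslash\Gamma$.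 A matrix-valued modular form of weight $\underline{k}$ for $\rho$ is a holomorphic $A:\mathfrak{H}\to\mathrm{Mat}_{p\times p}(\mathbb{C})$ with $\rho(\gamma)A(\tau)=A(\gamma\tau)J_{\underline{k}}(\gamma,\tau)^{-1}$ for all $\gamma\in\Gamma$; it is meromorphic/holomorphic/cuspidal if each column is, where for a holomorphic $F:\mathfrak{H}\to\mathbb{C}^p$ with $(c\tau+d)^{-k}F(\gamma\tau)=\rho(\gamma)F(\tau)$: the span of its components has a basis of chains $(g_0,\dots,g_{m-1})$ with $g_j(\tau+1)=\lambda(g_j(\tau)+g_{j-1}(\tau))$, $g_{-1}=0$, $\lambda=e^{2\pi i\mu}$, $\mu$ real, and $g_j=\sum_{s=0}^j\binom{\tau}{s}h_{j-s}$ with $h_s=\sum_n a_s(n)q^{n+\mu}$; $F$ is holomorphic if $a_s(n)=0$ whenever $n+\mu<0$, cuspidal if whenever $n+\mu\le0$, meromorphic if whenever $n+\mu<n_0$ for some $n_0$. *)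

(* Defs.v *)
From HB Require Import structures.
From mathcomp Require Import all_boot all_order all_algebra.
From mathcomp Require Import finmap complex.
From mathcomp Require Import all_classical all_reals all_analysis.
From mathcomp.analysis.showcase Require summability.
Set Implicit Arguments.
Unset Strict Implicit.
Unset Printing Implicit Defensive.
Import Order.TTheory GRing.Theory Num.Theory.
Import numFieldNormedType.Exports.
Local Open Scope classical_set_scope.
Local Open Scope complex_scope.
Local Open Scope ring_scope.

Record SL2Z := MkSL2Z { SL2Z_mx :> 'M[int]_2; _ : \det SL2Z_mx == 1 }.
HB.instance Definition _ := [isSub for SL2Z_mx].
HB.instance Definition _ := [Choice of SL2Z by <:].

Section SL2ZGroup.
Implicit Types g h : SL2Z.

Lemma SL2Z_det g : \det g = 1. Proof. by case: g => A /= /eqP. Qed.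

Lemma SL2Z_unitmx g : (g : 'M[int]_2) \in unitmx.
Proof. by rewrite unitmxE SL2Z_det unitr1. Qed.

Fact SL2Z_one_subproof : \det (1%:M : 'M[int]_2) == 1.
Proof. by rewrite det1. Qed.
Definition SL2Z_one := MkSL2Z SL2Z_one_subproof.

Fact SL2Z_mul_subproof g h : \det (g *m h) == 1.
Proof. by rewrite det_mulmx !SL2Z_det mulr1. Qed.
Definition SL2Z_mul g h := MkSL2Z (SL2Z_mul_subproof g h).

Fact SL2Z_inv_subproof g : \det (invmx g) == 1.
Proof. by rewrite det_inv SL2Z_det invr1. Qed.
Definition SL2Z_inv g := MkSL2Z (SL2Z_inv_subproof g).

Fact SL2Z_mulA : associative SL2Z_mul.
Proof. by move=> f g h; apply: val_inj; rewrite /= mulmxA. Qed.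
Fact SL2Z_1mul : left_id SL2Z_one SL2Z_mul.
Proof. by move=> g; apply: val_inj; rewrite /= mul1mx. Qed.
Fact SL2Z_mul1 : right_id SL2Z_one SL2Z_mul.
Proof. by move=> g; apply: val_inj; rewrite /= mulmx1. Qed.
Fact SL2Z_Vmul : left_inverse SL2Z_one SL2Z_inv SL2Z_mul.
Proof. by move=> g; apply: val_inj; rewrite /= mulVmx ?SL2Z_unitmx. Qed.
Fact SL2Z_mulV : right_inverse SL2Z_one SL2Z_inv SL2Z_mul.
Proof. by move=> g; apply: val_inj; rewrite /= mulmxV ?SL2Z_unitmx. Qed.

End SL2ZGroup.

HB.instance Definition _ := isGroup.Build SL2Z
  SL2Z_mulA SL2Z_1mul SL2Z_mul1 SL2Z_Vmul SL2Z_mulV.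

Definition mx22 (a b c d : int) : 'M[int]_2 :=
  \matrix_(i, j) if i == 0 then (if j == 0 then a else b)
                 else (if j == 0 then c else d).

Lemma det_mx22 a b c d : \det (mx22 a b c d) = a * d - b * c.
Proof.
rewrite (expand_det_row _ ord0) !big_ord_recl big_ord0 /cofactor !det_mx11.
by rewrite !mxE /= addr0 expr0 expr1 mul1r mulN1r mulrN.
Qed.

Fact SL2Z_S_subproof : \det (mx22 0 (-1) 1 0) == 1.
Proof. by rewrite det_mx22. Qed.
Fact SL2Z_T_subproof : \det (mx22 1 1 0 1) == 1.
Proof. by rewrite det_mx22. Qed.
Definition SL2Z_S : SL2Z := MkSL2Z SL2Z_S_subproof.
Definition SL2Z_T : SL2Z := MkSL2Z SL2Z_T_subproof.

Definition cycleT : set SL2Z :=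
  [set g | exists n : nat, g = (SL2Z_T ^+ n)%g \/ g = (SL2Z_T ^- n)%g].

Definition is_transversal_T (Reps : set SL2Z) : Prop :=
  forall g : SL2Z, exists! M : SL2Z, Reps M /\ cycleT (g * M^-1)%g.

Definition exactly_one_of3 (A B C : Prop) : Prop :=
  [/\ A \/ B \/ C, ~ (A /\ B), ~ (A /\ C) & ~ (B /\ C)].

Section Complex.
Variable R : realType.
Local Notation C := R[i].

Definition cexp (z : C) : C :=
  (expR (complex.Re z))%:C
  * (cos (complex.Im z) +i* sin (complex.Im z)).

(* e2pi z is exp(2 pi i z); thus q^x is e2pi (x * tau) *)
Definition e2pi (z : C) : C := cexp ((2 * pi)%:C * 'i * z).

Definition binomC (x : C) (s : nat) : C :=
  (\prod_(l < s) (x - (l : nat)%:R)) / s`!%:R.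

Definition uhp : set C := [set tau | 0 < complex.Im tau].

(* R[i]^o carries the normed structure over R[i] itself, so that derivable is
   complex differentiability. *)
Definition holomorphic_on_uhp (f : C -> C) : Prop :=
  forall tau, uhp tau -> derivable (f : C^o -> C^o) tau 1.

(* Unordered summation over D: the limit along the net of finite subsets, which
   for complex families is the same as absolute convergence. *)
Definition finite_sums (I : choiceType) (D : set I) (f : I -> C)
  (A : {fset I}) : C^o := \sum_(i <- A | i \in D) f i.

Definition sums_to (I : choiceType) (D : set I) (f : I -> C) (l : C) : Prop :=
  finite_sums D f @ summability.totally --> (l : C^o).

Definition is_summable (I : choiceType) (D : set I) (f : I -> C) : Prop :=
  cvg (finite_sums D f @ summability.totally).

Definition sum_over (I : choiceType) (D : set I) (f : I -> C) : C :=
  lim (finite_sums D f @ summability.totally).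

Definition automorphy (g : SL2Z) (tau : C) : C :=
  (g 1 0)%:~R * tau + (g 1 1)%:~R.

Definition moebius (g : SL2Z) (tau : C) : C :=
  ((g 0 0)%:~R * tau + (g 0 1)%:~R) / automorphy g tau.

(* Matrix entries are indexed from 0, hence i == j.+1 on the subdiagonal. *)
Definition jordan (m : nat) (lam : C) : 'M[C]_m :=
  \matrix_(i, j) if (i == j) || (i == j.+1 :> nat) then lam else 0.

Definition Bmx (m : nat) (x : C) : 'M[C]_m :=
  \matrix_(i, j) if (j <= i)%N then
                   (-1) ^+ (i - j) * binomC (x + (i - j)%:R - 1) (i - j)
                 else 0.

(* Being multiplicative with value 1%:M at the identity, such a rho takes its
   values in the invertible matrices. *)
Definition is_representation (p : nat) (rho : SL2Z -> 'M[C]_p) : Prop :=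
  rho 1%g = 1%:M /\ forall g h : SL2Z, rho (g * h)%g = rho g *m rho h.

Definition Jmx (p : nat) (k : 'I_p -> int) (g : SL2Z) (tau : C) : 'M[C]_p :=
  diag_mx (\row_n automorphy g tau ^ k n).

Section ModularForms.
Variable p : nat.
Implicit Types (rho : SL2Z -> 'M[C]_p) (F : C -> 'cV[C]_p) (A : C -> 'M[C]_p).

Definition vv_modular rho (k : int) F : Prop :=
  (forall i, holomorphic_on_uhp (fun tau => F tau i 0)) /\
  (forall (g : SL2Z) tau, uhp tau ->
     automorphy g tau ^ (- k) *: F (moebius g tau) = rho g *m F tau).

Definition is_chain (d : nat) (mu : R) (g : nat -> C -> C) : Prop :=
  forall j, (j < d)%N -> forall tau, uhp tau ->
    g j (tau + 1) =
    e2pi mu%:C * (g j tau + if j is j'.+1 then g j' tau else 0).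

Definition log_q_expansion (d : nat) (mu : R) (g : nat -> C -> C)
    (a : nat -> int -> C) : Prop :=
  exists h : nat -> C -> C,
    (forall s, (s < d)%N -> forall tau, uhp tau ->
       sums_to [set: int] (fun n => a s n * e2pi ((n%:~R + mu)%:C * tau))
               (h s tau)) /\
    (forall j, (j < d)%N -> forall tau, uhp tau ->
       g j tau = \sum_(s < j.+1) binomC tau s * h (j - s)%N tau).

(* Linear algebra of functions on the upper half-plane: values off uhp are
   irrelevant.  The family is g r j for r < u and j < d r. *)
Definition is_basis_of_span (u : nat) (d : 'I_u -> nat)
    (g : 'I_u -> nat -> C -> C) F : Prop :=
  [/\ forall c : 'I_u -> nat -> C,
        (forall tau, uhp tau ->
           \sum_(r < u) \sum_(j < d r) c r j * g r j tau = 0) ->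
        forall r j, (j < d r)%N -> c r j = 0,
      forall r j, (j < d r)%N -> exists c : 'I_p -> C,
        forall tau, uhp tau -> g r j tau = \sum_(i < p) c i * F tau i 0
    & forall i, exists c : 'I_u -> nat -> C,
        forall tau, uhp tau ->
          F tau i 0 = \sum_(r < u) \sum_(j < d r) c r j * g r j tau].

(* The span of the components of F has a basis of chains with logarithmic
   q-expansions, in which no exponent n + mu lying in Z occurs. *)
Definition expansions_avoid (Z : set R) F : Prop :=
  exists (u : nat) (d : 'I_u -> nat) (mu : 'I_u -> R)
         (g : 'I_u -> nat -> C -> C) (a : 'I_u -> nat -> int -> C),
  [/\ is_basis_of_span d g F,
      forall r, [/\ (0 < d r)%N, is_chain (d r) (mu r) (g r)
                  & log_q_expansion (d r) (mu r) (g r) (a r)]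
    & forall r s n, (s < d r)%N -> Z (n%:~R + mu r) -> a r s n = 0].

Definition vv_meromorphic rho k F : Prop :=
  vv_modular rho k F /\ exists n0 : R, expansions_avoid [set x | x < n0] F.

Definition vv_holomorphic rho k F : Prop :=
  vv_modular rho k F /\ expansions_avoid [set x | x < 0] F.

Definition vv_cuspidal rho k F : Prop :=
  vv_modular rho k F /\ expansions_avoid [set x | x <= 0] F.

Definition mv_modular rho (k : 'I_p -> int) A : Prop :=
  (forall i j, holomorphic_on_uhp (fun tau => A tau i j)) /\
  (forall (g : SL2Z) tau, uhp tau ->
     rho g *m A tau = A (moebius g tau) *m invmx (Jmx k g tau)).

Definition mv_meromorphic rho k A : Prop :=
  mv_modular rho k A /\
  forall n, vv_meromorphic rho (k n) (fun tau => col n (A tau)).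

Definition mv_holomorphic rho k A : Prop :=
  mv_modular rho k A /\
  forall n, vv_holomorphic rho (k n) (fun tau => col n (A tau)).

Definition mv_cuspidal rho k A : Prop :=
  mv_modular rho k A /\
  forall n, vv_cuspidal rho (k n) (fun tau => col n (A tau)).

Definition nonzero_on_uhp A : Prop := exists2 tau, uhp tau & A tau != 0.

End ModularForms.

Section Poincare.
Variables (t : nat) (m : 'I_t -> nat).
Local Notation p := (\sum_(r < t) m r)%N.

Definition Brho (x : C) : 'M[C]_p := \mxdiag_(r < t) Bmx (m r) x.

Definition Lambda (z : 'I_t -> C) : 'M[C]_p :=
  \mxdiag_(r < t) ((z r)%:M : 'M[C]_(m r)).

Variables (rho : SL2Z -> 'M[C]_p) (mu : 'I_t -> R) (nu : 'I_t -> int).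
Variables (k : 'I_p -> int) (Reps : set SL2Z).

Definition poincare_term (M : SL2Z) (tau : C) : 'M[C]_p :=
  invmx (rho M)
  *m Lambda (fun r => e2pi (((nu r)%:~R + mu r)%:C * moebius M tau))
  *m invmx (Brho (moebius M tau))
  *m invmx (Jmx k M tau).

Definition poincare_converges (tau : C) : Prop :=
  forall i n, is_summable Reps (fun M => poincare_term M tau i n).

Definition poincare (tau : C) : 'M[C]_p :=
  2^-1 *: \matrix_(i, n) sum_over Reps (fun M => poincare_term M tau i n).

End Poincare.

End Complex.

(* Main.v *)
(** Holomorphy is handled through functions whose Taylor remainder is uniformly
    quadratic.  For a 1-periodic such function f on the upper half-plane the means
    of f(z) e(-nz) over N equally spaced points of a horizontal period converge to a
    constant a_n, and exact discrete Fourier inversion together with an O(1/n^2)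
    bound from second differences gives f = sum a_n q^n.  Applied to
    f(z0 + r e(z)) this yields Cauchy's estimates, hence normally convergent sums
    stay holomorphic.

    Euclid's algorithm provides coset representatives on which rho grows
    polynomially in the bottom row (c, d).  Hence in large weight the Poincare series
    converges normally, and its terms with c <> 0 contribute O(y^(-p-1)) as
    y -> oo, uniformly in x; the two cosets with c = 0 give an explicit main term,
    which decides nonvanishing and which exponents can occur.  Finally, the
    components of a column are chains for the translation by 1, and a linear
    relation between chains can be used to shorten one of them, so that their span
    has a basis of chains. *)

Require Import Defs.
From mathcomp Require Import all_boot all_order all_algebra finmap complex.
From mathcomp Require Import all_classical all_reals all_analysis.
From mathcomp Require Import ring lra zify.
From mathcomp.analysis.showcase Require summability.
Set Implicit Arguments.
Unset Strict Implicit.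
Unset Printing Implicit Defensive.
Import Order.TTheory GRing.Theory Num.Theory.
Import numFieldNormedType.Exports.
Import Normc.
Local Open Scope classical_set_scope.
Local Open Scope complex_scope.
Local Open Scope ring_scope.

(** The weight bound [al + 4 + p.+1] in [poincare_term_dominated] has three sources: [al] is the
    growth exponent of [rho] and of the matrix entries along Euclid's representatives, 4 makes the
    sum over bottom rows converge, and p + 1 is the decay at the cusp. The logarithms dictate this
    last exponent: a basis chain has length at most p, its periodic parts cost binomials of size
    y^p, and one more power of y is left to squeeze a coefficient to 0. The good representatives
    serve only to bound terms: a summand depends only on its coset, so the estimates hold on
    whatever transversal is given. The three alternatives come from one statement: if v bounds all
    nu_r + mu_r from below, no exponent x0 < v with x0 <= 0 occurs. The condition x0 <= 0 is due to
    the cosets with c <> 0, which are only known to decay like a power of y. For nonvanishing, the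
    sign condition makes the cosets of I and -I add up instead of cancelling. The components of a
    column may be linearly dependent, while a basis of their span is asked for; so decay is proved
    for components and carried to the span by linearity. *)

Local Notation Re := complex.Re.
Local Notation Im := complex.Im.

(** * Elementary estimates for the complex exponential *)

Section ComplexBasics.
Variable R : realType.
Local Notation C := R[i].
Implicit Types (z w : C) (x y : R).

Lemma normc_ge0 z : 0 <= normc z.
Proof. by case: z => a b; apply: sqrtr_ge0. Qed.

Lemma normcE_real z : `|z| = (normc z)%:C.
Proof. by rewrite normc_def; case: z. Qed.

Lemma normc_eq0 z : (normc z == 0) = (z == 0).
Proof. by apply/eqP/eqP => [/eq0_normc|->]; rewrite ?normc0. Qed.

Lemma normc_gt0 z : (0 < normc z) = (z != 0).
Proof. by rewrite lt_def normc_ge0 andbT normc_eq0. Qed.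

Lemma normc_real x : normc x%:C = `|x|.
Proof. by rewrite /= expr0n /= addr0 sqrtr_sqr. Qed.

Lemma normc_nat n : normc (n%:R : C) = n%:R.
Proof. by rewrite -(rmorph_nat (real_complex R)) normc_real ger0_norm. Qed.

Lemma normc_int (n : int) : normc (n%:~R : C) = `|n%:~R|.
Proof. by rewrite -(rmorph_int (real_complex R)) normc_real. Qed.

Lemma normcX z n : normc (z ^+ n) = normc z ^+ n.
Proof. by elim: n => [|n IH]; rewrite ?expr0 ?normc1// !exprS normcM IH. Qed.

Lemma normc_sum I (r : seq I) (P : pred I) (F : I -> C) :
  normc (\sum_(i <- r | P i) F i) <= \sum_(i <- r | P i) normc (F i).
Proof.
elim/big_rec2: _ => [|i y z _ IH]; first by rewrite normc0.
by rewrite (le_trans (le_normcD _ _))// lerD2l.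
Qed.

Lemma normcB z w : normc (z - w) = normc (w - z).
Proof. by rewrite -normcN opprB. Qed.

Lemma le_normcB z w : normc (z - w) <= normc z + normc w.
Proof. by rewrite (le_trans (le_normcD _ _))// normcN. Qed.

Lemma le_normc_trans z1 z2 z3 :
  normc (z1 - z3) <= normc (z1 - z2) + normc (z2 - z3).
Proof. by rewrite -{1}(subrK z2 z1) -addrA le_normcD. Qed.

Lemma lerB_normc z w : normc z - normc w <= normc (z - w).
Proof. by rewrite lerBlDr -{1}(subrK w z) le_normcD. Qed.

Lemma Re_normc z : `|Re z| <= normc z.
Proof.
by case: z => a b /=; rewrite -sqrtr_sqr ler_wsqrtr// lerDl sqr_ge0.
Qed.

Lemma Im_normc z : `|Im z| <= normc z.
Proof.
by case: z => a b /=; rewrite -sqrtr_sqr ler_wsqrtr// lerDr sqr_ge0.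
Qed.

Lemma normc_ReIm z : normc z <= `|Re z| + `|Im z|.
Proof.
case: z => a b /=.
rewrite -(ger0_norm (addr_ge0 (normr_ge0 a) (normr_ge0 b))) -sqrtr_sqr.
rewrite ler_wsqrtr// sqrrD !real_normK ?num_real//.
by rewrite -addrA lerD2l lerDr mulrn_wge0// mulr_ge0.
Qed.

Lemma ReD z w : Re (z + w) = Re z + Re w.
Proof. by case: z; case: w. Qed.
Lemma ImD z w : Im (z + w) = Im z + Im w.
Proof. by case: z; case: w. Qed.
Lemma ReN z : Re (- z) = - Re z.
Proof. by case: z. Qed.
Lemma ImN z : Im (- z) = - Im z.
Proof. by case: z. Qed.
Lemma ReMr x z : Re (x%:C * z) = x * Re z.
Proof. by case: z => a b /=; rewrite mul0r subr0. Qed.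
Lemma ImMr x z : Im (x%:C * z) = x * Im z.
Proof. by case: z => a b /=; rewrite mul0r addr0. Qed.

Lemma cexpD z w : cexp (z + w) = cexp z * cexp w.
Proof.
rewrite /cexp ReD ImD expRD cosD sinD; case: z => a b; case: w => c d /=.
by simpc; congr (_ +i* _); ring.
Qed.

Lemma cexp0 : cexp (0 : C) = 1.
Proof. by rewrite /cexp /= expR0 cos0 sin0 mul1r. Qed.

Lemma normc_cexp z : normc (cexp z) = expR (Re z).
Proof.
rewrite /cexp normcM normc_real ger0_norm ?expR_ge0//=.
by rewrite cos2Dsin2 sqrtr1 mulr1.
Qed.

Lemma e2piE z : e2pi z = cexp ((- (2 * pi * Im z)) +i* (2 * pi * Re z)).
Proof. by rewrite /e2pi; case: z => a b; simpc => /=; congr cexp; congr (_ +i* _); ring. Qed.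

Lemma e2piD z w : e2pi (z + w) = e2pi z * e2pi w.
Proof. by rewrite /e2pi mulrDr cexpD. Qed.

Lemma e2pi0 : e2pi (0 : C) = 1.
Proof. by rewrite /e2pi mulr0 cexp0. Qed.

Lemma e2piNK z : e2pi z * e2pi (- z) = 1.
Proof. by rewrite -e2piD subrr e2pi0. Qed.

Lemma normc_e2pi z : normc (e2pi z) = expR (- (2 * pi * Im z)).
Proof. by rewrite e2piE normc_cexp. Qed.

Lemma e2pi_neq0 z : e2pi z != 0.
Proof. by rewrite -normc_gt0 normc_e2pi expR_gt0. Qed.

Lemma e2piN z : e2pi (- z) = (e2pi z)^-1.
Proof. by apply: (mulfI (e2pi_neq0 z)); rewrite e2piNK divff// e2pi_neq0. Qed.

Lemma e2piMn z n : e2pi (n%:R * z) = e2pi z ^+ n.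
Proof.
elim: n => [|n IH]; first by rewrite mul0r e2pi0.
by rewrite -natr1 mulrDl mul1r e2piD IH exprSr.
Qed.

Lemma e2pi1 : e2pi (1 : C) = 1.
Proof.
rewrite e2piE /cexp /= !mulr0 oppr0 expR0 mulr1.
by rewrite mulr_natl cos2pi sin2pi mul1r.
Qed.

Lemma e2pi_int (n : int) : e2pi (n%:~R : C) = 1.
Proof.
have H k : e2pi (k%:R : C) = 1 by rewrite -[k%:R]mulr1 e2piMn e2pi1 expr1n.
by case: n => n; rewrite ?NegzE ?rmorphN ?e2piN /= -pmulrn H ?invr1.
Qed.

Lemma e2piD1 z : e2pi (z + 1) = e2pi z.
Proof. by rewrite e2piD e2pi1 mulr1. Qed.

Lemma normc_e2pi_real x : normc (e2pi x%:C) = 1.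
Proof. by rewrite normc_e2pi /= mulr0 oppr0 expR0. Qed.

(** Polar coordinates: the modulus fixes Im w through a logarithm, the direction fixes Re w through
    [acos]. The modulus is recorded because |z| < 1 has to give Im w > 0 when a punctured disc is
    parametrised by the upper half-plane. *)
Lemma e2pi_surj z : z != 0 -> exists w, e2pi w = z /\
   normc z = expR (- (2 * pi * Im w)).
Proof.
move=> z0; have pi0 : 2 * (pi : R) != 0 by rewrite mulf_neq0// gt_eqF// pi_gt0.
suff [w Hw] : exists w, e2pi w = z by exists w; rewrite -normc_e2pi Hw.
pose r : R := normc z; have r0 : 0 < r by rewrite normc_gt0.
have [s Hs] : exists s : R, s * (2 * pi) = - ln r.
  by exists (- ln r / (2 * pi)); rewrite divfK.
suff [th [Hc Hsn]] : exists th : R, cos th = Re z / r /\ sin th = Im z / r.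
  exists ((th / (2 * pi)) +i* s); rewrite e2piE /cexp /=.
  rewrite [2 * pi * s]mulrC Hs opprK lnK ?posrE// [2 * pi * _]mulrC divfK// Hc Hsn.
  rewrite -[RHS](divfK (_ : r%:C != 0)); last by rewrite eq_complex /= negb_and gt_eqF.
  rewrite mulrC; congr (_ * _).
  by rewrite -fmorphV [z in RHS]complexE; case: (z) => a b /=; simpc.
have E : (Re z / r) ^+ 2 + (Im z / r) ^+ 2 = 1.
  rewrite !expr_div_n -mulrDl; have -> : Re z ^+ 2 + Im z ^+ 2 = r ^+ 2.
    by rewrite /r; case: (z) => a b /=; rewrite sqr_sqrtr// addr_ge0// sqr_ge0.
  by rewrite divff// expf_neq0// gt_eqF.
set a := _ / r in E *; set b := _ / r in E *.
have a1 : -1 <= a <= 1.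
  rewrite -ler_norml -(@ler_pXn2r _ 2%N)// ?nnegrE// expr1n real_normK ?num_real//.
  by rewrite -E lerDl sqr_ge0.
have Eb : Num.sqrt (1 - a ^+ 2) = `|b|.
  by rewrite -E addrC addKr sqrtr_sqr.
(* [acos] only yields angles with nonnegative sine, so the sign of [b] decides between the angle and
   its opposite. *)
have [b0|b0] := leP 0 b.
  exists (acos a); rewrite acosK ?in_itv//= sin_acos// Eb.
  by rewrite ger0_norm.
exists (- acos a); rewrite cosN sinN acosK ?in_itv//= sin_acos// Eb.
by rewrite ltr0_norm// opprK.
Qed.

Lemma lipschitz_of_derive (f df : R -> R) (v B : R) :
  (forall x, is_derive x 1 f (df x)) ->
  (forall x, `|x| <= `|v| -> `|df x| <= B) -> `|f v - f 0| <= B * `|v|.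
Proof.
move=> Hf Hd.
have cf x : {for x, continuous f}.
  by apply/differentiable_continuous/derivable1_diffP; case: (Hf x).
have [v0|v0|->] := ltgtP v 0; last by rewrite !subrr !normr0 mulr0.
- have [c cI E] := MVT v0 (fun x _ => Hf x) (continuous_subspaceT cf).
  rewrite distrC E normrM sub0r normrN ler_wpM2r// Hd//.
  move: cI; rewrite in_itv/= => /andP[c1 c2].
  by rewrite !ltr0_norm// lerN2 ltW.
- have [c cI E] := MVT v0 (fun x _ => Hf x) (continuous_subspaceT cf).
  rewrite E normrM subr0 ler_wpM2r// Hd//.
  move: cI; rewrite in_itv/= => /andP[c1 c2].
  by rewrite !gtr0_norm// ltW.
Qed.

Lemma sin_le_id x : `|sin x| <= `|x|.
Proof.
have := @lipschitz_of_derive (@sin R) (@cos R) x 1.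
by rewrite sin0 subr0 mul1r; apply => // y _; rewrite cos_max.
Qed.

Lemma cos_sub1_le x : `|cos x - 1| <= x ^+ 2.
Proof.
have -> : cos x - 1 = - (sin (x / 2) ^+ 2 *+ 2).
  have {1}-> : x = (x / 2) *+ 2 by rewrite -mulr_natr divfK.
  by rewrite cos_mulr2n cos2sin2; ring.
rewrite normrN normrMn normrX.
have := sin_le_id (x / 2); rewrite -(@ler_pXn2r _ 2%N)// ?nnegrE// => H.
rewrite (@le_trans _ _ (`|x / 2| ^+ 2 *+ 2))// ?lerMn2r// ?H ?orbT//.
by rewrite real_normK ?num_real// expr_div_n; have := sqr_ge0 x; lra.
Qed.

Lemma sin_sub_id_le x : `|sin x - x| <= `|x| ^+ 3.
Proof.
have := @lipschitz_of_derive (fun x => sin x - x) (fun x => cos x - 1) x (`|x| ^+ 2).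
rewrite sin0 !subr0 -exprSr; apply => y Hy.
rewrite (le_trans (cos_sub1_le _))// -real_normK ?num_real//.
by rewrite ler_pXn2r ?nnegrE.
Qed.

(** A crude form of Jordan's inequality. Up to 3/4 the cubic error of [sin_sub_id_le] is small
    enough; beyond, monotonicity gives sin x >= 3/4 - 27/64 > 1/4, while x / 8 < 1/4 because pi / 2
    < 2. *)
Lemma sin_ge_eighth x : 0 <= x <= pi / 2 -> x / 8 <= sin x.
Proof.
have H y : 0 <= y <= 3 / 4 -> y / 8 <= sin y.
  move=> /andP[y0 y1]; have := sin_sub_id_le y.
  rewrite [X in _ <= X ^+ 3]ger0_norm// ler_norml => /andP[H _].
  suff : y ^+ 3 <= 9 / 16 * y by lra.
  rewrite exprSr ler_wpM2r//.
  have -> : (9 / 16 : R) = (3 / 4) ^+ 2 by field.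
  by rewrite ler_pXn2r// ?nnegrE//; lra.
case/andP => x0 x1; have [xs|xb] := leP x (3 / 4); first by apply: H; rewrite x0.
have [p1 p2] := (@pihalf_ge1 R, @pihalf_lt2 R).
have: sin (3 / 4 : R) < sin x.
  by rewrite ltr_sin// in_itv/=; apply/andP; split; lra.
have := sin_sub_id_le (3 / 4 : R).
rewrite [X in _ <= X ^+ 3]ger0_norm; last by lra.
rewrite ler_norml => /andP[H1 _] H2.
by nra.
Qed.

(** Only 1 + x <= e^x is used: applied to - x it gives e^x (1 - x) <= 1, hence e^x - 1 - x <= x^2 /
    (1 - x). *)
Lemma expR_sub_le x : x <= 1 / 2 -> `|expR x - 1 - x| <= 2 * x ^+ 2.
Proof.
move=> x1; have H1 := expR_ge1Dx x; have H2 := expR_ge1Dx (- x).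
have E : expR x * expR (- x) = 1 by rewrite -expRD subrr expR0.
have p := expR_gt0 x.
have s2 := sqr_ge0 x.
rewrite ger0_norm; last by lra.
have : expR x * (1 - x) <= 1 by rewrite -[leRHS]E ler_wpM2l// ltW.
have [x0|x0] := leP 0 x; last by nra.
by nra.
Qed.

Lemma cexp_taylor w : normc w <= 1 / 2 ->
  normc (cexp w - 1 - w) <= 16 * normc w ^+ 2.
Proof.
move=> w1; set r := normc w.
have r0 : 0 <= r by apply: normc_ge0.
have Hu : `|Re w| <= r := Re_normc w.
have Hv : `|Im w| <= r := Im_normc w.
move: (Re w) (Im w) Hu Hv (erefl (cexp w)) => u v Hu Hv _.
apply: le_trans (normc_ReIm _) _.
rewrite !ReD !ImD !ReN !ImN /cexp ReMr ImMr /= oppr0 addr0.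
move: Hu Hv; rewrite -/r; have := Re_normc w; have := Im_normc w; rewrite -/r.
move: (Re w) (Im w) => {}u {}v Hv Hu _ _.
have u1 : u <= 1 / 2 by rewrite (le_trans (ler_norm _))// (le_trans Hu).
have He := expR_sub_le u1.
have u2 : u ^+ 2 <= r ^+ 2.
  by rewrite -[X in X <= _]real_normK ?num_real// ler_pXn2r// ?nnegrE.
have v2 : v ^+ 2 <= r ^+ 2.
  by rewrite -[X in X <= _]real_normK ?num_real// ler_pXn2r// ?nnegrE.
have Hc := le_trans (cos_sub1_le v) v2.
have v3 : `|v| ^+ 3 <= r ^+ 2.
  rewrite exprS -[leRHS]mul1r ler_pM// ?exprn_ge0//; first by move: w1; rewrite -/r; lra.
  by rewrite real_normK ?num_real.
have Hs := le_trans (sin_sub_id_le v) v3.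
have e2 : expR u <= 2.
  have := He; rewrite ler_norml => /andP[_]; have : r ^+ 2 <= 1/4; last by lra.
  have -> : (1 / 4 : R) = (1/2)^+2 by field.
  by rewrite ler_pXn2r ?nnegrE//; lra.
have p := expR_ge0 u.
have -> : expR u * cos v - 1 - u = expR u * (cos v - 1) + (expR u - 1 - u) by ring.
have -> : expR u * sin v - v = expR u * (sin v - v) + (expR u - 1) * v by ring.
have A1 : `|expR u * (cos v - 1)| <= 2 * r ^+ 2.
  by rewrite normrM ger0_norm// ler_pM.
have A2 : `|expR u * (sin v - v)| <= 2 * r ^+ 2.
  by rewrite normrM ger0_norm// ler_pM.
have A3 : `|(expR u - 1) * v| <= 2 * r ^+ 2.
  rewrite normrM expr2 mulrA ler_pM//.
  have -> : expR u - 1 = (expR u - 1 - u) + u by ring.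
  rewrite (le_trans (ler_normD _ _))//.
  have : r ^+ 2 <= r * (1 / 2) by rewrite expr2 ler_wpM2l.
  by lra.
have B1 := ler_normD (expR u * (cos v - 1)) (expR u - 1 - u).
have B2 := ler_normD (expR u * (sin v - v)) ((expR u - 1) * v).
by have := sqr_ge0 r; lra.
Qed.

End ComplexBasics.

(** * Unordered sums *)

#[local] Existing Instance summability.totally_filter.

Section UnorderedSums.
Variable R : realType.
Local Notation C := R[i].
Implicit Types (I J : choiceType).
Local Open Scope fset_scope.
Local Open Scope ring_scope.

(** Convergence along finite subsets with real epsilons. There is no domain: a sum over a subset is
    written as the sum of the extension by 0, see [sums_toP]. *)
Definition usum I (f : I -> C) (l : C) := forall e : R, 0 < e ->
  exists A0 : {fset I}, forall A : {fset I}, A0 `<=` A ->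
    normc (\sum_(i <- A) f i - l) < e.

(** For nonnegative [w] this is summability with total at most M; it plays the part of the majorant
    in every convergence argument. *)
Definition bounded_sums I (w : I -> R) (M : R) :=
  forall A : {fset I}, \sum_(i <- A) w i <= M.

Lemma ltcR0 (e : R[i]) : 0 < e -> exists2 r : R, 0 < r & e = r%:C.
Proof. by case: e => a b; rewrite ltcE /= => /andP[/eqP -> a0]; exists a. Qed.

Lemma sums_toP I (D : set I) (f : I -> C) l :
  sums_to D f l <-> usum (fun i => if i \in D then f i else 0) l.
Proof.
split=> [H e e0|H].
  have {}H : forall eps : C, 0 < eps -> \forall A \near summability.totally,
      `|(l : C^o) - finite_sums D f A| < eps.
    rewrite /sums_to in H; exact/(cvgrPdist_lt (FF := summability.totally_filter)).
  move: (H e%:C); rewrite ltcR => /(_ e0).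
  case=> A0 _ HA0; exists A0 => A /HA0 /=.
  by rewrite /finite_sums big_mkcond normcB normc_def ltcR; case: (_ - _).
apply/cvgrPdist_lt => e /ltcR0[r r0 ->].
have [A0 HA0] := H r r0; exists A0 => // A /HA0 /=.
by rewrite /finite_sums [in X in _ -> X]big_mkcond normcB normc_def ltcR; case: (_ - _).
Qed.

Lemma fsetU_sub I (A0 A1 A : {fset I}) : A0 `|` A1 `<=` A -> A0 `<=` A /\ A1 `<=` A.
Proof. by rewrite fsubUset => /andP. Qed.

Lemma eq0_small (z : C) : (forall e : R, 0 < e -> normc z < e) -> z = 0.
Proof.
move=> H; apply/eqP; rewrite -normc_eq0 eq_le normc_ge0 andbT leNgt.
by apply/negP => h; have := H _ h; rewrite ltxx.
Qed.

Lemma usum_unique I (f : I -> C) l l' : usum f l -> usum f l' -> l = l'.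
Proof.
move=> H H'; apply/eqP; rewrite -subr_eq0; apply/eqP/eq0_small => e e0.
have e2 : 0 < e / 2 by rewrite divr_gt0.
have [A HA] := H _ e2; have [A' HA'] := H' _ e2.
have /HA h := fsubsetUl A A'; have /HA' h' := fsubsetUr A A'.
rewrite (le_lt_trans (le_normc_trans _ (\sum_(i <- A `|` A') f i) _))//.
by rewrite normcB [e]splitr ltrD.
Qed.

Lemma eq_usum I (f g : I -> C) l : f =1 g -> usum f l -> usum g l.
Proof. by move=> /funext ->. Qed.

Lemma usumD I (f g : I -> C) l l' :
  usum f l -> usum g l' -> usum (fun i => f i + g i) (l + l').
Proof.
move=> H H' e e0; have e2 : 0 < e / 2 by rewrite divr_gt0.
have [A HA] := H _ e2; have [A' HA'] := H' _ e2.
exists (A `|` A') => B /fsetU_sub[/HA h /HA' h'].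
by rewrite big_split/= opprD addrACA (le_lt_trans (le_normcD _ _))// [e]splitr ltrD.
Qed.

Lemma usumZ I (f : I -> C) l a : usum f l -> usum (fun i => a * f i) (a * l).
Proof.
move=> H e e0.
have [A HA] := H (e / (normc a + 1)) (divr_gt0 e0 (ltr_wpDl (normc_ge0 a) ltr01)).
exists A => B /HA h; rewrite -mulr_sumr -mulrBr normcM.
rewrite ltr_pdivlMr ?(ltr_wpDl (normc_ge0 a))// in h.
by rewrite mulrC (le_lt_trans _ h)// ler_wpM2l ?normc_ge0// lerDl.
Qed.

Lemma usum0 I : usum (fun _ : I => 0) 0.
Proof. by move=> e e0; exists fset0 => A _; rewrite big1// subrr normc0. Qed.

Lemma usum_sum I (K : Type) (r : seq K) (f : K -> I -> C) (l : K -> C) :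
  (forall k, usum (f k) (l k)) ->
  usum (fun i => \sum_(k <- r) f k i) (\sum_(k <- r) l k).
Proof.
move=> H; elim: r => [|k r IH].
  by rewrite big_nil; apply: eq_usum (@usum0 I) => i; rewrite big_nil.
rewrite big_cons; apply: eq_usum (usumD (H k) IH) => i.
by rewrite big_cons.
Qed.

Lemma usum_fin I (A : {fset I}) (f : I -> C) :
  (forall i, i \notin A -> f i = 0) -> usum f (\sum_(i <- A) f i).
Proof.
move=> H e e0; exists A => B AB.
rewrite (big_fset_incl _ AB) ?subrr ?normc0// => i _; exact: H.
Qed.

Lemma usum_le I (f : I -> C) (w : I -> R) l M : usum f l ->
  (forall i, normc (f i) <= w i) -> bounded_sums w M -> normc l <= M.
Proof.
move=> H Hw HM; rewrite leNgt; apply/negP => h.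
have d0 : 0 < normc l - M by rewrite subr_gt0.
have [A /(_ A (fsubset_refl _))] := H _ d0.
rewrite ltNge => /negP; apply; rewrite normcB.
rewrite (le_trans _ (lerB_normc _ _))// lerB// (le_trans (normc_sum _ _ _))//.
by rewrite (le_trans _ (HM A))// ler_sum.
Qed.

Lemma ler_sum_fset_subset I (w : I -> R) (A B : {fset I}) :
  (forall i, 0 <= w i) -> A `<=` B -> \sum_(i <- A) w i <= \sum_(i <- B) w i.
Proof.
move=> w0 /fsetIidPr; rewrite (big_fsetID _ (mem A) B)/= => AB.
rewrite (_ : [fset x in B | x \in A] = A).
  by rewrite lerDl sumr_ge0.
by apply/fsetP => x; rewrite !inE -[in RHS]AB inE.
Qed.

Lemma bounded_sums_sup I (w : I -> R) M : (forall i, 0 <= w i) ->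
  bounded_sums w M -> exists l, forall e : R, 0 < e ->
  exists A0 : {fset I}, forall A : {fset I}, A0 `<=` A ->
    l - e < \sum_(i <- A) w i <= l.
Proof.
move=> w0 H; pose S := [set x : R | exists A : {fset I}, x = \sum_(i <- A) w i].
have supS : has_sup S.
  split; first by exists (\sum_(i <- fset0 : {fset I}) w i), fset0.
  by exists M => x [A ->]; apply: H.
exists (sup S) => e e0; have [_ [A0 ->] hA] := sup_adherent e0 supS.
exists A0 => A sA; rewrite (lt_le_trans hA) ?ler_sum_fset_subset//=.
by apply: ub_le_sup; [case: supS|exists A].
Qed.

Lemma bounded_sums_tail I (w : I -> R) M : (forall i, 0 <= w i) ->
  bounded_sums w M -> forall e : R, 0 < e -> exists A0 : {fset I},
  forall A : {fset I}, A0 `<=` A -> forall B : {fset I}, [disjoint A & B]%fset ->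
    \sum_(i <- B) w i < e.
Proof.
move=> w0 H e e0; have [l Hl] := bounded_sums_sup w0 H.
have [A0 HA0] := Hl e e0; exists A0 => A sA B dAB.
have /andP[h1 _] := HA0 _ sA.
have /HA0 /andP[_ h2] : A0 `<=` A `|` B by rewrite (fsubset_trans sA)// fsubsetUl.
move: h2; rewrite (big_fsetID _ (mem A))/=.
have -> : [fset x in A `|` B | x \in A] = A.
  by apply/fsetP => x; rewrite !inE; case: (x \in A); rewrite ?orbT ?andbF.
have -> : [fset x in A `|` B | x \notin A] = B.
  apply/fsetP => x; rewrite !inE; case xA : (x \in A) => /=; rewrite ?andbT ?andbF//.
  apply/esym/negbTE; apply/negP => xB.
  by move/fdisjointP : dAB => /(_ x xA); rewrite xB.
by lra.
Qed.

Lemma usum_nonneg I (w : I -> R) M : (forall i, 0 <= w i) ->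
  bounded_sums w M -> exists l, usum (fun i => (w i)%:C) l.
Proof.
move=> w0 H; have [l Hl] := bounded_sums_sup w0 H.
exists l%:C => e e0; have [A0 HA0] := Hl e e0; exists A0 => A /HA0 /andP[h1 h2].
by rewrite -rmorph_sum -rmorphB normc_real ltr_norml; lra.
Qed.

Lemma bounded_sums_le I (w w' : I -> R) M : (forall i, w i <= w' i) ->
  bounded_sums w' M -> bounded_sums w M.
Proof. by move=> h H A; rewrite (le_trans _ (H A))// ler_sum. Qed.

Lemma usum_exists I (f : I -> C) (w : I -> R) M :
  (forall i, normc (f i) <= w i) -> bounded_sums w M -> exists l, usum f l.
Proof.
move=> fw H.
(* Real and imaginary parts are split into positive and negative parts, so that only nonnegative
   families, whose sums are suprema, remain. *)
have part (g : I -> R) : (forall i, `|g i| <= normc (f i)) -> exists l, usum (fun i => (g i)%:C) l.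
  move=> Hg; pose gp i := (`|g i| + g i) / 2; pose gm i := (`|g i| - g i) / 2.
  have Hp i : 0 <= gp i <= w i.
    by have := fw i; have := Hg i; have := ler_norm (g i); have := ler_norm (- g i); rewrite normrN /gp; lra.
  have Hm i : 0 <= gm i <= w i.
    by have := fw i; have := Hg i; have := ler_norm (g i); have := ler_norm (- g i); rewrite normrN /gm; lra.
  have [||lp Hlp] := @usum_nonneg I gp M; first by move=> i; case/andP: (Hp i).
    by apply: bounded_sums_le H => i; case/andP: (Hp i).
  have [||lm Hlm] := @usum_nonneg I gm M; first by move=> i; case/andP: (Hm i).
    by apply: bounded_sums_le H => i; case/andP: (Hm i).
  exists (lp + (-1) * lm); apply: eq_usum (usumD Hlp (usumZ (-1) Hlm)) => i.
  by rewrite mulN1r -rmorphB /gp /gm; congr (_%:C); field.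
have [lr Hr] := part (fun i => Re (f i)) (fun i => Re_normc _).
have [li Hi] := part (fun i => Im (f i)) (fun i => Im_normc _).
exists (lr + 'i * li); apply: eq_usum (usumD Hr (usumZ 'i Hi)) => i.
by rewrite -complexE.
Qed.

(** The maps are inverse to each other only between the supports. This is what families extended by
    0 off a transversal need: a change of representatives has no meaning elsewhere. *)
Lemma usum_reindex I J (f : J -> C) (f' : I -> C) (h : I -> J) (g : J -> I) l :
  (forall j, f j != 0 -> h (g j) = j /\ f' (g j) = f j) ->
  (forall i, f' i != 0 -> g (h i) = i /\ f (h i) = f' i) ->
  usum f' l -> usum f l.
Proof.
move=> Hj Hi H e e0; have [A0 HA0] := H e e0.
exists [fset h x | x in A0]; move=> B sB.
pose B' := [fset j in B | f j != 0].
have inB' j : (j \in B') = (j \in B) && (f j != 0) by rewrite /B' !inE.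
have /HA0 : A0 `<=` A0 `|` [fset g j | j in B'] by exact: fsubsetUl.
set A := _ `|` _.
suff -> : \sum_(i <- A) f' i = \sum_(j <- B) f j by [].
have E1 : \sum_(j <- B) f j = \sum_(j <- B') f j.
  apply/esym/big_fset_incl; first by apply/fsubsetP => j; rewrite ?inB' => /andP[].
  by move=> j jB; rewrite ?inB' jB /= negbK => /eqP.
have E2 : \sum_(i <- A) f' i = \sum_(i <- [fset g j | j in B']) f' i.
  apply/esym/big_fset_incl; first by exact: fsubsetUr.
  move=> i; rewrite in_fsetU => /orP[iA0|->//].
  apply: contraNeq => fi; have [gi fhi] := Hi i fi.
  apply/imfsetP; exists (h i) => //=; rewrite ?inB' fhi fi andbT.
  by move/fsubsetP: sB; apply; apply/imfsetP; exists i.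
rewrite E1 E2 big_imfset/=; last first.
  move=> x y xB yB E.
  have /andP[_ fx] : (x \in B) && (f x != 0) by rewrite -inB'; exact: xB.
  have /andP[_ fy] : (y \in B) && (f y != 0) by rewrite -inB'; exact: yB.
  by rewrite -(Hj x fx).1 -(Hj y fy).1 E.
rewrite big_seq [RHS]big_seq; apply: eq_bigr => j; rewrite ?inB' => /andP[_ fj].
by rewrite (Hj j fj).2.
Qed.

Lemma bounded_sums_inj I J (w : I -> R) (w' : J -> R) (h : I -> J) M :
  (forall j, 0 <= w' j) ->
  (forall i, w i != 0 -> w i <= w' (h i)) ->
  (forall i i', w i != 0 -> w i' != 0 -> h i = h i' -> i = i') ->
  bounded_sums w' M -> bounded_sums w M.
Proof.
move=> w'0 Hw inj H A; pose A' := [fset i in A | w i != 0].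
have inA' j : (j \in A') = (j \in A) && (w j != 0) by rewrite /A' !inE.
have -> : \sum_(i <- A) w i = \sum_(i <- A') w i.
  apply/esym/big_fset_incl; first by apply/fsubsetP => j; rewrite ?inA' => /andP[].
  by move=> j jB; rewrite ?inA' jB /= negbK => /eqP.
rewrite (le_trans _ (H [fset h i | i in A']))// [leRHS]big_imfset/=; last first.
  move=> x y xA yA.
  have /andP[_ fx] : (x \in A) && (w x != 0) by rewrite -inA'; exact: xA.
  have /andP[_ fy] : (y \in A) && (w y != 0) by rewrite -inA'; exact: yA.
  exact: inj.
rewrite [X in _ <= X]big_seq big_seq ler_sum// => i; rewrite ?inA' => /andP[_]; exact: Hw.
Qed.

(** The shift by 1 keeps the weight positive at n = 0, so it can dominate a whole family over the
    integers, bottom rows with c = 0 included. *)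
Definition inv_sq (n : int) : R := ((`|n|%N)%:R + 1) ^- 2.

Lemma inv_sq_ge0 n : 0 <= inv_sq n.
Proof. by rewrite invr_ge0 exprn_ge0// addr_ge0. Qed.

(** Telescoping: 1 / (x + 1)^2 is at most 2 / ((x + 1)(x + 2)) = 2 / (x + 1) - 2 / (x + 2). *)
Lemma sum_nat_inv_sq N : \sum_(k < N) ((k%:R + 1) ^- 2 : R) <= 2 - 2 / (N%:R + 1).
Proof.
elim: N => [|N IH]; first by rewrite big_ord0 add0r divr1 subrr.
rewrite big_ord_recr/= -[N.+1%:R]natr1; move: IH; set S := \sum_(_ < _) _ => IH.
have n0 : 0 <= N%:R :> R by [].
move: (N%:R) n0 IH => x x0 IH.
suff : (x + 1) ^- 2 <= 2 / (x + 1) - 2 / (x + 1 + 1) by lra.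
have -> : 2 / (x + 1) - 2 / (x + 1 + 1) = 2 / ((x + 1) * (x + 1 + 1)).
  by field; rewrite !gt_eqF //; lra.
rewrite ler_pdivlMr ?mulr_gt0//; [|lra|lra].
rewrite ler_pdivrMl ?exprn_gt0//; last by lra.
by nra.
Qed.

Lemma bounded_inv_sq : bounded_sums inv_sq 4.
Proof.
have Hnat : bounded_sums (fun k : nat => (k%:R + 1) ^- 2 : R) 2.
  move=> A; pose N := (\max_(k <- A) k).+1.
  apply: (@le_trans _ _ (\sum_(k <- [fset (val k) | k in 'I_N]) ((k%:R + 1) ^- 2 : R))).
    apply: ler_sum_fset_subset => [k|]; first by rewrite invr_ge0 exprn_ge0// addr_ge0.
    apply/fsubsetP => k kA; have kN : (k < N)%N.
      by rewrite ltnS; apply: (leq_bigmax_seq (F := id)).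
    by apply/imfsetP; exists (Ordinal kN).
  rewrite big_imfset/=; last by move=> x y _ _ /val_inj.
  rewrite big_enum/= (le_trans (sum_nat_inv_sq N))// gerBl divr_ge0// addr_ge0//.
move=> A; rewrite (big_fsetID _ (fun n : int => 0 <= n)) /= (_ : 4 = 2 + 2 :> R); last by ring.
have half (B : {fset int}) : {in B &, injective absz} -> \sum_(n <- B) inv_sq n <= 2.
  move=> inj; rewrite (le_trans _ (Hnat [fset absz n | n in B]))// big_imfset//=.
by apply: lerD; apply: half => x y; rewrite !inE => /andP[_ ?] /andP[_ ?] /=; lia.
Qed.

Definition inv_sq2 (n : int * int) : R := inv_sq n.1 * inv_sq n.2.

Lemma inv_sq2_ge0 n : 0 <= inv_sq2 n.
Proof. by rewrite mulr_ge0 ?inv_sq_ge0. Qed.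

Lemma bounded_inv_sq2 : bounded_sums inv_sq2 16.
Proof.
move=> A; pose A1 := [fset x.1 | x in A]; pose A2 := [fset x.2 | x in A].
have h : \sum_(n <- A) inv_sq2 n <= \sum_(n <- [fset ((a, b) : int * int)%type | a in A1, b in A2]) inv_sq2 n.
  apply: ler_sum_fset_subset; first exact: inv_sq2_ge0.
  apply/fsubsetP => -[a b] abA; apply/imfset2P; exists a.
    by apply/imfsetP; exists (a, b).
  by exists b => //; apply/imfsetP; exists (a, b).
apply: (le_trans h).
rewrite big_imfset2/=; last by move=> [? ?] [? ?] _ _ [-> ->].
rewrite /inv_sq2/=. under eq_bigr do rewrite -mulr_sumr. rewrite -mulr_suml.
have -> : 16 = 4 * 4 :> R by ring.
by rewrite ler_pM ?bounded_inv_sq// sumr_ge0// => *; apply: inv_sq_ge0.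
Qed.

(** Dominated convergence for finite sums over growing index sets. Beyond a finite set the majorant
    leaves less than e / 2, and on that set convergence is uniform. It turns the exact discrete
    inversion formulas into a Fourier series. *)
Lemma tannery I (c : nat -> I -> C) (a : I -> C) (w : I -> R) (S : nat -> {fset I}) M f :
  (forall i, 0 <= w i) -> bounded_sums w M ->
  (forall k i, i \in S k -> normc (c k i) <= w i) ->
  (forall i, normc (a i) <= w i) ->
  (forall i (e : R), 0 < e -> exists K, forall k, (K <= k)%N -> normc (c k i - a i) < e) ->
  (forall A : {fset I}, exists K, forall k, (K <= k)%N -> A `<=` S k) ->
  (forall k, \sum_(i <- S k) c k i = f) ->
  usum a f.
Proof.
move=> w0 HM Hc Ha Hlim HS Hf e e0; have e2 : 0 < e / 2 by rewrite divr_gt0.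
have [A0 HA0] := bounded_sums_tail w0 HM e2; exists A0 => A sA.
have [K1 HK1] := HS A.
have [K2 HK2] : exists K, forall k, (K <= k)%N ->
    \sum_(i <- A) normc (c k i - a i) < e / 2.
  elim: (A : seq I) (e / 2) e2 => [|x s IH] d d0; first by exists 0%N => k _; rewrite big_nil.
  have d2 : 0 < d / 2 by rewrite divr_gt0.
  have [K1' H1] := IH _ d2; have [K2 H2] := Hlim x _ d2.
  exists (maxn K1' K2) => k; rewrite geq_max big_cons => /andP[/H1 h1 /H2 h2].
  by rewrite [d]splitr ltrD.
have Ak := HK1 _ (leq_maxl K1 K2); have hk := HK2 _ (leq_maxr K1 K2).
move: (maxn K1 K2) Ak hk => k Ak hk.
rewrite -(Hf k) (big_fsetID _ (mem A) (S k))/=.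
have -> : [fset x in S k | x \in A] = A.
  by apply/fsetP => x; rewrite !inE andbC; case xA : (x \in A) => //=; apply: (fsubsetP Ak).
rewrite opprD addrA (le_lt_trans (le_normcB _ _))// [e]splitr ltrD//.
  rewrite normcB -sumrB (le_lt_trans (normc_sum _ _ _))//.
apply: le_lt_trans (normc_sum _ _ _) _.
apply: le_lt_trans (HA0 A sA [fset x in S k | x \notin A] _).
  by rewrite [X in _ <= X]big_seq big_seq ler_sum// => i; rewrite !inE => /andP[iS _]; apply: Hc.
by apply/fdisjointP => x xA; rewrite !inE xA andbF.
Qed.

End UnorderedSums.

(** * Functions with uniformly quadratic Taylor remainder *)

Section QuadraticallyDifferentiable.
Variable R : realType.
Local Notation C := R[i].
Implicit Types (f g : C -> C) (z w a b : C) (d K : R).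

(* The Taylor coefficient [a] is bounded but is not required to be a function
   of [z]: this is what makes the notion stable under normally convergent sums. *)
Definition taylor_bound f z d K := normc (f z) <= K /\
  exists a, normc a <= K /\
    forall w, normc w < d -> normc (f (z + w) - f z - a * w) <= K * normc w ^+ 2.

(** One radius serves for centres and increments, and one constant for value, coefficient and
    remainder; closure under sums, products and composition then reduces to bookkeeping with a
    single pair (d, K). *)
Definition hol_bound f z0 d K := forall z, normc (z - z0) < d -> taylor_bound f z d K.

Definition hol f z0 := exists d K, 0 < d /\ hol_bound f z0 d K.

Lemma taylor_bound_mono f z d K d' K' : d' <= d -> K <= K' ->
  taylor_bound f z d K -> taylor_bound f z d' K'.
Proof.
move=> dd KK [fz [a [aK Ha]]]; split; first exact: le_trans KK.
exists a; split; first exact: le_trans KK.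
move=> w wd; rewrite (le_trans (Ha w (lt_le_trans wd dd)))//.
by rewrite ler_wpM2r// exprn_ge0// normc_ge0.
Qed.

Lemma hol_bound_mono f z0 d K d' K' : d' <= d -> K <= K' ->
  hol_bound f z0 d K -> hol_bound f z0 d' K'.
Proof.
move=> dd KK H z zd; apply: (taylor_bound_mono dd KK).
exact: H (lt_le_trans zd dd).
Qed.

Lemma hol_common_bound f g z0 z1 : hol f z0 -> hol g z1 ->
  exists d K, [/\ 0 < d, d <= 1, 1 <= K, hol_bound f z0 d K & hol_bound g z1 d K].
Proof.
move=> [d [K [d0 H]]] [d' [K' [d0' H']]].
exists (Num.min (Num.min d d') 1), (Num.max (Num.max K K') 1); split.
- by rewrite !lt_min d0 d0' ltr01.
- by rewrite ge_min lexx orbT.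
- by rewrite le_max lexx orbT.
- by apply: hol_bound_mono H; rewrite ?ge_min ?le_max lexx.
- by apply: hol_bound_mono H'; rewrite ?ge_min ?le_max lexx ?orbT.
Qed.

Lemma hol_bound_shift f z0 d K z w : d <= 1 -> hol_bound f z0 d K ->
  normc (z - z0) < d -> normc w < d -> normc (f (z + w) - f z) <= 2 * K * normc w.
Proof.
move=> d1 H zd wd; have [fz [a [aK /(_ w wd) Ha]]] := H z zd.
have K0 : 0 <= K := le_trans (normc_ge0 _) fz.
have -> : f (z + w) - f z = (f (z + w) - f z - a * w) + a * w by ring.
have w0 := normc_ge0 w.
rewrite (le_trans (le_normcD _ _))// normcM.
have h1 : normc a * normc w <= K * normc w by rewrite ler_wpM2r.
have h2 : K * normc w ^+ 2 <= K * normc w.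
  by rewrite ler_wpM2l// expr2 ler_piMl// (le_trans (ltW wd)).
by lra.
Qed.

Lemma eq_hol f g z0 (r : R) : 0 < r ->
  (forall z, normc (z - z0) < r -> f z = g z) -> hol f z0 -> hol g z0.
Proof.
move=> r0 E [d [K [d0 H]]].
have m0 : 0 < Num.min d (r / 2) by rewrite lt_min d0 divr_gt0.
exists (Num.min d (r / 2)), K; split => // z.
rewrite lt_min => /andP[zd zr].
have Ez : f z = g z by apply: E; lra.
have [fz [a [aK Ha]]] := H z zd; rewrite /taylor_bound -Ez.
split => //; exists a; split => // w.
rewrite lt_min => /andP[wd wr]; rewrite -E ?Ha//.
rewrite addrAC (le_lt_trans (le_normcD _ _))//; lra.
Qed.

Lemma hol_cst c z0 : hol (fun=> c) z0.
Proof.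
exists 1, (normc c); split => // z _; split => //; exists 0.
rewrite normc0 normc_ge0; split => // w _.
by rewrite subrr mul0r subr0 normc0 mulr_ge0 ?normc_ge0 ?exprn_ge0 ?normc_ge0.
Qed.

Lemma hol_id z0 : hol id z0.
Proof.
exists 1, (normc z0 + 1); split => // z z1; split.
  rewrite -{1}(subrK z0 z) addrC (le_trans (le_normcD _ _))//.
  by rewrite lerD2l ltW.
exists 1; rewrite normc1 lerDr normc_ge0; split => // w _.
rewrite (_ : z + w - z - 1 * w = 0) ?normc0; last by ring.
by rewrite mulr_ge0 ?addr_ge0 ?normc_ge0 ?exprn_ge0 ?normc_ge0.
Qed.

Lemma holD f g z0 : hol f z0 -> hol g z0 -> hol (fun z => f z + g z) z0.
Proof.
move=> Hf Hg; have [d [K [d0 d1 K1 {}Hf {}Hg]]] := hol_common_bound Hf Hg.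
exists d, (2 * K); split => // z zd.
have [fz [a [aK Ha]]] := Hf z zd; have [gz [b [bK Hb]]] := Hg z zd.
split; first by rewrite (le_trans (le_normcD _ _))//; lra.
exists (a + b); split; first by rewrite (le_trans (le_normcD _ _))//; lra.
move=> w wd; have := Ha w wd; have := Hb w wd => h1 h2.
have -> : f (z + w) + g (z + w) - (f z + g z) - (a + b) * w =
  (f (z + w) - f z - a * w) + (g (z + w) - g z - b * w) by ring.
by rewrite (le_trans (le_normcD _ _))//; lra.
Qed.

Lemma holM f g z0 : hol f z0 -> hol g z0 -> hol (fun z => f z * g z) z0.
Proof.
move=> Hf Hg; have [d [K [d0 d1 K1 {}Hf {}Hg]]] := hol_common_bound Hf Hg.
exists (d / 2), (4 * K ^+ 2); split; first by lra.
move=> z zd'; have zd : normc (z - z0) < d by lra.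
have [fz [a [aK Ha]]] := Hf z zd; have [gz [b [bK Hb]]] := Hg z zd.
have K0 : 0 <= K by lra.
have KK : 0 <= K ^+ 2 by rewrite exprn_ge0.
have fg : normc (f z) * normc (g z) <= K ^+ 2 by rewrite ler_pM ?normc_ge0.
split; first by rewrite normcM; lra.
exists (a * g z + f z * b); split.
  rewrite (le_trans (le_normcD _ _))// !normcM.
  have : normc a * normc (g z) <= K ^+ 2 by rewrite ler_pM ?normc_ge0.
  have : normc (f z) * normc b <= K ^+ 2 by rewrite ler_pM ?normc_ge0.
  by lra.
move=> w wd'; have wd : normc w < d by lra.
have [gw _] : normc (g (z + w)) <= K /\ True.
  split=> //; apply: (Hg (z + w) _).1.
  by rewrite addrAC (le_lt_trans (le_normcD _ _))//; lra.
have -> : f (z + w) * g (z + w) - f z * g z - (a * g z + f z * b) * w =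
  (f (z + w) - f z - a * w) * g (z + w) + f z * (g (z + w) - g z - b * w)
  + a * w * (g (z + w) - g z) by ring.
have w0 := normc_ge0 w.
have h1 : normc ((f (z + w) - f z - a * w) * g (z + w)) <= K * normc w ^+ 2 * K.
  by rewrite normcM ler_pM ?normc_ge0 ?Ha.
have h2 : normc (f z * (g (z + w) - g z - b * w)) <= K * (K * normc w ^+ 2).
  by rewrite normcM ler_pM ?normc_ge0 ?Hb.
have h3 : normc (a * w * (g (z + w) - g z)) <= K * normc w * (2 * K * normc w).
  rewrite !normcM; apply: ler_pM; rewrite ?mulr_ge0 ?normc_ge0//.
    by rewrite ler_wpM2r.
  exact: hol_bound_shift d1 Hg zd wd.
rewrite (le_trans (le_normcD _ _))//.
have := le_normcD ((f (z + w) - f z - a * w) * g (z + w)) (f z * (g (z + w) - g z - b * w)).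
by lra.
Qed.

Lemma hol_comp f g z0 : hol g z0 -> hol f (g z0) -> hol (fun z => f (g z)) z0.
Proof.
move=> Hg Hf; have [d [K [d0 d1 K1 {}Hg {}Hf]]] := hol_common_bound Hg Hf.
have K0 : 0 < 2 * K by lra.
have e0 : 0 < d / (2 * K) by rewrite divr_gt0.
have ed : d / (2 * K) <= d by rewrite ler_pdivrMr// ler_peMr//; lra.
have hsmall w : normc w < d / (2 * K) -> 2 * K * normc w < d.
  by rewrite ltr_pdivlMr// mulrC.
(* 2 K is a Lipschitz constant of [g], so increments below d / (2 K) are moved by less than d. The
   remainder is K (2 K)^2 from [f] plus K K from [g], at most 5 K^3. *)
exists (d / (2 * K)), (5 * K ^+ 3); split => // z zd'.
have zd := lt_le_trans zd' ed.
have [gz [b [bK Hb]]] := Hg z zd.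
have gzd : normc (g z - g z0) < d.
  have -> : z = z0 + (z - z0) by ring.
  apply: le_lt_trans (hsmall _ zd').
  by apply: hol_bound_shift d1 Hg _ zd; rewrite subrr normc0.
have [fz [a [aK Ha]]] := Hf _ gzd.
have K2 : K <= K ^+ 2 by rewrite expr2 ler_peMr//; lra.
have K3 : K ^+ 2 <= K ^+ 3 by rewrite (exprS _ 2) ler_peMl ?exprn_ge0//; lra.
split; first by lra.
exists (a * b); split.
  rewrite normcM; have : normc a * normc b <= K ^+ 2 by rewrite ler_pM ?normc_ge0.
  by lra.
move=> w wd'; have wd := lt_le_trans wd' ed.
set D := g (z + w) - g z.
have hD : normc D <= 2 * K * normc w := hol_bound_shift d1 Hg zd wd.
have Dd : normc D < d := le_lt_trans hD (hsmall _ wd').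
have -> : f (g (z + w)) - f (g z) - a * b * w =
    (f (g z + D) - f (g z) - a * D) + a * (D - b * w).
  by rewrite /D [g z + _]addrC subrK; ring.
rewrite (le_trans (le_normcD _ _))//.
have w0 := normc_ge0 w.
have h1 : normc (f (g z + D) - f (g z) - a * D) <= K * (2 * K * normc w) ^+ 2.
  by rewrite (le_trans (Ha _ Dd))// ler_wpM2l//; [lra|rewrite ler_pXn2r ?nnegrE ?normc_ge0// mulr_ge0// ltW].
have h2 : normc (a * (D - b * w)) <= K * (K * normc w ^+ 2).
  by rewrite normcM ler_pM ?normc_ge0 ?Hb.
have h3 : K ^+ 2 * normc w ^+ 2 <= K ^+ 3 * normc w ^+ 2 by rewrite ler_wpM2r// exprn_ge0.
apply: le_trans (lerD h1 h2) _.
rewrite !exprMn_comm; [|exact: mulrC..].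
have -> : K * (2 ^+ 2 * K ^+ 2 * normc w ^+ 2) + K * (K * normc w ^+ 2) =
  4 * (K ^+ 3 * normc w ^+ 2) + K ^+ 2 * normc w ^+ 2 by ring.
by lra.
Qed.

Lemma hol_inv z0 : z0 != 0 -> hol (fun z => z^-1) z0.
Proof.
move=> z00; have r0 : 0 < normc z0 by rewrite normc_gt0.
set r := normc z0 in r0 *; pose s : R := 2 / r.
have s0 : 0 < s by rewrite divr_gt0.
have Hs z : normc (z - z0) < r / 2 -> z != 0 /\ normc (z^-1) <= s.
  move=> h; have := lerB_normc z0 (z0 - z).
  rewrite (_ : z0 - (z0 - z) = z); last by ring.
  rewrite normcB -/r in h *; rewrite normcB in h * => h'.
  have zr : r / 2 < normc z by lra.
  have z0' : 0 < normc z by lra.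
  split; first by rewrite -normc_gt0.
  by rewrite normcV /s -invf_div lef_pV2 ?posrE//; [lra|rewrite divr_gt0].
(* With centres and increments below r / 4 the point z + w stays in the disc of radius r / 2 about
   [z0], where inverses are bounded by s = 2 / r. *)
exists (r / 4), (s + s ^+ 2 + s ^+ 3); split; first by lra.
have [p2 p3] : 0 < s ^+ 2 /\ 0 < s ^+ 3 by rewrite !exprn_gt0.
move=> z zd; have [zn zs] : z != 0 /\ normc (z^-1) <= s by apply: Hs; lra.
split; first by lra.
exists (- (z^-1 ^+ 2)); split.
  rewrite normcN normcX; have : normc z^-1 ^+ 2 <= s ^+ 2.
    by rewrite ler_pXn2r ?nnegrE ?normc_ge0// ltW.
  by lra.
move=> w wd; have [zwn zws] : z + w != 0 /\ normc ((z + w)^-1) <= s.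
  by apply: Hs; rewrite addrAC (le_lt_trans (le_normcD _ _))//; lra.
have -> : (z + w)^-1 - z^-1 - - z^-1 ^+ 2 * w = (z^-1) ^+ 2 * (z + w)^-1 * w ^+ 2.
  by field; rewrite zn zwn.
rewrite normcM normcX ler_wpM2r ?exprn_ge0 ?normc_ge0// normcM normcX.
have : normc z^-1 ^+ 2 * normc (z + w)^-1 <= s ^+ 2 * s.
  by rewrite ler_pM ?exprn_ge0 ?normc_ge0// ler_pXn2r ?nnegrE ?normc_ge0// ltW.
by rewrite -exprSr; lra.
Qed.

Lemma hol_e2pi z0 : hol (@e2pi R) z0.
Proof.
pose c : C := (2 * pi)%:C * 'i.
have p0 : 0 < 2 * pi :> R by rewrite mulr_gt0// pi_gt0.
have nc : normc c = 2 * pi.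
  by rewrite /c normcM normc_real gtr0_norm// /= expr0n add0r expr1n sqrtr1 mulr1.
pose M : R := expR (2 * pi * (`|Im z0| + 1)).
have M0 : 0 < M := expR_gt0 _.
(* |w| < 1 / (4 pi) gives |2 pi i w| <= 1 / 2, the range of [cexp_taylor]; the bound 1 keeps Im z
   close to Im z0, so that [M] bounds the exponential. *)
pose d : R := Num.min 1 ((4 * pi)^-1).
have d0 : 0 < d by rewrite lt_min ltr01 invr_gt0 mulr_gt0// pi_gt0.
exists d, (M * (1 + 2 * pi + 16 * (2 * pi) ^+ 2)); split => // z.
rewrite lt_min => /andP[z1 _].
have pp : 0 < (2 * pi : R) ^+ 2 by rewrite exprn_gt0.
have eM : normc (e2pi z) <= M.
  rewrite normc_e2pi ler_expR -mulrN ler_wpM2l ?(ltW p0)//.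
  have := Im_normc (z - z0); rewrite ImD ImN.
  have := ler_norm (- Im z0); rewrite normrN.
  rewrite ler_norml => h1 /andP[h2 _]; lra.
split; first by rewrite (le_trans eM)// ler_peMr ?(ltW M0)//; lra.
exists (e2pi z * c); split.
  by rewrite normcM nc ler_pM ?normc_ge0 ?(ltW p0)//; lra.
move=> w; rewrite lt_min => /andP[_ w1].
have wc : normc (c * w) <= 1 / 2.
  rewrite normcM nc; move: w1; rewrite -[_^-1]mul1r ltr_pdivlMr; last by rewrite mulr_gt0// pi_gt0.
  by lra.
have -> : e2pi (z + w) - e2pi z - e2pi z * c * w = e2pi z * (cexp (c * w) - 1 - c * w).
  by rewrite e2piD {2}/e2pi -/c; ring.
have := cexp_taylor wc; rewrite [normc (c * w)]normcM nc exprMn => h.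
rewrite normcM -[leRHS]mulrA ler_pM ?normc_ge0// (le_trans h)//.
by rewrite mulrA ler_wpM2r ?exprn_ge0 ?normc_ge0//; lra.
Qed.

Lemma hol_sum (I : Type) (r : seq I) (P : pred I) (f : I -> C -> C) z0 :
  (forall i, P i -> hol (f i) z0) -> hol (fun z => \sum_(i <- r | P i) f i z) z0.
Proof.
move=> H; elim: r => [|i r IH].
  by apply: (eq_hol ltr01 _ (hol_cst 0 z0)) => z _; rewrite big_nil.
have [Pi|Pi] := boolP (P i); last first.
  by apply: (eq_hol ltr01 _ IH) => z _; rewrite big_cons (negbTE Pi).
by apply: (eq_hol ltr01 _ (holD (H i Pi) IH)) => z _; rewrite big_cons Pi.
Qed.

Lemma hol_prod (I : Type) (r : seq I) (P : pred I) (f : I -> C -> C) z0 :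
  (forall i, P i -> hol (f i) z0) -> hol (fun z => \prod_(i <- r | P i) f i z) z0.
Proof.
move=> H; elim: r => [|i r IH].
  by apply: (eq_hol ltr01 _ (hol_cst 1 z0)) => z _; rewrite big_nil.
have [Pi|Pi] := boolP (P i); last first.
  by apply: (eq_hol ltr01 _ IH) => z _; rewrite big_cons (negbTE Pi).
by apply: (eq_hol ltr01 _ (holM (H i Pi) IH)) => z _; rewrite big_cons Pi.
Qed.

Lemma holX f n z0 : hol f z0 -> hol (fun z => f z ^+ n) z0.
Proof.
move=> H; apply: (eq_hol ltr01 _ (@hol_prod 'I_n (index_enum _) predT (fun=> f) z0 _)) => // z _.
by rewrite prodr_const card_ord.
Qed.

Lemma holN f z0 : hol f z0 -> hol (fun z => - f z) z0.
Proof.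
move=> H; apply: (eq_hol ltr01 _ (holM (hol_cst (-1) z0) H)) => z _.
by rewrite mulN1r.
Qed.

(** The bridge to the notion of holomorphy in the definitions; all other arguments stay with
    [hol]. *)
Lemma hol_derivable f z0 : hol f z0 -> derivable (f : C^o -> C^o) z0 1.
Proof.
move=> [d [K [d0 H]]].
have zz : normc (z0 - z0) < d by rewrite subrr normc0.
have [_ [a [aK Ha]]] := H z0 zz.
apply/cvg_ex; exists (a : C^o); apply/cvgrPdist_lt => _ /ltcR0[e e0 ->].
have K0 : 0 <= K := le_trans (normc_ge0 _) aK.
have K10 : 0 < K + 1 by lra.
apply/nbhs_ballP => /=; exists (Num.min d (e / (K + 1)))%:C.
  by rewrite /= ltcR lt_min d0 divr_gt0.
move=> h /=; rewrite /ball/= sub0r normrN normcE_real ltcR lt_min ltr_pdivlMr// => /andP[hd he] h0.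
have := Ha h hd; have n0 : 0 < normc h by rewrite normc_gt0.
have -> : a - h^-1 *: (f (h *: 1 + z0) - f z0) =
  - (h^-1 * (f (z0 + h) - f z0 - a * h)) :> C.
  rewrite /GRing.scale/= mulr1 [h + z0]addrC; field.
  exact: h0.
rewrite normrN normcE_real ltcR normcM normcV -ltr_pdivlMl ?invr_gt0// invrK.
move=> h1; apply: le_lt_trans h1 _.
have : normc h * (normc h * (K + 1)) < normc h * e by rewrite ltr_pM2l.
have := sqr_ge0 (normc h); nra.
Qed.

End QuadraticallyDifferentiable.

(** * Dyadic limits and gluing along a segment *)

Section NatSums.
Variable R : realType.
Local Notation C := R[i].

Lemma bounded_sums_nat (w : nat -> R) M : (forall k, 0 <= w k) ->
  (forall N, \sum_(k < N) w k <= M) -> bounded_sums w M.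
Proof.
move=> w0 H A; pose N := (\max_(k <- A) k).+1.
apply: (@le_trans _ _ (\sum_(k <- [fset (val k) | k in 'I_N]%fset) w k)).
  apply: ler_sum_fset_subset => //.
  apply/fsubsetP => k kA; have kN : (k < N)%N.
    by rewrite ltnS; apply: (leq_bigmax_seq (F := id)).
  by apply/imfsetP; exists (Ordinal kN).
rewrite big_imfset/=; last by move=> x y _ _ /val_inj.
by rewrite big_enum.
Qed.

Lemma usum_nat_cvg (f : nat -> C) l : usum f l -> forall e : R, 0 < e ->
  exists K, forall N, (K <= N)%N -> normc (\sum_(k < N) f k - l) < e.
Proof.
move=> H e e0; have [A HA] := H e e0; exists (\max_(k <- A) k).+1 => N hN.
have -> : \sum_(k < N) f k = \sum_(k <- [fset (val k) | k in 'I_N]%fset) f k.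
  rewrite big_imfset/=; last by move=> x y _ _ /val_inj.
  by rewrite big_enum.
apply: HA; apply/fsubsetP => k kA; have kN : (k < N)%N.
  by apply: leq_trans hN; rewrite ltnS; apply: (leq_bigmax_seq (F := id)).
by apply/imfsetP; exists (Ordinal kN).
Qed.

Lemma bounded_geometric (c : R) : 0 <= c -> bounded_sums (fun k : nat => c * 2 ^- k) (2 * c).
Proof.
move=> c0; apply: bounded_sums_nat => [k|N]; first by rewrite mulr_ge0// invr_ge0 exprn_ge0.
rewrite -mulr_sumr mulrC ler_wpM2r//.
suff -> : \sum_(k < N) (2 ^- k : R) = 2 - 2 * 2 ^- N.
  by rewrite gerBl mulr_ge0// invr_ge0 exprn_ge0.
elim: N => [|N IH]; first by rewrite big_ord0 expr0 invr1 mulr1 subrr.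
by rewrite big_ord_recr/= IH exprS invfM; field; rewrite expf_neq0.
Qed.

Lemma dyadic_limit (u : nat -> C) (c : R) k0 : 0 <= c ->
  (forall k, (k0 <= k)%N -> normc (u k.+1 - u k) <= c * 2 ^- k) ->
  exists l, forall e : R, 0 < e -> exists K, forall k, (K <= k)%N -> normc (u k - l) < e.
Proof.
move=> c0 H; have [//|l Hl] := @usum_exists R _ (fun k => u (k0 + k).+1 - u (k0 + k)%N)
  (fun k => c * 2 ^- k) (2 * c) _ (bounded_geometric c0).
  move=> k; rewrite (le_trans (H _ (leq_addr _ _)))// ler_wpM2l// lef_pV2 ?posrE ?exprn_gt0//.
  by rewrite -!natrX ler_nat leq_exp2l// leq_addl.
exists (u k0 + l) => e e0; have [K HK] := usum_nat_cvg Hl e0.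
exists (k0 + K)%N => k hk; have /HK : (K <= k - k0)%N by rewrite leq_subRL ?(leq_trans (leq_addr _ _) hk).
rewrite (_ : \sum_(_ < _) _ = u k - u k0); first by rewrite opprD addrA.
have tel n : \sum_(i < n) (u (k0 + i).+1 - u (k0 + i)%N) = u (k0 + n)%N - u k0.
  elim: n => [|n IH]; first by rewrite big_ord0 addn0 subrr.
  by rewrite big_ord_recr/= IH addnS; ring.
by rewrite tel subnKC// (leq_trans (leq_addr _ _) hk).
Qed.

(** Compactness of the unit interval as an induction principle: the supremum of the end points
    reachable from 0 is itself reachable, and is 1 by the local hypothesis. It gives uniform bounds
    in [hol_strip] and constancy along a segment in [avg_limit_cst]. *)
Lemma segment_ind (P : R -> R -> Prop) :
  (forall x, 0 <= x <= 1 -> exists2 d, 0 < d &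
     forall a b, x - d < a -> a <= b -> b < x + d -> P a b) ->
  (forall a b c, a <= b -> b <= c -> P a b -> P b c -> P a c) -> P 0 1.
Proof.
move=> loc glue; pose S := [set x : R | 0 <= x <= 1 /\ P 0 x].
have S0 : S 0.
  have [|d d0 H] := loc 0; first by rewrite lexx ler01.
  by split; [rewrite lexx ler01|apply: H; lra].
have supS : has_sup S by split; [exists 0|exists 1 => x [/andP[]]].
have s01 : 0 <= sup S <= 1.
  by rewrite ub_le_sup//=; [apply: ge_sup; [exists 0|move=> x [/andP[]]]|case: supS].
have [d d0 H] := loc _ s01; have [x [/andP[x0 x1] Px] hx] := sup_adherent d0 supS.
have xs : x <= sup S by apply: ub_le_sup; [case: supS|split; rewrite ?x0].
case/andP: s01 => s0 s1.
pose y := Num.min 1 (sup S + d / 2).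
have xy : x <= y by rewrite le_min x1; lra.
have yd : y < sup S + d by rewrite gt_min; apply/orP; right; lra.
have Py : P 0 y by apply: glue Px _ => //; apply: H.
have Sy : S y by split => //; rewrite (le_trans x0 xy) ge_min lexx.
have : y <= sup S by apply: ub_le_sup => //; case: supS.
rewrite ge_min => /orP[h|]; last by lra.
suff -> : 1 = y :> R by [].
by apply/eqP; rewrite eq_le ge_min lexx andbT le_min lexx; lra.
Qed.

End NatSums.

(** * Fourier expansion of periodic functions *)

Section Averages.
Variable R : realType.
Local Notation C := R[i].

Definition strip_bound (G : C -> C) (y d K : R) := forall z : C,
  `|Im z - y| < d -> taylor_bound G z d K.

Lemma strip_hol_bound G y d K z : strip_bound G y d K -> Im z = y ->
  hol_bound G z d K.
Proof.
move=> H Ez z' zd; apply: H; apply: le_lt_trans zd.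
by rewrite -Ez -ImN -ImD Im_normc.
Qed.

Definition periodic1 (G : C -> C) := forall z, G (z + 1) = G z.

Lemma periodic1_int G (n : int) z : periodic1 G -> G (z + n%:~R) = G z.
Proof.
move=> per; have pn k x : G (x + k%:R) = G x.
  by elim: k => [|k IH]; rewrite ?addr0// -natr1 addrA per.
case: n => k; first by rewrite -pmulrn pn.
by rewrite NegzE rmorphN/= -[LHS](pn k.+1) -pmulrn subrK.
Qed.

(** Compactness of one period of the line Im z = y makes the local constants uniform for 0 <= Re z
    <= 1; periodicity carries them to the whole strip. *)
Lemma hol_strip (G : C -> C) (y : R) : periodic1 G ->
  (forall z, 0 < Im z -> hol G z) -> 0 < y ->
  exists d K, [/\ 0 < d, d <= 1, d <= y, 1 <= K & strip_bound G y d K].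
Proof.
move=> per hG y0.
pose Q s t := exists d K, 0 < d /\ forall z, s <= Re z <= t ->
  `|Im z - y| < d -> taylor_bound G z d K.
have [d [K [d0 H]]] : Q 0 1.
  apply: segment_ind => [x _|a b c ab bc [d [K [d0 H]]] [d' [K' [d0' H']]]].
  - have [d [K [d0 Hm]]] := hG (x +i* y) y0.
    exists (d / 2); first by rewrite divr_gt0.
    move=> s t xs st tx; exists (d / 2), K; split; first by rewrite divr_gt0.
    move=> z /andP[sz zt] zy; have zd : normc (z - (x +i* y)) < d.
      rewrite (le_lt_trans (normc_ReIm _))// ReD ImD ReN ImN /= [d]splitr ltrD//.
      by rewrite ltr_norml; lra.
    by apply: taylor_bound_mono (Hm z zd) => //; lra.
  - exists (Num.min d d'), (Num.max K K'); split; first by rewrite lt_min d0.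
    move=> z /andP[az zc]; rewrite lt_min => /andP[zd zd'].
    have [zb|bz] := leP (Re z) b.
      by apply: taylor_bound_mono (H z _ zd); rewrite ?ge_min ?le_max ?lexx// az.
    by apply: taylor_bound_mono (H' z _ zd'); rewrite ?ge_min ?le_max ?lexx ?orbT// zc ltW.
exists (Num.min (Num.min d 1) y), (Num.max K 1); split.
- by rewrite !lt_min d0 ltr01.
- by rewrite !ge_min lexx orbT.
- by rewrite !ge_min lexx orbT.
- by rewrite le_max lexx orbT.
move=> z; rewrite !lt_min => /andP[/andP[zd _] _].
pose n := Num.floor (Re z); pose z' := z - n%:~R.
have Im' : Im z' = Im z.
  by rewrite /z' -(rmorph_int (real_complex R)) ImD ImN/= oppr0 addr0.
have Re' : 0 <= Re z' <= 1.
  rewrite /z' -(rmorph_int (real_complex R)) ReD ReN/=.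
  have := floor_le_tmp (Re z); have := floorD1_gt (Re z).
  by rewrite -/n intrD; lra.
have [|h1 [a [h2 h3]]] := H z' Re'; first by rewrite Im'.
have E x : G (x - n%:~R) = G x by rewrite -rmorphN/= periodic1_int.
rewrite /z' E in h1; split; first by rewrite le_max h1.
exists a; split; first by rewrite le_max h2.
move=> w; rewrite !lt_min => /andP[/andP[wd _] _].
have := h3 w wd; have -> : z' + w = (z + w) - n%:~R by rewrite /z' addrAC.
rewrite /z' !E => h4; apply: (le_trans h4).
by rewrite ler_wpM2r ?exprn_ge0 ?normc_ge0// le_max lexx.
Qed.

Definition sample (N j : nat) (z : C) : C := z + j%:R / N%:R.

Definition avg (N : nat) (G : C -> C) (z : C) : C :=
  N%:R^-1 * \sum_(j < N) G (sample N j z).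

Lemma Im_sample N j z : Im (sample N j z) = Im z.
Proof.
rewrite /sample -!(rmorph_nat (real_complex R)) -fmorphV -rmorphM ImD /=.
by rewrite addr0.
Qed.

Lemma sum_shift (G : C -> C) N z : periodic1 G -> (0 < N)%N ->
  \sum_(j < N) G (sample N j z + N%:R^-1) = \sum_(j < N) G (sample N j z).
Proof.
move=> per N0; have E j : sample N j z + N%:R^-1 = sample N j.+1 z.
  by rewrite /sample -natr1 mulrDl mul1r addrA.
under eq_bigr do rewrite E.
case: N N0 E => // N _ E; rewrite big_ord_recr big_ord_recl/= addrC; congr (_ + _).
by rewrite /sample divff ?pnatr_eq0// per mul0r addr0.
Qed.

Lemma normc_avg_le N (G : C -> C) z (K : R) : (0 < N)%N ->
  (forall j, (j < N)%N -> normc (G (sample N j z)) <= K) -> normc (avg N G z) <= K.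
Proof.
move=> N0 H; rewrite normcM normcV normc_nat mulrC ler_pdivrMr ?ltr0n//.
rewrite (le_trans (normc_sum _ _ _))//.
apply: (@le_trans _ _ (\sum_(j < N) K)); first by apply: ler_sum => j _; apply: H.
by rewrite sumr_const card_ord mulr_natr.
Qed.

Lemma avgB N (G H : C -> C) z : avg N (fun u => G u - H u) z = avg N G z - avg N H z.
Proof. by rewrite /avg -mulrBr -sumrB. Qed.

(** Doubling the number of sample points changes the mean by half a mean of increments over 1 / (2
    N). These are O(1/N), so means over 2^k points form a Cauchy sequence. *)
Lemma avg_double N (G : C -> C) z : (0 < N)%N ->
  avg (2 * N) G z = avg N G z + 2^-1 * avg N (fun u => G (u + (2 * N)%:R^-1) - G u) z.
Proof.
move=> N0; have dbl M (F : nat -> C) : \sum_(i < 2 * M) F i = \sum_(j < M) (F (2 * j)%N + F (2 * j).+1).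
  elim: M => [|M IH]; first by rewrite muln0 !big_ord0.
  by rewrite mulnS add2n !big_ord_recr/= IH addrA.
have n0 : (N%:R : C) != 0 by rewrite pnatr_eq0 -lt0n.
rewrite avgB /avg (dbl N (fun i => G (sample (2 * N) i z))) big_split/=.
have -> : \sum_(j < N) G (sample (2 * N) (2 * j) z) = \sum_(j < N) G (sample N j z).
  apply: eq_bigr => j _; rewrite /sample; congr (G (_ + _)).
  by rewrite !natrM -mulf_div divff ?mul1r// pnatr_eq0.
have -> : \sum_(j < N) G (sample (2 * N) (2 * j).+1 z) = \sum_(j < N) G (sample N j z + (2 * N)%:R^-1).
  apply: eq_bigr => j _; rewrite /sample; congr (G _).
  by rewrite -natr1 !natrM mulrDl mul1r -mulf_div divff ?mul1r ?pnatr_eq0// addrA.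
by rewrite natrM; field.
Qed.

Section PeriodicHol.
Variable G : C -> C.
Hypothesis per : periodic1 G.
Hypothesis hG : forall z, 0 < Im z -> hol G z.

Lemma invN_small (d : R) : 0 < d -> exists k0, forall k, (k0 <= k)%N -> 2 ^- k < d.
Proof.
move=> d0; exists (Num.truncn d^-1).+1 => k hk.
have d1 : d^-1 < k%:R.
  apply: lt_le_trans (truncnS_gt _) _; by rewrite ler_nat.
rewrite -[d]invrK ltf_pV2 ?posrE ?exprn_gt0 ?invr_gt0// (lt_trans d1)//.
by rewrite -natrX ltr_nat ltn_expl.
Qed.

Lemma avg_limit z : 0 < Im z ->
  exists l, forall e : R, 0 < e -> exists K, forall k, (K <= k)%N ->
    normc (avg (2 ^ k) G z - l) < e.
Proof.
move=> z0; have [d [K [d0 d1 dy K1 H]]] := hol_strip per hG z0.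
have [k0 Hk0] := invN_small d0.
apply: (@dyadic_limit R (fun k => avg (2 ^ k) G z) K k0); first by lra.
move=> k hk; rewrite expnS avg_double ?expn_gt0// [avg _ _ _ + _]addrC addrK.
rewrite normcM normcV normc_nat ler_pdivrMl// mulrA.
apply: normc_avg_le => [|j _]; first by rewrite expn_gt0.
have h2 : normc ((2 * 2 ^ k)%:R^-1 : C) <= 2 ^- k.
  rewrite normcV normc_nat lef_pV2 ?posrE ?exprn_gt0 ?ltr0n ?muln_gt0 ?expn_gt0//.
  by rewrite -natrX ler_nat leq_pmull.
have hb := strip_hol_bound H (Im_sample (2 ^ k) j z).
apply: le_trans (hol_bound_shift d1 hb _ _) _.
- by rewrite subrr normc0.
- exact: le_lt_trans h2 (Hk0 _ hk).
- by rewrite ler_wpM2l//; lra.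
Qed.

(* Over one period the means of the Taylor coefficients telescope to O(1/N),
   so only the quadratic remainder survives in the limit. *)
Lemma avg_limit_flat (l : C -> C) (y : R) : 0 < y ->
  (forall z, 0 < Im z -> forall e : R, 0 < e -> exists K, forall k, (K <= k)%N ->
    normc (avg (2 ^ k) G z - l z) < e) ->
  exists d K, [/\ 0 < d, 1 <= K & forall z, `|Im z - y| < d ->
    forall w, normc w < d -> normc (l (z + w) - l z) <= K * normc w ^+ 2].
Proof.
move=> y0 Hl; have [d [K [d0 d1 dy K1 H]]] := hol_strip per hG y0.
exists (d / 2), K; split => //; first by rewrite divr_gt0.
move=> z zy' w wd'; have wd : normc w < d by lra.
have zy : `|Im z - y| < d by lra.
have zp : 0 < Im z by move: zy; rewrite ltr_norml; lra.
have zwp : 0 < Im (z + w).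
  by have := le_lt_trans (Im_normc w) wd'; rewrite ImD; move: zy'; rewrite !ltr_norml; lra.
have [k0 Hk0] := invN_small d0.
have step k : (k0 <= k)%N ->
    normc (avg (2 ^ k) G (z + w) - avg (2 ^ k) G z) <= K * normc w ^+ 2 + K * normc w * 2 ^- k.
  move=> hk; have N0 : (0 < 2 ^ k)%N by rewrite expn_gt0.
  have nc0 : ((2 ^ k)%:R : C) != 0 by rewrite pnatr_eq0 -lt0n.
  have nN : normc ((2 ^ k)%:R^-1 : C) = 2 ^- k by rewrite normcV normc_nat natrX.
  have /choice[a Ha] : forall u, exists a, `|Im u - y| < d -> normc a <= K /\ forall w, normc w < d ->
    normc (G (u + w) - G u - a * w) <= K * normc w ^+ 2.
    move=> u; case: (pselect (`|Im u - y| < d)) => [h|h]; last by exists 0.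
    by have [_ [a Ha]] := H u h; exists a.
  have Hs j := Ha (sample (2 ^ k) j z) ltac:(by rewrite Im_sample).
  have a_avg : normc (avg (2 ^ k) a z) <= K * 2 ^- k.
    (* The shifted and unshifted values of G cancel by periodicity, which equates the mean of the
       coefficients times 1/N with a mean of quadratic remainders, up to sign. *)
    have E : avg (2 ^ k) (fun u => G (u + (2 ^ k)%:R^-1) - G u - a u * (2 ^ k)%:R^-1) z
       = - (avg (2 ^ k) a z * (2 ^ k)%:R^-1).
      rewrite /avg sumrB sumrB sum_shift// subrr sub0r -mulr_suml.
      by rewrite mulrN mulrA.
    have : normc (avg (2 ^ k) a z * (2 ^ k)%:R^-1) <= K * (2 ^- k) ^+ 2.
      rewrite -normcN -E; apply: normc_avg_le => // j _.
      by rewrite (le_trans ((Hs j).2 _ _)) ?nN//; apply: Hk0.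
    rewrite normcM nN expr2 mulrA ler_pM2r// invr_gt0 exprn_gt0//.
  have -> : avg (2 ^ k) G (z + w) - avg (2 ^ k) G z =
     avg (2 ^ k) (fun u => G (u + w) - G u - a u * w) z + avg (2 ^ k) a z * w.
    rewrite /avg !sumrB -mulr_suml.
    have -> : \sum_(j < 2 ^ k) G (sample (2 ^ k) j (z + w)) = \sum_(j < 2 ^ k) G (sample (2 ^ k) j z + w).
      by apply: eq_bigr => j _; rewrite /sample addrAC.
    by ring.
  rewrite (le_trans (le_normcD _ _))// lerD//.
    by apply: normc_avg_le => // j _; apply: (Hs j).2.
  by rewrite normcM mulrAC ler_wpM2r// normc_ge0.
apply/ler_addgt0Pr => e e0.
have w0 := normc_ge0 w.
have e3 : 0 < e / 3 by rewrite divr_gt0.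
have [K1' HK1'] := Hl _ zp _ e3; have [K2 HK2] := Hl _ zwp _ e3.
have Kw : 0 < K * normc w + 1 by rewrite ltr_wpDl// mulr_ge0//; lra.
have [k1 Hk1] := invN_small (divr_gt0 e3 Kw).
pose k := maxn (maxn K1' K2) (maxn k0 k1).
have h1 := HK1' k ltac:(by rewrite !leq_max leqnn).
have h2 := HK2 k ltac:(by rewrite !leq_max leqnn orbT).
have h3 := step k ltac:(by rewrite !leq_max leqnn !orbT).
have := Hk1 k ltac:(by rewrite !leq_max leqnn !orbT).
rewrite ltr_pdivlMr// mulrDr mulr1 => h4.
have p2 : 0 < (2 : R) ^- k by rewrite invr_gt0 exprn_gt0.
have := le_normc_trans (l (z + w)) (avg (2 ^ k) G (z + w)) (l z).
have := le_normc_trans (avg (2 ^ k) G (z + w)) (avg (2 ^ k) G z) (l z).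
rewrite [normc (l (z + w) - avg _ _ _)]normcB => h5 h6.
by rewrite [2 ^- k * _]mulrC in h4; lra.
Qed.

(** By [avg_limit_flat] the limit has quadratically small increments. Cutting the segment from i to
    z into short pieces bounds the total change by e times its parameter length, for every e > 0. *)
Lemma avg_limit_cst : exists l, forall z, 0 < Im z ->
  forall e : R, 0 < e -> exists K, forall k, (K <= k)%N ->
    normc (avg (2 ^ k) G z - l) < e.
Proof.
have /choice[l Hl] : forall z, exists l, 0 < Im z -> forall e : R, 0 < e ->
    exists K, forall k, (K <= k)%N -> normc (avg (2 ^ k) G z - l) < e.
  move=> z; case: (pselect (0 < Im z)) => [/avg_limit[l Hl]|h]; last by exists 0.
  by exists l.
suff cst z : 0 < Im z -> l z = l 'i.
  by exists (l 'i) => z z0; rewrite -(cst z z0); apply: Hl.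
move=> z0; pose g (s : R) := 'i + s%:C * (z - 'i).
have Img s : Im (g s) = 1 + s * (Im z - 1).
  by rewrite /g ImD ImMr ImD ImN.
have gD s t : g t = g s + (t - s)%:C * (z - 'i) by rewrite /g rmorphB/=; ring.
suff H e : 0 < e -> normc (l (g 1) - l (g 0)) <= e * (1 - 0).
  have -> : z = g 1 by rewrite /g mul1r addrC subrK.
  have -> : 'i = g 0 by rewrite /g mul0r addr0.
  apply/eqP; rewrite -subr_eq0; apply/eqP/eq0_small => e e0.
  by have := H (e / 2) ltac:(by rewrite divr_gt0); lra.
move=> e0; apply: (@segment_ind R (fun s t => normc (l (g t) - l (g s)) <= e * (t - s))); last first.
  move=> a b c ab bc h1 h2; have := le_normc_trans (l (g c)) (l (g b)) (l (g a)).
  by lra.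
move=> x /andP[x0 x1].
have yx : 0 < Im (g x).
  rewrite Img; have [h|h] := leP (Im z) 1; last by rewrite ltr_wpDr// mulr_ge0//; lra.
  have : x * (1 - Im z) <= 1 * (1 - Im z) by rewrite ler_wpM2r//; lra.
  by lra.
have [d [K [d0 K1 H]]] := avg_limit_flat yx Hl.
pose D := normc (z - 'i) + 1; have D0 : 0 < D by rewrite ltr_wpDl ?normc_ge0.
(* The first bound keeps increments of [g] below d; the second makes K |g b - g a|^2 at most e (b -
   a), as b - a < 2 d'. *)
pose d' := Num.min (d / (2 * D)) (e / (2 * K * D ^+ 2)).
have D2 : 0 < D ^+ 2 by rewrite exprn_gt0.
have d'0 : 0 < d' by rewrite lt_min !divr_gt0//; rewrite ?mulr_gt0//; lra.
exists d' => // a b xa ab bx.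
have nzD : normc (z - 'i) <= D by rewrite lerDl.
have small s t : `|t - s| < 2 * d' -> normc (g t - g s) < d.
  move=> ts; rewrite (gD s t) [g s + _]addrC addrK normcM normc_real.
  have t0 := normr_ge0 (t - s).
  apply: (@le_lt_trans _ _ (`|t - s| * D)); first by rewrite ler_wpM2l.
  have : d' <= d / (2 * D) by rewrite ge_min lexx.
  by rewrite ler_pdivlMr ?mulr_gt0// => h; nra.
have ha : `|Im (g a) - Im (g x)| < d.
  rewrite -ImN -ImD (le_lt_trans (Im_normc _))// small// ltr_norml; lra.
have hb : normc (g b - g a) < d by apply: small; rewrite ltr_norml; lra.
have := H _ ha _ hb; rewrite [g a + _]addrC subrK => /le_trans; apply.
rewrite (gD a b) [g a + _]addrC addrK normcM normc_real exprMn.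
have ba : `|b - a| = b - a by rewrite ger0_norm// subr_ge0.
rewrite ba; have h1 : (b - a) * (2 * K * D ^+ 2) <= 2 * e.
  have : d' <= e / (2 * K * D ^+ 2) by rewrite ge_min lexx orbT.
  have p : 0 < 2 * K * D ^+ 2 by rewrite !mulr_gt0//; lra.
  rewrite ler_pdivlMr// => h.
  have : (b - a) * (2 * K * D ^+ 2) <= 2 * d' * (2 * K * D ^+ 2).
    by rewrite ler_wpM2r ?(ltW p)//; lra.
  by lra.
have h2 : normc (z - 'i) ^+ 2 <= D ^+ 2 by rewrite ler_pXn2r ?nnegrE ?normc_ge0// ltW.
have b0 : 0 <= b - a by lra.
have h3 : K * (b - a) ^+ 2 * normc (z - 'i) ^+ 2 <= K * (b - a) ^+ 2 * D ^+ 2.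
  by rewrite ler_wpM2l// mulr_ge0 ?sqr_ge0//; lra.
have h4 : (b - a) * ((b - a) * (2 * K * D ^+ 2)) <= (b - a) * (2 * e) by rewrite ler_wpM2l.
by nra.
Qed.

End PeriodicHol.
End Averages.

Section Fourier.
Variable R : realType.
Local Notation C := R[i].
Variable f : C -> C.
Hypothesis per : periodic1 f.
Hypothesis hf : forall z, 0 < Im z -> hol f z.

Definition twist (n : int) (z : C) : C := f z * e2pi (- (n%:~R * z)).

Lemma twist_periodic n : periodic1 (twist n).
Proof.
move=> z; rewrite /twist per mulrDr mulr1 opprD e2piD.
by rewrite -rmorphN e2pi_int mulr1.
Qed.

Lemma twist_hol n z : 0 < Im z -> hol (twist n) z.
Proof.
move=> z0; apply: holM; first exact: hf.
apply: (@hol_comp R (@e2pi R) (fun u => - (n%:~R * u))); last exact: hol_e2pi.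
by apply/holN/holM; [exact: hol_cst|exact: hol_id].
Qed.

Lemma e2pi_frac_neq1 (x : R) : 0 < x < 1 -> e2pi x%:C != 1.
Proof.
move=> /andP[x0 x1]; rewrite e2piE /cexp /= mulr0 oppr0 expR0 mul1r eq_complex /=.
rewrite negb_and; apply/orP; left.
have -> : 2 * pi * x = (pi * x) *+ 2 by rewrite -[RHS]mulr_natl mulrA.
rewrite cos_mulr2n cos2sin2.
have : 0 < sin (pi * x).
  apply: sin_gt0_pi; rewrite mulr_gt0 ?pi_gt0//=.
  by rewrite gtr_pMr ?pi_gt0.
move=> /(exprn_gt0 2) h; apply/eqP; lra.
Qed.

Lemma frac_root (N j : nat) : (0 < N)%N ->
  (j%:R / N%:R : C) = (j%:R / N%:R : R)%:C.
Proof. by move=> N0; rewrite rmorphM fmorphV !rmorph_nat. Qed.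

(** A system of residues modulo N centred at 0: it ensures 2 |n| <= N, without which e(n/N) could be
    close to 1 for a large n and [root_dist] would fail. *)
Definition window (N : nat) : {fset int} :=
  [fset (Posz (val i) - Posz N./2) | i in 'I_N]%fset.

Lemma sum_window N (F : int -> C) :
  \sum_(n <- window N) F n = \sum_(i < N) F (Posz i - Posz (N./2)).
Proof.
rewrite big_imfset/=; first by rewrite big_enum.
by move=> x y _ _ h; apply: val_inj => /=; lia.
Qed.

Lemma sum_roots N j : (0 < j)%N -> (j < N)%N ->
  \sum_(n <- window N) e2pi (- (n%:~R * (j%:R / N%:R : C))) = 0.
Proof.
move=> j0 jN; have N0 : (0 < N)%N by apply: leq_ltn_trans jN.
rewrite sum_window; set x : C := j%:R / N%:R.
have E i : e2pi (- ((Posz i - Posz (N./2))%:~R * x)) =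
    e2pi ((N./2)%:R * x) * e2pi (- x) ^+ i.
  rewrite -e2piMn -e2piD; congr e2pi.
  by rewrite rmorphB/= -!pmulrn; ring.
under eq_bigr do rewrite E.
rewrite -mulr_sumr; apply/eqP; rewrite mulf_eq0; apply/orP; right.
have w1 : e2pi (- x) != 1.
  rewrite e2piN invr_eq1 /x frac_root// e2pi_frac_neq1//.
  by rewrite divr_gt0 ?ltr0n//= ltr_pdivrMr ?ltr0n// mul1r ltr_nat.
have wN : e2pi (- x) ^+ N = 1.
  rewrite -e2piMn mulrN /x mulrC divfK ?pnatr_eq0 -?lt0n//.
  by have := e2pi_int R (- Posz j); rewrite rmorphN/= -pmulrn. 
have := subrX1 (e2pi (- x)) N; rewrite wN subrr => /esym/eqP.
by rewrite mulf_eq0 subr_eq0 (negbTE w1).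
Qed.

Definition dft (N : nat) (z : C) (n : int) : C := e2pi (n%:~R * z) * avg N (twist n) z.

(** Orthogonality of the N-th roots of unity: after exchanging the sums only the sample j = 0
    survives. Being exact for every N, it leaves no error term in the limit. *)
Lemma dft_inversion N z : (0 < N)%N -> \sum_(n <- window N) dft N z n = f z.
Proof.
move=> N0; have n0 : (N%:R : C) != 0 by rewrite pnatr_eq0 -lt0n.
have E n : dft N z n = N%:R^-1 * \sum_(j < N) f (sample N j z) * e2pi (- (n%:~R * (j%:R / N%:R))).
  rewrite /dft /avg mulrCA; congr (_ * _); rewrite mulr_sumr; apply: eq_bigr => j _.
  rewrite /twist mulrCA -e2piD /sample; congr (_ * e2pi _); ring.
under eq_bigr do rewrite E.
rewrite -mulr_sumr exchange_big/=.
under eq_bigr do rewrite -mulr_sumr.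
case: N N0 n0 {E} => // N _ n0; rewrite big_ord_recl/= [X in _ * (_ + X)]big1 => [|i _]; last first.
  have := @sum_roots N.+1 (lift ord0 i) isT (ltn_ord _).
  by move=> /= ->; rewrite mulr0.
rewrite addr0 sum_window.
under eq_bigr do rewrite mul0r mulr0 oppr0 e2pi0.
by rewrite sumr_const card_ord mulrCA /sample mul0r addr0 mulVf// mulr1.
Qed.

(** With x = n / N the right side is 4 sin^2(pi x), and |x| <= 1/2 allows sin(pi |x|) >= pi |x| / 8
    >= |x| / 4. *)
Lemma root_dist (n : int) (N : nat) : (0 < N)%N -> (2 * `|n| <= N)%N ->
  ((`|n|%N)%:R / N%:R) ^+ 2 / 4 <=
    normc (e2pi (- (n%:~R / N%:R)) - 2 + e2pi (n%:~R / N%:R : C)).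
Proof.
move=> N0 nN; have Nr : 0 < (N%:R : R) by rewrite ltr0n.
pose x : R := n%:~R / N%:R.
have -> : (n%:~R / N%:R : C) = x%:C by rewrite /x rmorphM fmorphV !rmorph_nat rmorph_int.
have -> : e2pi (- x%:C) - 2 + e2pi x%:C = (- (4 * sin (pi * x) ^+ 2))%:C.
  have Ec y : e2pi y%:C = cos (2 * pi * y) +i* sin (2 * pi * y) :> C.
    by rewrite e2piE /cexp /= mulr0 oppr0 expR0 mul1r.
  rewrite -rmorphN !Ec mulrN cosN sinN.
  have -> : 2 * pi * x = (pi * x) *+ 2 by rewrite -[RHS]mulr_natl mulrA.
  rewrite cos_mulr2n cos2sin2.
  have -> : (2 : C) = (2 : R)%:C by rewrite rmorph_nat.
  by congr (_ +i* _); ring.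
rewrite normc_real normrN ger0_norm; last by apply: mulr_ge0 => //; apply: sqr_ge0.
have -> : sin (pi * x) ^+ 2 = sin (pi * `|x|) ^+ 2.
  have [x0|x0] := leP 0 x; first by rewrite ger0_norm.
  by rewrite ltr0_norm// mulrN sinN sqrrN.
have -> : (`|n|%N)%:R / N%:R = `|x| :> R.
  by rewrite /x normrM normfV (ger0_norm (ler0n R N)) -intr_norm natr_absz.
have x2 : `|x| <= 1 / 2.
  rewrite /x normrM normfV (ger0_norm (ler0n R N)) ler_pdivrMr// -intr_norm -natr_absz.
  by rewrite mul1r ler_pdivlMl// -natrM ler_nat.
have p2 := @pi_ge2 R; have a0 := normr_ge0 x.
have hx : 0 <= pi * `|x| <= pi / 2.
  by rewrite mulr_ge0//=; [rewrite ler_wpM2l//; lra|lra].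
have h := sin_ge_eighth hx; have h1 : `|x| / 4 <= sin (pi * `|x|).
  by apply: le_trans h; have := ler_wpM2r a0 p2; lra.
have : (`|x| / 4) ^+ 2 <= sin (pi * `|x|) ^+ 2.
  by rewrite ler_pXn2r ?nnegrE//; lra.
by rewrite expr_div_n; lra.
Qed.

(* Summation by parts: the discrete Fourier transform of the second difference
   is that of [f] times [e(n/N) - 2 + e(-n/N)], of size at least (n/N)^2 / 4. *)
Lemma dft_bound z : 0 < Im z -> exists k0 K, 0 <= K /\
  forall k n, (k0 <= k)%N -> (2 * `|n| <= 2 ^ k)%N ->
  normc (dft (2 ^ k) z n) <= K * inv_sq R n.
Proof.
move=> z0; have [d [K [d0 d1 dy K1 H]]] := hol_strip per hf z0.
have [k0 Hk0] := invN_small d0.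
have K0 : 0 <= 32 * K by lra.
(* 32 = 8 * 4: the second difference 2 K / N^2 divided by (n/N)^2 / 4 gives 8 K / n^2, and (|n| +
   1)^2 <= 4 n^2 for n <> 0 passes to [inv_sq]. *)
exists k0, (32 * K); split => // k n hk nN.
have N0 : (0 < 2 ^ k)%N by rewrite expn_gt0.
have wd := Hk0 k hk; move: N0 nN wd; rewrite -natrX; move: (2 ^ k)%N => N N0 nN wd.
have Nr : 0 < (N%:R : R) by rewrite ltr0n.
have nc : (N%:R : C) != 0 by rewrite pnatr_eq0 -lt0n.
have nw : normc (N%:R^-1 : C) = N%:R^-1 by rewrite normcV normc_nat.
rewrite /inv_sq; have [->|nn0] := eqVneq n 0.
  rewrite absz0 add0r expr1n invr1 mulr1 /dft mul0r e2pi0 mul1r.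
  apply: normc_avg_le => // j _; rewrite /twist mul0r oppr0 e2pi0 mulr1.
  have := (H (sample N j z) _).1; rewrite Im_sample subrr normr0 => /(_ d0).
  by lra.
have m1 : (1 <= `|n|)%N by rewrite lt0n absz_eq0.
have m1r : 1 <= (`|n|%N)%:R :> R by rewrite (ler_nat _ 1).
pose th : C := e2pi (- (n%:~R / N%:R)).
have thV : e2pi (n%:~R / N%:R : C) = th^-1 by rewrite /th e2piN invrK.
have th0 : th != 0 by rewrite e2pi_neq0.
pose w : C := N%:R^-1.
have D2 u : `|Im u - Im z| < d ->
    normc (f (u + w) - 2 * f u + f (u - w)) <= 2 * K * N%:R ^- 2.
  move=> /H[_ [a [_ Ha]]].
  have h1 := Ha w; have h2 := Ha (- w).
  rewrite normcN nw in h1 h2; move/(_ wd) in h1; move/(_ wd) in h2.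
  have -> : f (u + w) - 2 * f u + f (u - w) =
    (f (u + w) - f u - a * w) + (f (u - w) - f u - a * - w) by ring.
  by rewrite (le_trans (le_normcD _ _))// -exprVn; lra.
have E : (th - 2 + th^-1) * avg N (twist n) z =
   avg N (fun u => (f (u + w) - 2 * f u + f (u - w)) * e2pi (- (n%:~R * u))) z.
  have S1 : avg N (fun u => f (u + w) * e2pi (- (n%:~R * u))) z = th^-1 * avg N (twist n) z.
    rewrite /avg mulrCA -(sum_shift z (twist_periodic n) N0); congr (_ * _).
    rewrite mulr_sumr; apply: eq_bigr => j _; rewrite /twist [RHS]mulrCA -thV -e2piD.
    by congr (_ * e2pi _); rewrite /w; ring.
  have S2 : avg N (fun u => f (u - w) * e2pi (- (n%:~R * u))) z = th * avg N (twist n) z.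
    rewrite /avg mulrCA; congr (_ * _).
    have perT : periodic1 (fun u => twist n (u - w)).
      by move=> u; rewrite addrAC twist_periodic.
    have -> : \sum_(j < N) twist n (sample N j z) = \sum_(j < N) twist n (sample N j z - w).
      rewrite -(sum_shift z perT N0); apply: eq_bigr => j _.
      by rewrite addrK.
    rewrite mulr_sumr; apply: eq_bigr => j _; rewrite /twist [RHS]mulrCA -e2piD.
    by congr (_ * e2pi _); rewrite /w; ring.
  rewrite mulrDl mulrBl -S1 -S2 /avg mulrCA -mulrBr -mulrDr; congr (_ * _).
  rewrite mulr_sumr -sumrB -big_split/=; apply: eq_bigr => j _.
  by rewrite /twist; ring.
have B : normc (avg N (fun u => (f (u + w) - 2 * f u + f (u - w)) * e2pi (- (n%:~R * u))) z)
    <= 2 * K * N%:R ^- 2 * normc (e2pi (- (n%:~R * z))).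
  apply: normc_avg_le => // j _; rewrite normcM ler_pM ?normc_ge0//.
    by apply: D2; rewrite Im_sample subrr normr0.
  rewrite !normc_e2pi !ImN -!(rmorph_int (real_complex R)) !ImMr Im_sample//.
rewrite -E normcM in B.
have := root_dist N0 nN; rewrite thV -/th => rd.
rewrite /dft normcM.
have e1 : normc (e2pi (n%:~R * z)) * normc (e2pi (- (n%:~R * z))) = 1.
  by rewrite -normcM e2piNK normc1.
have e0 : 0 < normc (e2pi (n%:~R * z)) by rewrite normc_gt0 e2pi_neq0.
set a := normc (e2pi (n%:~R * z)) in e1 e0 *.
set b := normc (e2pi _) in B e1 *.
set A := normc (avg _ _ _) in B *.
have A0 : 0 <= A by apply: normc_ge0.
have h1 : ((`|n|%N)%:R / N%:R) ^+ 2 / 4 * A <= 2 * K * N%:R ^- 2 * b.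
  by apply: le_trans B; rewrite ler_wpM2r.
move: m1r h1; set m : R := (`|n|%N)%:R => m1r h1.
have h2 : m ^+ 2 * A <= 8 * K * b.
  have := h1; rewrite expr_div_n.
  have N2 : 0 < (N%:R : R) ^+ 2 by rewrite exprn_gt0.
  rewrite -(ler_pM2r N2) (_ : _ * A * N%:R ^+ 2 = m ^+ 2 * A / 4); last by field; rewrite gt_eqF.
  rewrite (_ : _ * b * N%:R ^+ 2 = 2 * K * b); last by field; rewrite gt_eqF.
  by lra.
have h3 : m ^+ 2 * (a * A) <= 8 * K.
  rewrite mulrCA; have : a * (m ^+ 2 * A) <= a * (8 * K * b) by rewrite ler_wpM2l// ltW.
  by rewrite (_ : a * (8 * K * b) = 8 * K * (a * b)); [rewrite e1 mulr1|ring].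
rewrite ler_pdivlMr ?exprn_gt0//; last by lra.
have aA : 0 <= a * A by rewrite mulr_ge0// ltW.
have : a * A * (m + 1) ^+ 2 <= a * A * (4 * m ^+ 2).
  by rewrite ler_wpM2l//; nra.
by lra.
Qed.

(** The second clause needs a bound on a single horizontal line only, because the coefficients do
    not depend on the height. Letting y vary then removes coefficients: y -> oo gives Taylor
    expansions in a disc, and a well chosen y later excludes exponents at the cusp. *)
Theorem fourier_expansion : exists a : int -> C,
  (forall z, 0 < Im z -> usum (fun n => a n * e2pi (n%:~R * z)) (f z)) /\
  (forall n (y M : R), 0 < y -> (forall x : R, normc (f (x +i* y)) <= M) ->
     normc (a n) <= M * expR (2 * pi * n%:~R * y)).
Proof.
have /choice[a Ha] n := avg_limit_cst (twist_periodic n) (@twist_hol n).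
exists a; split => [z z0|n y M y0 HM]; last first.
  apply/ler_addgt0Pr => e e0; have [k Hk] := Ha n (0 +i* y) y0 e e0.
  have := Hk k (leqnn k); rewrite normcB => h2.
  have := le_normcD (a n - avg (2 ^ k) (twist n) (0 +i* y)) (avg (2 ^ k) (twist n) (0 +i* y)).
  rewrite subrK => h1.
  have : normc (avg (2 ^ k) (twist n) (0 +i* y)) <= M * expR (2 * pi * n%:~R * y).
    apply: normc_avg_le => [|j _]; first by rewrite expn_gt0.
    rewrite normcM; apply: ler_pM; rewrite ?normc_ge0//.
      have := Im_sample (2 ^ k) j (0 +i* y); case: (sample _ _ _) => u v /= ->; exact: HM.
    rewrite normc_e2pi -(rmorph_int (real_complex R)) ImN ImMr Im_sample/=.
    by rewrite ler_expR; lra.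
  by lra.
have [k0 [K [K0 HK]]] := dft_bound z0.
have lim n e : 0 < e -> exists k1, forall k, (k1 <= k)%N ->
    normc (dft (2 ^ (k0 + k)) z n - a n * e2pi (n%:~R * z)) < e.
  move=> e0; have c0 : 0 < normc (e2pi (n%:~R * z)) by rewrite normc_gt0 e2pi_neq0.
  have [k1 Hk1] := Ha n z z0 _ (divr_gt0 e0 c0).
  exists k1 => k hk; have := Hk1 (k0 + k)%N (leq_trans hk (leq_addl _ _)).
  rewrite ltr_pdivlMr// -normcM; congr (normc _ < _).
  by rewrite /dft mulrBl [e2pi _ * avg _ _ _]mulrC.
have big (A : {fset int}) : exists k1, forall k, (k1 <= k)%N -> (A `<=` window (2 ^ (k0 + k)))%fset.
  exists (\max_(n <- A) `|n|%N + 2)%N => k hk; apply/fsubsetP.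
  suff key : forall n : int, n \in A -> n \in window (2 ^ (k0 + k)) by exact: key.
  move=> n nA.
  have nk : (`|n| + 2 <= k)%N by apply: leq_trans hk; rewrite leq_add2r; apply: (leq_bigmax_seq (F := absz)).
  have [q Eq] : exists q, (k0 + k = q.+1)%N by exists (k0 + k).-1; lia.
  have h : (`|n| < 2 ^ q)%N.
    apply: (@leq_trans q); first lia.
    by rewrite ltnW// ltn_expl.
  have Eh : ((2 ^ q.+1)./2 = 2 ^ q)%N by rewrite expnS mul2n doubleK.
  have lt : (absz (n + Posz (2 ^ q))%R < 2 ^ q.+1)%N by rewrite expnS; lia.
  rewrite Eq; apply/imfsetP; exists (Ordinal lt) => //=; rewrite Eh; lia.
have hw k n : n \in window (2 ^ (k0 + k)) -> normc (dft (2 ^ (k0 + k)) z n) <= K * inv_sq R n.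
  move=> nw; apply: HK; first exact: leq_addr.
  case/imfsetP: nw => i _ ->; have := ltn_ord i => /= h.
  by have := half_leq (leqnn (2 ^ (k0 + k))); have := odd_double_half (2 ^ (k0 + k)); lia.
(* The index is shifted by [k0] so that [dft_bound] holds for all k and one majorant serves the
   whole sequence. *)
apply: (@tannery R _ (fun k => dft (2 ^ (k0 + k)) z) _ (fun n => K * inv_sq R n)
  (fun k => window (2 ^ (k0 + k))) (K * 4)) => //.
- by move=> n; rewrite mulr_ge0// inv_sq_ge0.
- by move=> A; rewrite -mulr_sumr ler_wpM2l// bounded_inv_sq.
- move=> n; apply/ler_addgt0Pr => e e0.
  have [k1 Hk1] := lim n e e0; have [k2 Hk2] := big [fset n]%fset.
  have := Hk1 _ (leq_maxl k1 k2).
  have /fsubsetP/(_ n) := Hk2 _ (leq_maxr k1 k2); rewrite inE eqxx => /(_ isT) /hw.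
  set u := dft _ _ _; set v := a n * _ => h1 h2.
  by have := le_normcD (v - u) u; rewrite subrK; rewrite normcB in h2; lra.
- by move=> k; rewrite dft_inversion// expn_gt0.
Qed.

End Fourier.

(** * Cauchy estimates and normally convergent sums *)

Section Weierstrass.
Variable R : realType.
Local Notation C := R[i].
Implicit Types (f : C -> C) (z w : C).

(** The limit y -> 0 of a family of bounds; the next lemma is the limit y -> oo for negative c. *)
Lemma le_of_expR (x M c : R) : 0 <= M -> (forall y, 0 < y -> x <= M * expR (c * y)) -> x <= M.
Proof.
move=> M0 H; apply/ler_addgt0Pr => e e0.
have [c0|c0] := leP c 0.
  have := H 1 ltr01; have : expR (c * 1) <= 1 by rewrite mulr1 expR_le1.
  by move=> /(ler_wpM2l M0); lra.
pose y : R := ln (1 + e / (M + 1)) / c.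
have M1 : 0 < M + 1 by lra.
have eM : 0 < e / (M + 1) by rewrite divr_gt0.
have y0 : 0 < y by rewrite divr_gt0// ln_gt0//; lra.
have := H y y0; rewrite /y [c * _]mulrC divfK ?gt_eqF// lnK ?posrE; last by lra.
move=> /le_trans; apply; rewrite mulrDr mulr1 lerD2l mulrCA ler_piMr ?(ltW e0)//.
by rewrite ler_pdivrMr// mul1r; lra.
Qed.

Lemma le0_of_expR (x M c : R) : 0 <= M -> c < 0 -> (forall y, 0 < y -> x <= M * expR (c * y)) -> x <= 0.
Proof.
move=> M0 c0 H; rewrite leNgt; apply/negP => x0.
have M1 : 0 < M.
  by rewrite lt_def M0 andbT; apply/eqP => M00; have := H 1 ltr01; rewrite M00 mul0r; lra.
pose y : R := (`|ln (x / (2 * M))| + 1) / - c.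
have y0 : 0 < y by rewrite divr_gt0 ?oppr_gt0// ltr_wpDl.
have := H y y0; rewrite leNgt => /negP; apply.
have -> : c * y = - (`|ln (x / (2 * M))| + 1) by rewrite /y; field; rewrite lt_eqF.
have : expR (- (`|ln (x / (2 * M))| + 1)) <= x / (2 * M).
  rewrite -[leRHS]lnK ?posrE ?divr_gt0 ?mulr_gt0// ler_expR.
  by have := ler_norm (- ln (x / (2 * M))); rewrite normrN; lra.
move=> /(ler_wpM2l M0); have -> : M * (x / (2 * M)) = x / 2 by field; rewrite gt_eqF.
by lra.
Qed.

(* The function [u |-> f (z0 + r e(u))] is periodic and bounded on the upper
   half-plane: its Fourier coefficients are the Taylor coefficients of [f]. *)
Lemma cauchy_taylor f z0 (r M : R) : 0 < r ->
  (forall z, normc (z - z0) < r -> hol f z /\ normc (f z) <= M) ->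
  exists a, normc a <= M / r /\ forall w, normc w <= r / 2 ->
    normc (f (z0 + w) - f z0 - a * w) <= 2 * M / r ^+ 2 * normc w ^+ 2.
Proof.
move=> r0 H.
have M0 : 0 <= M.
  by apply: le_trans (normc_ge0 _) (H z0 _).2; rewrite subrr normc0.
pose F u := f (z0 + r%:C * e2pi u).
have inside u : 0 < Im u -> normc (z0 + r%:C * e2pi u - z0) < r.
  move=> u0; rewrite addrC addKr normcM normc_real gtr0_norm// gtr_pMr//.
  by rewrite normc_e2pi expR_lt1 oppr_lt0 mulr_gt0// mulr_gt0// pi_gt0.
have perF : periodic1 F by move=> u; rewrite /F e2piD1.
have holF u : 0 < Im u -> hol F u.
  move=> u0; apply: (@hol_comp R f (fun u => z0 + r%:C * e2pi u)).
    by apply: holD; [exact: hol_cst|apply: holM; [exact: hol_cst|exact: hol_e2pi]].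
  exact: (H _ (inside u u0)).1.
have [a [aF aM]] := fourier_expansion perF holF.
have aM' n y : 0 < y -> normc (a n) <= M * expR (2 * pi * n%:~R * y).
  by move=> y0; apply: aM => // x; apply: (H _ _).2; apply: inside.
(* Small heights bound all coefficients by M, large heights kill those with n < 0; what remains is a
   power series in e(u) = w / r. *)
have an n : normc (a n) <= M by apply: (@le_of_expR _ _ (2 * pi * n%:~R)) => // y /aM'.
have an0 n : n < 0 -> a n = 0.
  move=> n0; apply/eqP; rewrite -normc_eq0 eq_le normc_ge0 andbT.
  apply: (@le0_of_expR _ M (2 * pi * n%:~R)) => //; last by move=> y /aM'.
  by rewrite pmulr_rlt0 ?mulr_gt0 ?pi_gt0// ltrz0.
have r0C : r%:C != 0 :> C by rewrite eq_complex /= negb_and gt_eqF.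
have main w : w != 0 -> normc w <= r / 2 ->
    normc (f (z0 + w) - a 0 - a 1 / r%:C * w) <= 2 * M / r ^+ 2 * normc w ^+ 2.
  move=> w0 wr; have nw0 : 0 < normc w by rewrite normc_gt0.
  have [u [Hu Nu]] := @e2pi_surj R (w / r%:C) (mulf_neq0 w0 (invr_neq0 r0C)).
  pose q := normc w / r; have q0 : 0 < q by rewrite divr_gt0.
  have nq : normc (w / r%:C) = q by rewrite normcM normcV normc_real gtr0_norm.
  have q2 : q <= 1 / 2 by rewrite ler_pdivrMr//; lra.
  have u0 : 0 < Im u.
    have : expR (- (2 * pi * Im u)) < 1 by rewrite -Nu nq; lra.
    by rewrite expR_lt1 oppr_lt0 pmulr_rgt0 ?mulr_gt0 ?pi_gt0.
  have := aF u u0; rewrite /F Hu [r%:C * _]mulrC divfK// => S.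
  (* A family of finite support that cancels the constant and linear terms; for |w| <= r / 2 the
     rest is dominated by a geometric series of ratio at most 1/2, with sum at most 2 M q^2. *)
  pose h (n : int) : C := if n == 0 then - a 0 else if n == 1 then - (a 1 / r%:C * w) else 0.
  have Sh : usum h (- a 0 - a 1 / r%:C * w).
    have := @usum_fin R _ [fset 0; 1]%fset h; rewrite big_fsetU1 ?inE// big_seq_fset1.
    apply=> n; rewrite !inE negb_or /h => /andP[/negbTE -> /negbTE ->] //.
  rewrite -addrA; pose b (n : int) : R := if (1 < n)%R then M * q ^+ `|n|%N else 0.
  apply: (usum_le (usumD S Sh) (w := b)).
    move=> n; rewrite /h /b; have [->|n0] := eqVneq n 0.
      by rewrite mul0r e2pi0 mulr1 subrr normc0.
    have [->|n1] := eqVneq n 1.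
      by rewrite mul1r Hu mulrA mulrAC subrr normc0.
    rewrite addr0; have [n2|n2] := ltP 1 n; last first.
      by rewrite an0 ?mul0r ?normc0//; clear -n0 n1 n2; lia.
    have [k ->] : exists k, n = Posz k by exists `|n|%N; clear -n2; lia.
    by rewrite -pmulrn e2piMn Hu normcM normcX nq ler_wpM2r// exprn_ge0// ltW.
  have -> : 2 * M / r ^+ 2 * normc w ^+ 2 = 2 * (M * q ^+ 2) by rewrite /q expr_div_n; ring.
  apply: (@bounded_sums_inj R _ nat b (fun k => M * q ^+ 2 * 2 ^- k) (fun n : int => `|n|%N.-2)).
  - by move=> k; rewrite !mulr_ge0 ?exprn_ge0// ?invr_ge0 ?exprn_ge0// ltW.
  - move=> n; rewrite /b; case: ifP => [n1 _|]; last by rewrite eqxx.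
    have -> : q ^+ `|n|%N = q ^+ 2 * q ^+ (`|n|%N.-2) by rewrite -exprD; congr (_ ^+ _); clear -n1; lia.
    have p : 0 <= M * q ^+ 2 by rewrite mulr_ge0// exprn_ge0// ltW.
    rewrite mulrA; apply: (ler_wpM2l p); rewrite -exprVn.
    by rewrite lerXn2r ?nnegrE ?(ltW q0) ?invr_ge0//; lra.
  - move=> n n'; rewrite /b; case: ifP; last by rewrite eqxx.
    by move=> n1 _; case: ifP => [n2 _|]; [clear -n1 n2; lia|rewrite eqxx].
  by apply: bounded_geometric; rewrite mulr_ge0 ?exprn_ge0 ?(ltW q0).
(* The parametrisation z0 + r e(u) never reaches the centre, so the constant term is identified by
   letting w tend to 0 along positive reals, using that [f] is Lipschitz near [z0]. *)
have a0 : a 0 = f z0.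
  apply/eqP; rewrite -subr_eq0; apply/eqP/eq0_small => e e0.
  have zz : normc (z0 - z0) < r by rewrite subrr normc0.
  have [d [K [d0 Hd]]] := (H z0 zz).1.
  have Hm : hol_bound f z0 (Num.min d 1) K by apply: hol_bound_mono Hd; rewrite ?ge_min ?lexx.
  have m0 : 0 < Num.min d 1 by rewrite lt_min d0 ltr01.
  have m1 : Num.min d 1 <= 1 by rewrite ge_min lexx orbT.
  have K0 : 0 <= K by apply: le_trans (normc_ge0 _) (Hm z0 _).1; rewrite subrr normc0.
  pose B := 2 * K + M / r + 2 * M / r ^+ 2.
  have [p1 p2] : 0 <= M / r /\ 0 <= 2 * M / r ^+ 2.
    by split; rewrite mulr_ge0 ?mulr_ge0 ?invr_ge0 ?exprn_ge0 ?(ltW r0).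
  have B0 : 0 < B + 1 by rewrite /B; lra.
  pose s := Num.min (Num.min (d / 2) (1 / 2)) (Num.min (r / 2) (e / (B + 1) / 2)).
  have s0 : 0 < s by rewrite !lt_min !divr_gt0.
  have : s <= s by []; rewrite {2}/s !le_min => /andP[/andP[sd s1] /andP[sr se]].
  have ns : normc s%:C = s by rewrite normc_real gtr0_norm.
  have sC0 : s%:C != 0 :> C by rewrite -normc_gt0 ns.
  have := main _ sC0; rewrite ns => /(_ sr) h1.
  have := @hol_bound_shift R f z0 _ K z0 s%:C m1 Hm; rewrite ns subrr normc0 => /(_ m0).
  have -> : s < Num.min d 1 by rewrite lt_min; apply/andP; split; lra.
  move=> /(_ isT) h2.
  have h3 : normc (a 1 / r%:C * s%:C) <= M / r * s.
    rewrite !normcM normcV ns normc_real (gtr0_norm r0) ler_wpM2r ?(ltW s0)//.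
    by rewrite ler_wpM2r ?invr_ge0 ?(ltW r0).
  have h4 : 2 * M / r ^+ 2 * s ^+ 2 <= 2 * M / r ^+ 2 * s.
    by rewrite ler_wpM2l// expr2 ler_piMl ?(ltW s0)//; lra.
  have -> : a 0 - f z0 = (f (z0 + s%:C) - f z0) - (f (z0 + s%:C) - a 0 - a 1 / r%:C * s%:C) - a 1 / r%:C * s%:C by ring.
  apply: le_lt_trans (le_normcB _ _) _.
  have := le_normcB (f (z0 + s%:C) - f z0) (f (z0 + s%:C) - a 0 - a 1 / r%:C * s%:C).
  have : s * (B + 1) < e.
    by rewrite -ltr_pdivlMr//; have := divr_gt0 e0 B0; lra.
  by rewrite /B; lra.
exists (a 1 / r%:C); split.
  by rewrite normcM normcV normc_real gtr0_norm// ler_wpM2r// invr_ge0 ltW.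
move=> w wr; have [->|w0] := eqVneq w 0; last by rewrite -a0; exact: main.
by rewrite addr0 subrr mulr0 subr0 normc0 expr0n mulr0.
Qed.

(** Weierstrass' theorem. On discs of radius s = r / 2 the Cauchy estimates bound the i-th Taylor
    coefficient by b_i / s and the i-th remainder by a multiple of b_i, so both can be summed. *)
Lemma hol_usum (I : choiceType) (F : I -> C -> C) (S : C -> C) z0 (r M : R) (b : I -> R) :
  0 < r -> bounded_sums b M ->
  (forall z, normc (z - z0) < r -> usum (fun i => F i z) (S z)) ->
  (forall i z, normc (z - z0) < r -> hol (F i) z /\ normc (F i z) <= b i) ->
  hol S z0.
Proof.
move=> r0 HM HS HF; pose s := r / 2; have s0 : 0 < s by rewrite divr_gt0.
have M0 : 0 <= M by have := HM fset0; rewrite big_seq_fset0.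
have [p1 p2] : 0 <= M / s /\ 0 <= 2 * M / s ^+ 2.
  by split; rewrite mulr_ge0 ?mulr_ge0 ?invr_ge0 ?exprn_ge0 ?(ltW s0).
exists (s / 2), (M + M / s + 2 * M / s ^+ 2); split; first by rewrite divr_gt0.
move=> z zd; have zr : normc (z - z0) < r by rewrite /s in zd; lra.
split.
  rewrite (@le_trans _ _ M)//; last by lra.
  by apply: (usum_le (HS z zr) _ HM) => i; apply: (HF i z zr).2.
have near u : normc (u - z) < s -> normc (u - z0) < r.
  move=> us; apply: le_lt_trans (le_normc_trans u z z0) _.
  by rewrite /s in us zd; lra.
have /choice[a Ha] i := cauchy_taylor s0 (fun u hu => HF i u (near u hu)).
have HbV c : 0 <= c -> bounded_sums (fun i => b i * c) (M * c).
  by move=> c0 A; rewrite -mulr_suml ler_wpM2r.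
have sV : 0 <= s^-1 by rewrite invr_ge0 ltW.
have [l Hl] := @usum_exists R I a (fun i => b i * s^-1) _ (fun i => (Ha i).1) (HbV _ sV).
exists l; split.
  rewrite (@le_trans _ _ (M / s))//; last by lra.
  exact: (usum_le Hl (fun i => (Ha i).1) (HbV _ sV)).
move=> w wd; have zw : normc (z + w - z0) < r.
  by apply: near; rewrite addrC addKr; lra.
have w2 := sqr_ge0 (normc w).
have c0 : 0 <= 2 / s ^+ 2 * normc w ^+ 2 by apply: mulr_ge0 => //; apply: mulr_ge0 => //; rewrite invr_ge0 exprn_ge0// ltW.
have S' := usumD (usumD (HS _ zw) (usumZ (-1) (HS _ zr))) (usumZ (- w) Hl).
rewrite (_ : S (z + w) - S z - l * w = S (z + w) + -1 * S z + - w * l); last by ring.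
apply: le_trans (_ : M * (2 / s ^+ 2 * normc w ^+ 2) <= _).
  apply: (usum_le S' _ (HbV _ c0)) => i.
  rewrite (_ : _ + _ + _ = F i (z + w) - F i z - a i * w); last by ring.
  by apply: le_trans ((Ha i).2 w (ltW wd)) _; rewrite le_eqVlt; apply/orP; left; apply/eqP; ring.
rewrite (_ : M * _ = 2 * M / s ^+ 2 * normc w ^+ 2); last by ring.
by rewrite ler_wpM2r//; lra.
Qed.

End Weierstrass.

(** * Binomial Toeplitz matrices *)

Section Binomials.
Variable R : realType.
Local Notation C := R[i].
Implicit Types (x y : C).

Lemma binomC0 x : binomC x 0 = 1.
Proof. by rewrite /binomC big_ord0 fact0 divr1. Qed.

Lemma fact_neq0 s : (s`!%:R : C) != 0.
Proof. by rewrite pnatr_eq0 -lt0n fact_gt0. Qed.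

Lemma binomCS x s : s.+1%:R * binomC x s.+1 = (x - s%:R) * binomC x s.
Proof.
rewrite /binomC big_ord_recr/= factS natrM.
have := fact_neq0 s; have : (s.+1%:R : C) != 0 by rewrite pnatr_eq0.
move: (\prod_(_ < _) _) (s.+1%:R : C) (s`!%:R : C) => a b c b0 c0.
by field; rewrite b0 c0.
Qed.

(** Induction after multiplying by n + 1 and writing n + 1 = s + (n + 1 - s): [binomCS] lowers one
    binomial in each half, and the two linear factors add up to x + y - n. *)
Lemma binomC_vandermonde x y n :
  \sum_(s < n.+1) binomC x s * binomC y (n - s) = binomC (x + y) n.
Proof.
elim: n => [|n IH]; first by rewrite big_ord1 subnn !binomC0 mulr1.
have n0 : (n.+1%:R : C) != 0 by rewrite pnatr_eq0.
apply: (mulfI n0); rewrite binomCS -IH mulr_sumr.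
have E (s : 'I_n.+2) : n.+1%:R * (binomC x s * binomC y (n.+1 - s)) =
   s%:R * binomC x s * binomC y (n.+1 - s) + binomC x s * ((n.+1 - s)%:R * binomC y (n.+1 - s)).
  by rewrite natrB -1?ltnS//; ring.
under eq_bigr do rewrite E.
rewrite big_split/= big_ord_recl/= !mul0r add0r.
rewrite [X in _ + X = _]big_ord_recr/= subnn mul0r mulr0 addr0.
rewrite -big_split/= mulr_sumr; apply: eq_bigr => s _.
rewrite /bump /= add1n subSS binomCS subSn -1?ltnS// binomCS natrB -1?ltnS//.
by ring.
Qed.

Lemma binomC0n n : binomC (0 : C) n = (n == 0%N)%:R.
Proof.
case: n => [|n]; first by rewrite binomC0.
by rewrite /binomC big_ord_recl subrr !mul0r.
Qed.

Lemma binomC1n n : binomC (1 : C) n = (n <= 1)%:R.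
Proof.
case: n => [|[|n]]; first by rewrite binomC0.
  by rewrite /binomC big_ord1 subr0 (_ : 1`! = 1%N)// divr1.
by rewrite /binomC !big_ord_recl /= /bump /= subrr mul0r mulr0 mul0r.
Qed.

Lemma binomC_opp x n : (-1) ^+ n * binomC (x + n%:R - 1) n = binomC (- x) n.
Proof.
rewrite /binomC mulrA; congr (_ / _).
rewrite (reindex_inj rev_ord_inj)/=.
rewrite -[in (-1) ^+ n](card_ord n) -prodr_const -big_split/=.
apply: eq_bigr => l _; rewrite natrB// -natr1; ring.
Qed.

Lemma binomC_pascal x n : binomC (x + 1) n.+1 = binomC x n.+1 + binomC x n.
Proof.
rewrite -binomC_vandermonde big_ord_recr big_ord_recr/= subnn subSnn !binomC1n/= !mulr1.
rewrite [X in X + _ + _](_ : _ = 0); first by rewrite add0r addrC.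
apply: big1 => s _; rewrite binomC1n.
have -> : (n.+1 - s <= 1)%N = false by have := ltn_ord s; lia.
by rewrite mulr0.
Qed.

Definition toep (m : nat) (b : nat -> C) : 'M[C]_m :=
  \matrix_(i, j) if (j <= i)%N then b (i - j)%N else 0.

Lemma toep_mul m (b c : nat -> C) :
  toep m b *m toep m c = toep m (fun n => \sum_(s < n.+1) c s * b (n - s)%N).
Proof.
apply/matrixP => i j; rewrite !mxE.
under eq_bigr do rewrite !mxE.
pose F (k : nat) := (if (k <= i)%N then b (i - k)%N else 0) * (if (j <= k)%N then c (k - j)%N else 0).
rewrite -(big_mkord xpredT F) /F.
case: leqP => [ji|ij]; last first.
  apply: big1_seq => k _; case: leqP => ki; rewrite ?mul0r//.
  by rewrite leqNgt (leq_ltn_trans ki ij) mulr0.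
have im := ltn_ord i.
rewrite (big_cat_nat (n := j))//=; last exact: ltnW.
rewrite big_nat big1 ?add0r; last first.
  by move=> k /andP[_ kj]; rewrite [(j <= k)%N]leqNgt kj mulr0.
rewrite (big_cat_nat (n := i.+1))//=; last exact: leqW.
rewrite [X in _ + X]big_nat [X in _ + X]big1 ?addr0; last first.
  by move=> k /andP[ik _]; rewrite [(k <= i)%N]leqNgt ik mul0r.
rewrite -{1}[nat_of_ord j]add0n big_addn subSn// big_mkord.
apply: eq_bigr => s _; rewrite leq_addl addnK mulrC.
have -> : (s + j <= i)%N by have := ltn_ord s; lia.
by congr (_ * b _); lia.
Qed.

(* Vandermonde's convolution makes this a one-parameter group; [Bmx] is its value
   at [- x] and a Jordan block is a multiple of its value at 1. *)
Definition bimx m x : 'M[C]_m := toep m (binomC x).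

Lemma bimxD m x y : bimx m x *m bimx m y = bimx m (x + y).
Proof.
rewrite /bimx toep_mul; apply/matrixP => i j; rewrite !mxE.
by rewrite binomC_vandermonde addrC.
Qed.

Lemma bimx0 m : bimx m 0 = 1%:M.
Proof.
apply/matrixP => i j; rewrite !mxE binomC0n.
case: leqP => ij; last by rewrite -val_eqE/= ltn_eqF.
by rewrite subn_eq0 -val_eqE/= eqn_leq ij andbT.
Qed.

Lemma Bmx_bimx m x : Bmx m x = bimx m (- x).
Proof.
by apply/matrixP => i j; rewrite !mxE; case: ifP => // ji; rewrite binomC_opp.
Qed.

Lemma jordan_bimx m lam : jordan m lam = lam *: bimx m (1 : C).
Proof.
apply/matrixP => i j; rewrite !mxE binomC1n -val_eqE/=.
case: leqP => [ji|ij].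
  rewrite leq_subLR; have -> : (i <= j + 1)%N = ((i == j :> nat) || (i == j.+1 :> nat)) by lia.
  by case: ifP => _; rewrite ?mulr1 ?mulr0.
by rewrite mulr0 (_ : (_ || _) = false)//; lia.
Qed.

Lemma invmx_unique n (A B : 'M[C]_n) : A *m B = 1%:M -> invmx A = B.
Proof.
move=> AB; have [uA _] := mulmx1_unit AB.
by rewrite -[LHS]mulmx1 -AB mulmxA mulVmx// mul1mx.
Qed.

End Binomials.

(** * Block diagonal matrices *)

Section BlockDiagonal.
Variable R : realType.
Local Notation C := R[i].
Variables (t : nat) (m : 'I_t -> nat).
Local Notation p := (\sum_(r < t) m r)%N.

Lemma mxdiag_mul (A B : forall r, 'M[C]_(m r)) :
  mxdiag A *m mxdiag B = \mxdiag_(r < t) (A r *m B r).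
Proof.
rewrite {1}/mxdiag mul_mxblock_mxdiag; apply/eq_mxblock => i j.
by case: eqVneq => [<-|ij]; rewrite ?conform_mx_id// mul0mx.
Qed.

(** The entries are given as a function of natural numbers, so that no cast between the index types
    of two equal blocks appears. *)
Lemma mxdiag_entry (A : forall r, 'M[C]_(m r)) (b : 'I_t -> nat -> nat -> C) :
  (forall r i j, A r i j = b r i j) -> forall i j : 'I_p,
  mxdiag A i j = if tagnat.sig1 i == tagnat.sig1 j
                 then b (tagnat.sig1 i) (tagnat.sig2 i) (tagnat.sig2 j) else 0.
Proof.
move=> H i j; rewrite /mxdiag mxE.
move: (tagnat.sig1 i) (tagnat.sig2 i) (tagnat.sig1 j) (tagnat.sig2 j) => r a s c.
case: eqVneq => [E|_]; last by rewrite mxE.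
by move: c; rewrite -E => c; rewrite conform_mx_id H.
Qed.

Definition bidiag (x : C) : 'M[C]_p := \mxdiag_(r < t) bimx (m r) x.

Lemma bidiagD x y : bidiag x *m bidiag y = bidiag (x + y).
Proof. by rewrite /bidiag mxdiag_mul; apply: eq_mxdiag => r; rewrite bimxD. Qed.

Lemma bidiag0 : bidiag 0 = 1%:M.
Proof. by rewrite /bidiag -mxdiagZ; apply: eq_mxdiag => r; rewrite bimx0. Qed.

Lemma invmx_Brho x : invmx (Brho m x) = bidiag x.
Proof.
apply: invmx_unique; have -> : Brho m x = bidiag (- x).
  by apply: eq_mxdiag => r; rewrite Bmx_bimx.
by rewrite bidiagD addNr bidiag0.
Qed.

Lemma Lambda_mul (z z' : 'I_t -> C) :
  Lambda m z *m Lambda m z' = Lambda m (fun r => z r * z' r).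
Proof. by rewrite /Lambda mxdiag_mul; apply: eq_mxdiag => r; rewrite -scalar_mxM. Qed.

Lemma Lambda1 : Lambda m (fun=> 1) = 1%:M :> 'M[C]_p.
Proof. exact: mxdiagZ. Qed.

Lemma Lambda_bidiagC z x : Lambda m z *m bidiag x = bidiag x *m Lambda m z.
Proof.
by rewrite /Lambda /bidiag !mxdiag_mul; apply: eq_mxdiag => r; rewrite scalar_mxC.
Qed.

Lemma jordan_bidiag lam : \mxdiag_(r < t) jordan (m r) (lam r) = Lambda m lam *m bidiag (1 : C).
Proof.
rewrite /Lambda /bidiag mxdiag_mul; apply: eq_mxdiag => r.
by rewrite jordan_bimx mul_scalar_mx.
Qed.

Lemma bidiag_entry x (i j : 'I_p) : bidiag x i j =
  if tagnat.sig1 i == tagnat.sig1 j then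
    (if (tagnat.sig2 j <= tagnat.sig2 i)%N then binomC x (tagnat.sig2 i - tagnat.sig2 j) else 0)
  else 0.
Proof.
apply: (@mxdiag_entry (fun r => bimx (m r) x)
  (fun r i j => if (j <= i)%N then binomC x (i - j) else 0)) => r a b.
by rewrite mxE.
Qed.

Lemma Lambda_diag z : Lambda m z = diag_mx (\row_j z (tagnat.sig1 j)) :> 'M[C]_p.
Proof.
have -> : Lambda m z = diag_mx (\mxrow_r const_mx (z r)) :> 'M[C]_p.
  by rewrite diag_mxrow; apply: eq_mxdiag => r; rewrite diag_const_mx.
by congr diag_mx; apply/matrixP => i j; rewrite !mxE.
Qed.

End BlockDiagonal.

Lemma mulmx_diag_entry (R : realType) n' n (A : 'M[R[i]]_(n', n)) (f : 'I_n -> R[i]) i j :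
  (A *m diag_mx (\row_j f j)) i j = A i j * f j.
Proof. by rewrite mul_mx_diag mxE [X in _ * X]mxE. Qed.

(** * A submultiplicative matrix norm *)

Section MatrixNorm.
Variable R : realType.
Local Notation C := R[i].

Definition mnorm m n (A : 'M[C]_(m, n)) : R := \sum_i \sum_j normc (A i j).

Lemma mnorm_ge0 m n (A : 'M[C]_(m, n)) : 0 <= mnorm A.
Proof. by apply: sumr_ge0 => i _; apply: sumr_ge0 => j _; apply: normc_ge0. Qed.

Lemma normc_le_mnorm m n (A : 'M[C]_(m, n)) i j : normc (A i j) <= mnorm A.
Proof.
rewrite /mnorm (bigD1 i)//= (bigD1 j)//= -addrA lerDl addr_ge0// sumr_ge0// => *.
  exact: normc_ge0.
by apply: sumr_ge0 => *; apply: normc_ge0.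
Qed.

Lemma mnormM m n k (A : 'M[C]_(m, n)) (B : 'M[C]_(n, k)) :
  mnorm (A *m B) <= mnorm A * mnorm B.
Proof.
have E : mnorm A * mnorm B = \sum_i \sum_l (\sum_j normc (A i j)) * (\sum_j normc (B l j)).
  by rewrite /mnorm mulr_suml; apply: eq_bigr => i _; rewrite mulr_sumr.
rewrite E; apply: ler_sum => i _.
apply: (@le_trans _ _ (\sum_j \sum_l normc (A i l) * normc (B l j))).
  apply: ler_sum => j _; rewrite mxE (le_trans (normc_sum _ _ _))//.
  by apply: ler_sum => l _; rewrite normcM.
rewrite exchange_big/=; apply: ler_sum => l _.
rewrite -mulr_sumr ler_wpM2r ?sumr_ge0// => [*|]; first exact: normc_ge0.
by rewrite (bigD1 l)//= lerDl sumr_ge0// => *; apply: normc_ge0.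
Qed.

Lemma mnorm_le_entries m n (A : 'M[C]_(m, n)) c :
  (forall i j, normc (A i j) <= c) -> mnorm A <= m%:R * n%:R * c.
Proof.
move=> H; apply: (@le_trans _ _ (\sum_(i < m) \sum_(j < n) c)).
  by apply: ler_sum => i _; apply: ler_sum => j _; apply: H.
by rewrite !sumr_const !card_ord -mulrnA -[leLHS]mulr_natl natrM [n%:R * _]mulrC.
Qed.

Lemma normc_binomC_le (x : C) s : normc (binomC x s) <= (normc x + s%:R) ^+ s.
Proof.
rewrite /binomC normcM normcV normc_nat.
have b0 : 0 <= normc x + s%:R by rewrite addr_ge0// normc_ge0.
have h : normc (\prod_(l < s) (x - l%:R)) <= (normc x + s%:R) ^+ s.
  rewrite -[X in _ <= _ ^+ X]card_ord -prodr_const.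
  elim/big_ind2: _ => //; first by rewrite normc1.
    by move=> a b c d ab cd; rewrite normcM ler_pM ?normc_ge0.
  move=> l _; rewrite (le_trans (le_normcB _ _))// lerD2l normc_nat ler_nat.
  exact: ltnW.
rewrite ler_pdivrMr ?ltr0n ?fact_gt0// (le_trans h)// ler_peMr ?exprn_ge0//.
by rewrite ler1n fact_gt0.
Qed.

End MatrixNorm.

(** * The modular group *)

Section ModularGroup.
Implicit Types (g h M : SL2Z).

Lemma SL2Z_mulE g h (i j : 'I_2) :
  (g * h)%g i j = g i 0 * h 0 j + g i 1 * h 1 j.
Proof.
rewrite [LHS](_ : _ = ((g : 'M[int]_2) *m h) i j)// mxE !big_ord_recl big_ord0 addr0.
by congr (_ * _ + _ * _); congr (fun_of_matrix _ _ _); apply: val_inj.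
Qed.

Lemma SL2Z_detE g : g 0 0 * g 1 1 - g 0 1 * g 1 0 = 1.
Proof.
rewrite -(SL2Z_det g) (expand_det_row _ ord0) !big_ord_recl big_ord0 /cofactor !det_mx11.
rewrite !mxE /= addr0 expr0 expr1 mul1r mulN1r mulrN.
by congr (_ * _ - _ * _); congr (fun_of_matrix _ _ _); apply: val_inj.
Qed.

Lemma SL2Z_eq g h : g 0 0 = h 0 0 -> g 0 1 = h 0 1 -> g 1 0 = h 1 0 -> g 1 1 = h 1 1 -> g = h.
Proof.
move=> h00 h01 h10 h11; apply: val_inj; apply/matrixP => i j.
have ord2 (k : 'I_2) : k = 0 \/ k = 1.
  by case: k => [[|[|//]] lt]; [left|right]; apply: val_inj.
by case: (ord2 i) => ->; case: (ord2 j) => ->.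
Qed.

Fact SL2Z_trans_subproof n : \det (mx22 1 n 0 1) == 1.
Proof. by rewrite det_mx22 mulr0 subr0. Qed.
Definition SL2Z_trans n : SL2Z := MkSL2Z (SL2Z_trans_subproof n).

Lemma SL2Z_transE n (i j : 'I_2) : SL2Z_trans n i j =
  if i == 0 then (if j == 0 then 1 else n) else (if j == 0 then 0 else 1).
Proof. by rewrite /= mxE. Qed.

Lemma SL2Z_TE (i j : 'I_2) : SL2Z_T i j =
  if i == 0 then 1 else (if j == 0 then 0 else 1).
Proof. by rewrite /= mxE if_same. Qed.

Lemma SL2Z_SE (i j : 'I_2) : SL2Z_S i j =
  if i == 0 then (if j == 0 then 0 else -1) else (if j == 0 then 1 else 0).
Proof. by rewrite /= mxE. Qed.

Lemma SL2Z_1E (i j : 'I_2) : (1%g : SL2Z) i j = (i == j)%:R.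
Proof. by rewrite [LHS](_ : _ = (1%:M : 'M[int]_2) i j)// mxE. Qed.

Lemma SL2Z_transD n k : SL2Z_trans (n + k) = (SL2Z_trans n * SL2Z_trans k)%g.
Proof. by apply: SL2Z_eq; rewrite SL2Z_mulE !SL2Z_transE /=; ring. Qed.

Lemma SL2Z_trans0 : SL2Z_trans 0 = 1%g.
Proof. by apply: SL2Z_eq; rewrite SL2Z_transE [RHS]SL2Z_1E. Qed.

Lemma SL2Z_trans1 : SL2Z_trans 1 = SL2Z_T.
Proof. by apply: SL2Z_eq; rewrite [RHS]SL2Z_TE [LHS]SL2Z_transE. Qed.

Lemma SL2Z_transN n : SL2Z_trans (- n) = (SL2Z_trans n)^-1%g.
Proof.
apply: (@mulgI _ (SL2Z_trans n)).
by rewrite mulgV -SL2Z_transD subrr SL2Z_trans0.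
Qed.

Lemma SL2Z_transn n : SL2Z_trans (Posz n) = (SL2Z_T ^+ n)%g.
Proof.
elim: n => [|n IH]; first by rewrite SL2Z_trans0 expg0.
by rewrite -addn1 PoszD SL2Z_transD IH SL2Z_trans1 addn1 expgSr.
Qed.

Lemma cycleTP g : cycleT g <-> exists n, g = SL2Z_trans n.
Proof.
split=> [[n [->|->]]|[[n|n] ->]].
- by exists (Posz n); rewrite SL2Z_transn.
- by exists (- Posz n); rewrite SL2Z_transN SL2Z_transn.
- by exists n; left; rewrite SL2Z_transn.
- by exists n.+1; right; rewrite NegzE SL2Z_transN SL2Z_transn.
Qed.

Lemma trans_mul_bottom n g (j : 'I_2) : (SL2Z_trans n * g)%g 1 j = g 1 j.
Proof. by rewrite SL2Z_mulE !SL2Z_transE /= mul0r mul1r add0r. Qed.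

Lemma same_bottom g h : g 1 0 = h 1 0 -> g 1 1 = h 1 1 ->
  exists n, g = (SL2Z_trans n * h)%g.
Proof.
(* [n] is the upper right entry of g h^-1, a matrix that equal bottom rows and determinant 1 force
   to be a translation. *)
move=> e0 e1; pose n := g 0 1 * h 0 0 - g 0 0 * h 0 1.
exists n; have d1 := SL2Z_detE g; have d2 := SL2Z_detE h.
rewrite e0 e1 in d1.
apply: SL2Z_eq; rewrite ?trans_mul_bottom// SL2Z_mulE !SL2Z_transE /= mul1r /n.
- have -> : h 0 0 + (g 0 1 * h 0 0 - g 0 0 * h 0 1) * h 1 0 =
    h 0 0 * (1 - (g 0 0 * h 1 1 - g 0 1 * h 1 0)) + g 0 0 * (h 0 0 * h 1 1 - h 0 1 * h 1 0) by ring.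
  by rewrite d1 d2 subrr mulr0 add0r mulr1.
- have -> : h 0 1 + (g 0 1 * h 0 0 - g 0 0 * h 0 1) * h 1 1 =
    h 0 1 * (1 - (g 0 0 * h 1 1 - g 0 1 * h 1 0)) + g 0 1 * (h 0 0 * h 1 1 - h 0 1 * h 1 0) by ring.
  by rewrite d1 d2 subrr mulr0 add0r mulr1.
Qed.

Definition bottom_size M : nat := (absz (M 1 0)%R + absz (M 1 1)%R)%N.

Lemma bottom_size_gt0 M : (0 < bottom_size M)%N.
Proof.
rewrite /bottom_size lt0n addn_eq0 !absz_eq0; apply/negP => /andP[/eqP h0 /eqP h1].
by have := SL2Z_detE M; rewrite h0 h1 !mulr0 subrr.
Qed.

Lemma SL2Z_lower_right M : M 1 0 = 0 -> M 1 1 = 1 \/ M 1 1 = -1.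
Proof.
move=> c0; have : absz (M 1 1) = 1%N; last by lia.
have := SL2Z_detE M; rewrite c0 mulr0 subr0 => /(congr1 absz).
by rewrite abszM /= => /eqP; rewrite muln_eq1 => /andP[_ /eqP].
Qed.

(** Rounding to the nearest multiple, not downwards: each step of Euclid's algorithm must at least
    halve |c|, since the factor lost in a step is paid for by |c| / |d'| >= 2. *)
Lemma nearest_multiple (c d : int) : c != 0 -> exists n d' : int,
  d = n * c + d' /\ (2 * absz d' <= absz c)%N.
Proof.
move=> c0; have := divz_eq d c; have := modz_ge0 d c0; have := ltz_mod d c0.
set q := (d %/ c)%Z; set r := (d %% c)%Z => r1 r0 E.
have [h|h] := leP (2 * `|r|)%N `|c|%N; first by exists q, r.
have [cp|cn] := ltP 0 c.
  by exists (q + 1), (r - c); split; [rewrite E; ring|lia].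
by exists (q - 1), (r + c); split; [rewrite E; ring|lia].
Qed.

Section Growth.
Variable R : realType.
Variable N : SL2Z -> R.
Hypothesis N_ge0 : forall g, 0 <= N g.
Hypothesis N_mul : forall g h, N (g * h)%g <= N g * N h.
Variables (A : R) (e : nat).
Hypothesis N_trans : forall n, N (SL2Z_trans n) <= A * (1 + `|n|%N%:R) ^+ e.

(* Euclid's algorithm on the bottom row (c, d): with d = n c + d' and |d'| <= |c|/2,
   a step costs a factor O((1 + |n|)^e), which the drop from |c| to |d'| absorbs. *)
Lemma growth_aux : exists (K : R) (al : nat), 1 <= K /\ forall M, M 1 0 != 0 ->
  exists M', [/\ M' 1 0 = M 1 0, M' 1 1 = M 1 1 &
   N M' <= K * (absz (M 1 0))%:R ^+ al * (1 + (absz (M 1 1))%:R / (absz (M 1 0))%:R) ^+ e].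
Proof.
(* The cost of a step apart from (1 + |d| / |c|)^e; the factor 2^e comes from 1 + |n| <= 2 (1 + |d|
   / |c|). *)
pose B : R := Num.max 1 (N SL2Z_S * A * 2 ^+ e).
have B1 : 1 <= B by rewrite le_max lexx.
have BS : N SL2Z_S * A * 2 ^+ e <= B by rewrite le_max lexx orbT.
have [be Hbe] : exists be : nat, B <= 2 ^+ be.
  exists (Num.truncn B).+1; apply: ltW; apply: lt_le_trans (truncnS_gt _) _.
  by rewrite -natrX ler_nat ltnW// ltn_expl.
pose K0 : R := Num.max 1 (Num.max (N 1%g) (N (SL2Z_S ^+ 2)%g)).
have K01 : 1 <= K0 by rewrite le_max lexx.
have K0N : N 1%g <= K0 by rewrite !le_max lexx orbT.
have K0S : N (SL2Z_S ^+ 2)%g <= K0 by rewrite !le_max lexx !orbT.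
have BK1 : 1 <= B * K0 by rewrite -[1]mulr1 ler_pM.
(* For x = |c| / |d'| >= 2 one has (1 + x)^e <= x^(2 e) and B <= 2^be <= x^be, so this exponent
   absorbs exactly one step. *)
exists (B * K0), (2 * e + be)%N; split => // M.
have [k] := ubnP (absz (M 1 0)); elim: k M => // k IH M hk c0.
have [n [d' [Ed hd]]] := nearest_multiple (M 1 1) c0.
set c := M 1 0 in c0 hk Ed hd *; set d := M 1 1 in Ed *.
have cr : 1 <= (absz c)%:R :> R by rewrite ler1n lt0n absz_eq0.
have nb : (`|n|%N)%:R <= (absz d)%:R / (absz c)%:R + 1 / 2 :> R.
  have cp : 0 < (absz c)%:R :> R by lra.
  rewrite -(ler_pM2r cp) mulrDl divfK ?gt_eqF//.
  have h : (`|n| * absz c <= absz d + absz d')%N.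
    rewrite -abszM; have -> : n * c = d - d' by rewrite Ed addrK.
    by clear; lia.
  have : ((2 * (`|n| * absz c))%N)%:R <= ((2 * absz d + absz c)%N)%:R :> R.
    rewrite ler_nat; move: (`|n| * absz c)%N (absz d) (absz d') (absz c) h hd => x1 x2 x3 x4; lia.
  by rewrite natrD !natrM; lra.
have x0 : 0 <= (absz d)%:R / (absz c)%:R :> R by rewrite divr_ge0.
(* Its bottom row is (- d', c), so the induction runs on |d'| < |c|. Any M2 with that bottom row
   gives back, after right multiplication by S T^n, a matrix with the bottom row of M. *)
pose M1 := (M * SL2Z_trans (- n) * SL2Z_S^-1)%g.
have EM : M = (M1 * SL2Z_S * SL2Z_trans n)%g.
  by rewrite /M1 divgK SL2Z_transN divgK.
have EM0 M2 : (M2 * SL2Z_S * SL2Z_trans n)%g 1 0 = M2 1 1.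
  by rewrite !SL2Z_mulE !SL2Z_transE !SL2Z_SE /=; ring.
have EM1 M2 : (M2 * SL2Z_S * SL2Z_trans n)%g 1 1 = n * M2 1 1 - M2 1 0.
  by rewrite !SL2Z_mulE !SL2Z_transE !SL2Z_SE /=; ring.
have M11 : M1 1 1 = c by rewrite /c EM EM0.
have M10 : M1 1 0 = - d'.
  have : d = n * M1 1 1 - M1 1 0 by rewrite /d [in LHS]EM EM1.
  by rewrite Ed M11 => /addrI ->; rewrite opprK.
have NM2 M2 : N (M2 * SL2Z_S * SL2Z_trans n)%g <=
    N M2 * (B * (1 + (absz d)%:R / (absz c)%:R) ^+ e).
  rewrite (le_trans (N_mul _ _))// (le_trans (ler_wpM2r (N_ge0 _) (N_mul _ _)))//.
  rewrite -mulrA ler_wpM2l//.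
  apply: (@le_trans _ _ (N SL2Z_S * (A * (1 + `|n|%N%:R) ^+ e))).
    by rewrite ler_wpM2l.
  apply: (@le_trans _ _ (N SL2Z_S * A * 2 ^+ e * (1 + (absz d)%:R / (absz c)%:R) ^+ e)).
    have A0 : 0 <= A.
      have := le_trans (N_ge0 _) (N_trans 0).
      by rewrite absz0 addr0 expr1n mulr1.
    rewrite -!mulrA; apply: ler_wpM2l => //; apply: ler_wpM2l => //.
    rewrite -exprMn; apply: lerXn2r; rewrite ?nnegrE; [by rewrite addr_ge0| |lra].
    by rewrite mulr_ge0// addr_ge0.
  by rewrite ler_wpM2r// exprn_ge0// addr_ge0.
(* The algorithm stops: determinant 1 forces c = 1 or c = -1, and I or S^2 serves as the matrix with
   bottom row (0, c). *)
have [d0|d0] := eqVneq d' 0.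
  have c1 : absz c = 1%N.
    have := SL2Z_detE M1; rewrite M10 M11 d0 oppr0 mulr0 subr0 => /(congr1 absz).
    rewrite abszM /= => /eqP; rewrite muln_eq1 => /andP[_ /eqP //].
  have [M2 [h1 h2 h3]] : exists M2 : SL2Z, [/\ M2 1 0 = 0, M2 1 1 = c & N M2 <= K0].
    have : c = 1 \/ c = -1 by clear -c1; lia.
    case=> ->; first by exists 1%g; rewrite !SL2Z_1E; split.
    exists (SL2Z_S ^+ 2)%g; rewrite expgS expg1 !SL2Z_mulE !SL2Z_SE /=.
    by split; rewrite -?expgS//; ring.
  exists (M2 * SL2Z_S * SL2Z_trans n)%g; rewrite EM0 EM1 h1 h2; split => //.
    by rewrite Ed d0 ?subr0 ?addr0.
  apply: (le_trans (NM2 _)); rewrite c1 expr1n mulr1 mulrA; apply: ler_wpM2r.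
    by rewrite exprn_ge0// addr_ge0// divr_ge0.
  by rewrite mulrC ler_wpM2l//; lra.
have lt : (absz (M1 1 0)%R < k)%N by rewrite M10; clear -hk hd d0; lia.
have [|M2 [h1 h2 h3]] := IH M1 lt; first by rewrite M10 oppr_eq0.
rewrite M10 M11 abszN in h3.
exists (M2 * SL2Z_S * SL2Z_trans n)%g; rewrite EM0 EM1 h1 h2 M10 M11 opprK; split => //.
apply: (le_trans (NM2 _)); rewrite mulrA; apply: ler_wpM2r.
  by rewrite exprn_ge0// addr_ge0.
have B0 : 0 <= B by lra.
apply: (le_trans (ler_wpM2r B0 h3)).
have dr : 1 <= (absz d')%:R :> R by rewrite ler1n lt0n absz_eq0.
have cd : 2 * (absz d')%:R <= (absz c)%:R :> R by rewrite -natrM ler_nat.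
move: dr cd cr; set D : R := (absz d')%:R; set c' : R := (absz c)%:R => dr cd cr.
have D0 : 0 < D by lra.
pose x := c' / D; have x2 : 2 <= x by rewrite ler_pdivlMr.
have -> : c' = x * D by rewrite divfK// gt_eqF.
rewrite -[_ * D / D]mulrA divff ?gt_eqF// mulr1 exprMn.
have h4 : B * (1 + x) ^+ e <= x ^+ (2 * e + be).
  rewrite exprD mulrC; apply: ler_pM => //.
  - by rewrite exprn_ge0//; lra.
  - by rewrite exprM lerXn2r ?nnegrE ?exprn_ge0//; [lra|lra|nra].
  - apply: (le_trans Hbe); apply: lerXn2r; rewrite ?nnegrE//; lra.
have P0 : 0 <= B * K0 * D ^+ (2 * e + be).
  by rewrite !mulr_ge0 ?exprn_ge0//; lra.
have := ler_wpM2l P0 h4.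
by congr (_ <= _); ring.
Qed.

Lemma growth : exists (K : R) (al : nat), 0 <= K /\ forall M,
  exists M', [/\ M' 1 0 = M 1 0, M' 1 1 = M 1 1 & N M' <= K * (bottom_size M)%:R ^+ al].
Proof.
have [K [al [K1 H]]] := growth_aux.
pose K0 : R := Num.max K (Num.max (N 1%g) (N (SL2Z_S ^+ 2)%g)).
have KK0 : K <= K0 by rewrite le_max lexx.
have K0N : N 1%g <= K0 by rewrite !le_max lexx orbT.
have K0S : N (SL2Z_S ^+ 2)%g <= K0 by rewrite !le_max lexx !orbT.
have K00 : 0 <= K0 by lra.
exists K0, (al + e)%N; split => // M.
have s1 : 1 <= (bottom_size M)%:R :> R by rewrite ler1n bottom_size_gt0.
have [c0|c0] := eqVneq (M 1 0) 0; last first.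
  have [M' [h1 h2 h3]] := H M c0; exists M'; split => //; apply: (le_trans h3).
  have cr : 1 <= (absz (M 1 0))%:R :> R by rewrite ler1n lt0n absz_eq0.
  have K00' : 0 <= K by lra.
  have h4 : 0 <= 1 + (absz (M 1 1))%:R / (absz (M 1 0))%:R :> R by rewrite addr_ge0// divr_ge0.
  rewrite exprD mulrA; apply: ler_pM.
  - by rewrite mulr_ge0// exprn_ge0.
  - by rewrite exprn_ge0.
  - apply: ler_pM; rewrite ?exprn_ge0//.
    by apply: lerXn2r; rewrite ?nnegrE// ler_nat leq_addr.
  - apply: lerXn2r; rewrite ?nnegrE//.
    rewrite /bottom_size natrD lerD// ler_pdivrMr; last lra.
    by rewrite ler_peMr.
have one : 1 <= (bottom_size M)%:R ^+ (al + e) :> R by rewrite exprn_ege1.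
have fin x : x <= K0 -> x <= K0 * (bottom_size M)%:R ^+ (al + e).
  by move=> h; apply: (le_trans h); rewrite ler_peMr.
rewrite c0; case: (SL2Z_lower_right c0) => ->.
  by exists 1%g; rewrite !SL2Z_1E; split => //; apply: fin.
exists (SL2Z_S ^+ 2)%g; split; last exact: fin.
- by rewrite expgS expg1 !SL2Z_mulE !SL2Z_SE /=; ring.
- by rewrite expgS expg1 !SL2Z_mulE !SL2Z_SE /=; ring.
Qed.

End Growth.

Variable R : realType.
Local Notation C := R[i].
Implicit Types (tau : C).

Lemma Im_int_affine (a b : int) tau :
  Im (a%:~R * tau + b%:~R) = a%:~R * Im tau.
Proof.
by rewrite ImD -!(rmorph_int (real_complex R)) ImMr /= addr0.
Qed.

Lemma automorphy_neq0 g tau : uhp tau -> automorphy g tau != 0.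
Proof.
rewrite /uhp /automorphy /= => tau0; apply/negP => /eqP E.
have := congr1 (@Im R) E; rewrite Im_int_affine /= => /eqP.
rewrite mulf_eq0 (gt_eqF tau0) orbF intr_eq0 => /eqP c0.
move: E; rewrite c0 mul0r add0r => /eqP; rewrite intr_eq0 => /eqP d0.
by have := SL2Z_detE g; rewrite c0 d0 !mulr0 subrr.
Qed.

Lemma automorphyM g h tau : uhp tau ->
  automorphy (g * h)%g tau = automorphy g (moebius h tau) * automorphy h tau.
Proof.
move=> t0; have := automorphy_neq0 h t0; rewrite /moebius; set a := automorphy h tau => a0.
rewrite {2}/automorphy mulrDl -[X in X + _]mulrA divfK//.
by rewrite /a /automorphy !SL2Z_mulE !rmorphD !rmorphM /=; ring.
Qed.

Lemma moebiusM g h tau : uhp tau -> uhp (moebius h tau) ->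
  moebius (g * h)%g tau = moebius g (moebius h tau).
Proof.
move=> t0 ht0; have a0 := automorphy_neq0 h t0; have b0 := automorphy_neq0 g ht0.
rewrite {1 2}/moebius automorphyM// invfM mulrCA mulrC; congr (_ / _).
rewrite /moebius -[RHS](mulfK a0); congr (_ / _).
rewrite [RHS]mulrDl -[X in _ = X + _]mulrA divfK//.
by rewrite /automorphy !SL2Z_mulE !rmorphD !rmorphM /=; ring.
Qed.

Lemma Im_moebius g tau : uhp tau ->
  Im (moebius g tau) = Im tau / normc (automorphy g tau) ^+ 2.
Proof.
move=> t0; have := automorphy_neq0 g t0; rewrite /moebius /automorphy.
have D : (g 0 0)%:~R * (g 1 1)%:~R - (g 0 1)%:~R * (g 1 0)%:~R = 1 :> R.
  by rewrite -!rmorphM -rmorphB SL2Z_detE.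
rewrite -!(rmorph_int (real_complex R)).
move: (_%:~R : R) (_%:~R : R) (_%:~R : R) (_%:~R : R) D => a b c d D.
case: tau {t0} => x y; rewrite -normc_gt0 => n0.
move: n0; simpc => /=; rewrite sqr_sqrtr; last by rewrite addr_ge0 ?sqr_ge0.
rewrite sqrtr_gt0 => n0.
transitivity ((d * c - b * a) * y / ((a * x + c) ^+ 2 + (a * y) ^+ 2)).
  by field; rewrite gt_eqF.
by rewrite D mul1r.
Qed.

Lemma uhp_moebius g tau : uhp tau -> uhp (moebius g tau).
Proof.
move=> t0; rewrite /uhp /= Im_moebius// divr_gt0// exprn_gt0// normc_gt0.
exact: automorphy_neq0.
Qed.

Lemma moebius_trans n tau : moebius (SL2Z_trans n) tau = tau + n%:~R.
Proof.
by rewrite /moebius /automorphy !SL2Z_transE /= mul0r add0r divr1 mul1r.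
Qed.

Lemma automorphy_trans n tau : automorphy (SL2Z_trans n) tau = 1.
Proof. by rewrite /automorphy !SL2Z_transE /= mul0r add0r. Qed.

End ModularGroup.

(** * Terms of the Poincare series *)

Section PoincareTerms.
Variable R : realType.
Local Notation C := R[i].
Variables (t : nat) (m : 'I_t -> nat).
Local Notation p := (\sum_(r < t) m r)%N.
Variables (rho : SL2Z -> 'M[C]_p) (mu : 'I_t -> R) (nu : 'I_t -> int).
Hypothesis rho_rep : is_representation rho.
Hypothesis rho_T : rho SL2Z_T = \mxdiag_(r < t) jordan (m r) (e2pi (mu r)%:C).
Implicit Types (g M : SL2Z) (tau x : C).

Lemma rhoM g h : rho (g * h)%g = rho g *m rho h.
Proof. exact: rho_rep.2. Qed.

Lemma rhoV g : invmx (rho g) = rho g^-1%g.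
Proof. by apply: invmx_unique; rewrite -rhoM mulgV rho_rep.1. Qed.

(** The closed form of the powers of rho(T): a diagonal matrix times a commuting unipotent one, each
    a one-parameter group in n. *)
Definition rho_trans (n : int) : 'M[C]_p :=
  Lambda m (fun r => e2pi ((mu r)%:C * n%:~R)) *m bidiag m n%:~R.

Lemma rho_transD n k : rho_trans (n + k) = rho_trans n *m rho_trans k.
Proof.
rewrite /rho_trans mulmxA -[in RHS](mulmxA (Lambda m _)) -Lambda_bidiagC.
rewrite mulmxA Lambda_mul -mulmxA bidiagD rmorphD/=.
by congr (Lambda m _ *m _); apply/funext => r; rewrite mulrDr e2piD.
Qed.

Lemma rho_trans0 : rho_trans 0 = 1%:M.
Proof.
rewrite /rho_trans bidiag0 mulmx1 -Lambda1; congr Lambda.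
by apply/funext => r; rewrite mulr0 e2pi0.
Qed.

Lemma rho_transE n : rho (SL2Z_trans n) = rho_trans n.
Proof.
have E1 : rho SL2Z_T = rho_trans 1.
  rewrite rho_T jordan_bidiag /rho_trans; congr (Lambda m _ *m _).
  by apply/funext => r; rewrite mulr1.
have En k : rho (SL2Z_trans (Posz k)) = rho_trans (Posz k).
  elim: k => [|k IH]; first by rewrite SL2Z_trans0 rho_rep.1 rho_trans0.
  by rewrite -addn1 PoszD SL2Z_transD rhoM IH SL2Z_trans1 E1 rho_transD.
case: n => k //; rewrite NegzE SL2Z_transN -rhoV En.
by apply: invmx_unique; rewrite -rho_transD subrr rho_trans0.
Qed.

Lemma m_le_p r : (m r <= p)%N.
Proof. by rewrite (bigD1 r)//= leq_addr. Qed.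

Lemma bidiag_bound x i j : normc (bidiag m x i j) <= (normc x + 1 + p%:R) ^+ p.
Proof.
have b1 : 1 <= normc x + 1 + p%:R by have := normc_ge0 x; have := ler0n R p; lra.
rewrite bidiag_entry; case: eqP => // _; last by rewrite normc0 exprn_ge0; lra.
case: ifP => _; last by rewrite normc0 exprn_ge0; lra.
set s := (_ - _)%N; have sp : (s <= p)%N.
  apply: leq_trans (leq_subr _ _) _; apply: leq_trans (m_le_p (tagnat.sig1 i)).
  exact: ltnW.
apply: (le_trans (normc_binomC_le _ _)).
apply: (@le_trans _ _ ((normc x + 1 + p%:R) ^+ s)).
  have := normc_ge0 x => x0; apply: lerXn2r; rewrite ?nnegrE ?addr_ge0//.
  have : s%:R <= p%:R :> R by rewrite ler_nat.
  by lra.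
exact: ler_weXn2l.
Qed.

(** The summand of the identity coset, with the inverse of [Brho] already evaluated; every other
    summand is [Phi] at the Moebius image between [rho] and the automorphy factors. *)
Definition Phi x : 'M[C]_p :=
  Lambda m (fun r => e2pi (((nu r)%:~R + mu r)%:C * x)) *m bidiag m x.

(** As nu_r is an integer, e(nu_r n) = 1 and only mu_r is seen by the translation; the binomial
    factor obeys the group law. *)
Lemma Phi_shift x n : Phi (x + n%:~R) = rho (SL2Z_trans n) *m Phi x.
Proof.
rewrite rho_transE /rho_trans /Phi mulmxA -[in RHS](mulmxA (Lambda m _)) -Lambda_bidiagC.
rewrite mulmxA Lambda_mul -mulmxA bidiagD [x + _]addrC.
congr (Lambda m _ *m _); apply/funext => r.
rewrite mulrDr e2piD rmorphD /= !mulrDl e2piD rmorph_int -rmorphM/= e2pi_int mul1r.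
by rewrite mulrC e2piD.
Qed.

Definition Vmax : R := \sum_(r < t) `|(nu r)%:~R + mu r|.

Lemma Phi_bound x i j : 0 <= Im x ->
  normc (Phi x i j) <= expR (2 * pi * Vmax * Im x) * (normc x + 1 + p%:R) ^+ p.
Proof.
move=> x0; rewrite /Phi Lambda_diag mul_diag_mx mxE [X in normc (X * _)]mxE normcM.
apply: ler_pM; rewrite ?normc_ge0 ?bidiag_bound//.
rewrite normc_e2pi ImMr ler_expR.
set r := tagnat.sig1 i; have h : - ((nu r)%:~R + mu r) <= Vmax.
  rewrite /Vmax (bigD1 r)//=; have := ler_norm (- ((nu r)%:~R + mu r)); rewrite normrN => h.
  by rewrite (le_trans h)// lerDl sumr_ge0.
have := ler_wpM2r x0 h; have p0 : 0 <= 2 * pi :> R by rewrite mulr_ge0// pi_ge0.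
by move=> /(ler_wpM2l p0); lra.
Qed.

Definition int_norm g : R := \sum_(i < 2) \sum_(j < 2) (absz (g i j))%:R.

Lemma int_norm_mnorm g : int_norm g = mnorm (\matrix_(i, j) (g i j)%:~R : 'M[C]_2).
Proof.
apply: eq_bigr => i _; apply: eq_bigr => j _.
by rewrite mxE normc_int natr_absz intr_norm.
Qed.

Lemma int_normM g h : int_norm (g * h)%g <= int_norm g * int_norm h.
Proof.
rewrite !int_norm_mnorm; set A := \matrix_(i, j) (g i j)%:~R; set B := \matrix_(i, j) (h i j)%:~R.
suff -> : (\matrix_(i, j) ((g * h)%g i j)%:~R : 'M[C]_2) = A *m B by exact: mnormM.
apply/matrixP => i j; rewrite [LHS]mxE SL2Z_mulE [RHS]mxE !big_ord_recl big_ord0 addr0 rmorphD !rmorphM /=.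
by rewrite !mxE; congr (_ * _ + _ * _); congr ((fun_of_matrix _ _ _)%:~R); apply: val_inj.
Qed.

Lemma int_norm_entries g : int_norm g =
  (absz (g 0 0))%:R + (absz (g 0 1))%:R + ((absz (g 1 0))%:R + (absz (g 1 1))%:R).
Proof.
rewrite /int_norm !big_ord_recl !big_ord0 !addr0.
by congr (_ + _ + (_ + _)); congr (_%:R); congr absz; congr (fun_of_matrix _ _ _); apply: val_inj.
Qed.

Lemma int_norm_ge1 g : 1 <= int_norm g.
Proof.
rewrite int_norm_entries -!natrD ler1n lt0n; apply/negP.
rewrite !addn_eq0 !absz_eq0 => /andP[_ /andP[/eqP h0 /eqP h1]].
by have := SL2Z_detE g; rewrite h0 h1 !mulr0 subrr.
Qed.

(* The entries of [g] are included so as to bound [moebius g] as well. *)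
Definition rep_size g : R := mnorm (rho g^-1%g) * int_norm g ^+ p.

Lemma rep_size_growth : exists (K : R) (al : nat), 0 <= K /\ forall M,
  exists M', [/\ M' 1 0 = M 1 0, M' 1 1 = M 1 1 & rep_size M' <= K * (bottom_size M)%:R ^+ al].
Proof.
(* For T^n the norm of [rho] is at most p^2 (1 + p)^p (1 + |n|)^p and the matrix entries contribute
   (3 (1 + |n|))^p, whence the exponent p + p. *)
pose A : R := p%:R * p%:R * (1 + p%:R) ^+ p * 3 ^+ p.
apply: (@growth R rep_size _ _ A (p + p)).
- by move=> g; rewrite mulr_ge0 ?mnorm_ge0// exprn_ge0// (le_trans ler01)// int_norm_ge1.
- move=> g h; rewrite /rep_size invgM rhoM.
  have i0 g' : 0 <= int_norm g' by rewrite (le_trans ler01)// int_norm_ge1.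
  have -> : mnorm (rho g^-1%g) * int_norm g ^+ p * (mnorm (rho h^-1%g) * int_norm h ^+ p) =
    mnorm (rho h^-1%g) * mnorm (rho g^-1%g) * (int_norm g * int_norm h) ^+ p.
    by rewrite exprMn; ring.
  apply: ler_pM; rewrite ?mnorm_ge0 ?exprn_ge0 ?mnormM//.
  by apply: lerXn2r; rewrite ?nnegrE ?mulr_ge0 ?int_normM.
move=> n; rewrite /rep_size -SL2Z_transN rho_transE.
have n0 : 0 <= (absz n)%:R :> R by [].
have p0 : 0 <= p%:R :> R by [].
have h1 : mnorm (rho_trans (- n)) <= p%:R * p%:R * ((1 + p%:R) ^+ p * (1 + (absz n)%:R) ^+ p).
  apply: mnorm_le_entries => i j.
  rewrite /rho_trans Lambda_diag mul_diag_mx mxE [X in normc (X * _)]mxE normcM.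
  rewrite -(rmorph_int (real_complex R)) -[_%:C * _](rmorphM (real_complex R)) normc_e2pi_real mul1r.
  apply: (le_trans (bidiag_bound _ _ _)); rewrite -exprMn.
  apply: lerXn2r; rewrite ?nnegrE; [by rewrite !addr_ge0// normc_ge0|by rewrite mulr_ge0// addr_ge0|].
  rewrite normc_real -intr_norm -natr_absz abszN; nra.
have h2 : int_norm (SL2Z_trans n) <= 3 * (1 + (absz n)%:R).
  by rewrite int_norm_entries !SL2Z_transE /=; lra.
have i0 : 0 <= int_norm (SL2Z_trans n) by rewrite (le_trans ler01)// int_norm_ge1.
have h3 : int_norm (SL2Z_trans n) ^+ p <= 3 ^+ p * (1 + (absz n)%:R) ^+ p.
  by rewrite -exprMn; apply: lerXn2r; rewrite ?nnegrE//; lra.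
apply: le_trans (ler_pM (mnorm_ge0 _) (exprn_ge0 _ i0) h1 h3) _.
by rewrite /A exprD le_eqVlt; apply/orP; left; apply/eqP; ring.
Qed.

Section Weights.
Variable k : 'I_p -> int.

Lemma Jmx_inv M tau : uhp tau ->
  invmx (Jmx k M tau) = diag_mx (\row_n automorphy M tau ^ (- k n)).
Proof.
move=> t0; apply: invmx_unique; rewrite /Jmx mulmx_diag; apply/matrixP => i j.
rewrite !mxE; congr (_ *+ _).
by rewrite -expfzDr ?automorphy_neq0// subrr expr0z.
Qed.

Lemma poincare_term_mxE M tau : uhp tau -> poincare_term rho mu nu k M tau =
  rho M^-1%g *m Phi (moebius M tau) *m diag_mx (\row_n automorphy M tau ^ (- k n)).
Proof.
move=> t0; rewrite /poincare_term (Jmx_inv M t0) invmx_Brho rhoV.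
by rewrite /Phi (mulmxA (rho M^-1%g) (Lambda m _)).
Qed.

Lemma poincare_termE M tau i n : uhp tau ->
  poincare_term rho mu nu k M tau i n =
  (rho M^-1%g *m Phi (moebius M tau)) i n * automorphy M tau ^ (- k n).
Proof. by move=> t0; rewrite (poincare_term_mxE M t0) mulmx_diag_entry. Qed.

(** The factor rho(T^n) from [Phi_shift] cancels against rho(T^n M)^-1. This makes the series
    independent of the representatives and lets each estimate use the best one. *)
Lemma poincare_term_coset n M tau : uhp tau ->
  poincare_term rho mu nu k (SL2Z_trans n * M)%g tau = poincare_term rho mu nu k M tau.
Proof.
move=> t0; have Mt0 := uhp_moebius M t0.
rewrite (poincare_term_mxE M t0) (poincare_term_mxE _ t0).
have -> : automorphy (SL2Z_trans n * M)%g tau = automorphy M tau.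
  by rewrite (automorphyM _ _ t0) automorphy_trans mul1r.
rewrite (moebiusM _ t0 Mt0) moebius_trans Phi_shift (mulmxA (rho _)) -rhoM.
by rewrite invgM mulgVK.
Qed.

(** The transformation law term by term: the cocycle rule absorbs the weight factor of g, and the
    summand of M becomes that of M g. *)
Lemma poincare_term_modular g M tau : uhp tau ->
  poincare_term rho mu nu k M (moebius g tau) *m invmx (Jmx k g tau) =
  rho g *m poincare_term rho mu nu k (M * g)%g tau.
Proof.
move=> t0; have gt0 := uhp_moebius g t0.
rewrite (poincare_term_mxE M gt0) (poincare_term_mxE _ t0) (Jmx_inv g t0).
rewrite (moebiusM _ t0 gt0) (mulmxA (rho g)) (mulmxA (rho g)) -rhoM.
have -> : (g * (M * g)^-1 = M^-1)%g by rewrite invgM mulVKg.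
rewrite -mulmxA mulmx_diag; congr (_ *m diag_mx _).
by apply/rowP => n; rewrite !mxE (automorphyM _ _ t0) expfzMl.
Qed.

End Weights.

(** The bound is proved at Euclid's representative of the coset. The exponential comes from
    [Lambda], the power p from the binomials in the Moebius image, and [bottom_size] from
    [rep_size]. [K] and [al] precede the weight, which is needed to state a lower bound for the
    weight in terms of [al]. *)
Lemma poincare_term_bound : exists (K : R) (al : nat), 0 <= K /\
  forall (k : 'I_p -> int) (l : nat) n, k n = Posz l -> forall M i tau, uhp tau ->
  normc (poincare_term rho mu nu k M tau i n) <=
  K * expR (2 * pi * Vmax * (Im tau / normc (automorphy M tau) ^+ 2))
    * (1 + (normc tau + 1) / normc (automorphy M tau)) ^+ p
    * (bottom_size M)%:R ^+ al / normc (automorphy M tau) ^+ l.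
Proof.
have [K [al [K0 HK]]] := rep_size_growth.
pose P1 : R := 1 + p%:R; have P10 : 0 <= P1 by rewrite addr_ge0.
exists (p%:R * p%:R * P1 ^+ p * K), al; split; first by rewrite !mulr_ge0 ?exprn_ge0.
move=> k l n kn M i tau t0.
have [M' [h0 h1 HM]] := HK M.
have [q Eq] := same_bottom (esym h0) (esym h1).
have Ea : automorphy M tau = automorphy M' tau by rewrite /automorphy h0 h1.
rewrite Eq poincare_term_coset// -Eq Ea poincare_termE// kn normcM.
have a0 := automorphy_neq0 M' t0; set a := normc (automorphy M' tau).
have ap : 0 < a by rewrite normc_gt0.
have -> : normc (automorphy M' tau ^ (- Posz l)) = (a ^+ l)^-1.
  by rewrite -exprz_inv -exprnP normcX normcV exprVn.
rewrite ler_wpM2r ?invr_ge0 ?exprn_ge0 ?(ltW ap)//.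
have Mt0 := uhp_moebius M' t0.
have y0 : 0 <= Im (moebius M' tau) by apply: ltW.
have EIm : Im (moebius M' tau) = Im tau / a ^+ 2 by apply: Im_moebius.
have N2 : 1 <= int_norm M' by apply: int_norm_ge1.
have N20 : 0 <= int_norm M' by lra.
set u := (normc tau + 1) / a.
have nt := normc_ge0 tau.
have u0 : 0 <= u by rewrite divr_ge0 ?(ltW ap)//; lra.
have mob : normc (moebius M' tau) <= int_norm M' * u.
  rewrite /moebius normcM normcV -/a /u mulrA ler_wpM2r ?invr_ge0 ?(ltW ap)//.
  rewrite (le_trans (le_normcD _ _))// normcM !normc_int -!intr_norm -!natr_absz.
  rewrite int_norm_entries.
  have := ler0n R (absz (M' 1 0)); have := ler0n R (absz (M' 1 1)).
  have := ler0n R (absz (M' 0 0)); have := ler0n R (absz (M' 0 1)).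
  by nra.
have base : normc (moebius M' tau) + 1 + p%:R <= P1 * int_norm M' * (1 + u).
  have pp : 0 <= p%:R :> R by [].
  apply: (@le_trans _ _ (P1 * (int_norm M' * (1 + u)))); last by rewrite mulrA.
  have h : 1 <= int_norm M' * (1 + u) by rewrite -[1]mulr1 ler_pM//; lra.
  have : normc (moebius M' tau) + 1 <= int_norm M' * (1 + u) by lra.
  by rewrite /P1; nra.
set E := expR _; have E0 : 0 < E by apply: expR_gt0.
have hPhi i' j' : normc (Phi (moebius M' tau) i' j') <= E * (P1 * int_norm M' * (1 + u)) ^+ p.
  apply: (le_trans (Phi_bound _ _ y0)); rewrite EIm -/E; apply: ler_wpM2l; first exact: ltW.
  apply: lerXn2r; rewrite ?nnegrE//; first by rewrite !addr_ge0 ?normc_ge0.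
  by rewrite !mulr_ge0//; lra.
have hQ := le_trans (normc_le_mnorm (rho M'^-1%g *m Phi (moebius M' tau)) i n) (mnormM _ _).
apply: (le_trans hQ).
have hm := mnorm_le_entries hPhi.
apply: (le_trans (ler_wpM2l (mnorm_ge0 _) hm)).
have u1 : 0 <= (1 + u) ^+ p by rewrite exprn_ge0//; lra.
have c0 : 0 <= p%:R * p%:R * E * P1 ^+ p * (1 + u) ^+ p.
  by rewrite !mulr_ge0 ?exprn_ge0 ?(ltW E0)//; lra.
have := ler_wpM2l c0 HM; rewrite /rep_size.
by rewrite !exprMn; congr (_ <= _); ring.
Qed.

End PoincareTerms.

(** * Majorants uniform in tau *)

Section UniformBounds.
Variable R : realType.
Local Notation C := R[i].

Lemma automorphy_lower (X y0 : R) : 0 <= X -> 0 < y0 -> exists kap : R, 0 < kap /\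
  forall (M : SL2Z) (tau : C), `|Re tau| <= X -> y0 <= Im tau ->
  kap * (bottom_size M)%:R <= normc (automorphy M tau).
Proof.
move=> X0 y00; pose L := 1 + (1 + X) / y0.
have L0 : 0 < L by rewrite addr_gt0// divr_gt0//; lra.
exists L^-1; rewrite invr_gt0; split => // M tau hX hy.
rewrite ler_pdivrMl// /bottom_size natrD.
have hI : (absz (M 1 0))%:R * y0 <= normc (automorphy M tau).
  apply: le_trans (Im_normc _); rewrite /automorphy Im_int_affine normrM -intr_norm natr_absz.
  by rewrite ler_wpM2l// (le_trans hy)// ler_norm.
have hR : `|(M 1 0)%:~R * Re tau + (M 1 1)%:~R| <= normc (automorphy M tau).
  apply: le_trans (Re_normc _).
  by rewrite /automorphy ReD -!(rmorph_int (real_complex R)) ReMr.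
have hd : (absz (M 1 1))%:R <= normc (automorphy M tau) + (absz (M 1 0))%:R * X.
  rewrite natr_absz intr_norm -{1}[(M 1 1)%:~R](addKr ((M 1 0)%:~R * Re tau)).
  rewrite addrC (le_trans (ler_normB _ _))// lerD// normrM -intr_norm -natr_absz.
  by rewrite ler_wpM2l.
set a := normc _ in hI hR hd *; set c : R := (absz (M 1 0))%:R in hI hd *.
have hc : c <= a / y0 by rewrite ler_pdivlMr.
have : c * (1 + X) <= a / y0 * (1 + X) by rewrite ler_wpM2r//; lra.
rewrite /L mulrDl mul1r; have -> : (1 + X) / y0 * a = a / y0 * (1 + X) by ring.
by lra.
Qed.

(** As |c| + |d| >= 1, both |c| + 1 and |d| + 1 are at most 2 (|c| + |d|). The fourth power thus
    splits into two summable weights. *)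
Lemma inv_bottom_size_le (M : SL2Z) :
  (bottom_size M)%:R ^- 4 <= 16 * inv_sq2 R (M 1 0, M 1 1).
Proof.
have s1 : 1 <= (bottom_size M)%:R :> R by rewrite ler1n bottom_size_gt0.
rewrite /inv_sq2 /inv_sq /= -invfM -[_^-1]mul1r ler_pdivrMr ?exprn_gt0//; last by lra.
rewrite mulrAC ler_pdivlMr; last by rewrite mulr_gt0// exprn_gt0// ltr_wpDl.
move: s1; rewrite /bottom_size natrD; set c : R := (absz (M 1 0))%:R; set d : R := (absz (M 1 1))%:R.
have c0 : 0 <= c by []; have d0 : 0 <= d by [].
move=> s1; rewrite mul1r.
have h1 : (c + 1) <= 2 * (c + d) by lra.
have h2 : (d + 1) <= 2 * (c + d) by lra.
have e1 : (c + 1) ^+ 2 <= (2 * (c + d)) ^+ 2 by apply: lerXn2r; rewrite ?nnegrE//; lra.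
have e2 : (d + 1) ^+ 2 <= (2 * (c + d)) ^+ 2 by apply: lerXn2r; rewrite ?nnegrE//; lra.
apply: le_trans (ler_pM (sqr_ge0 _) (sqr_ge0 _) e1 e2) _.
by rewrite le_eqVlt; apply/orP; left; apply/eqP; ring.
Qed.

(** Of the l powers of a, q are kept for decay and the others are replaced by powers of kap s,
    enough to beat s^al and leave s^-4. *)
Lemma power_tradeoff (kap s a : R) (al l q : nat) : 0 < kap -> 1 <= s -> kap * s <= a ->
  (al + 4 + q <= l)%N -> s ^+ al / a ^+ l <= kap ^- (l - q) * s ^- 4 / a ^+ q.
Proof.
move=> k0 s1 sa hl; have s0 : 0 < s by lra.
have ks : 0 < kap * s by rewrite mulr_gt0.
have a0 : 0 < a by lra.
have -> : a ^+ l = a ^+ (l - q) * a ^+ q by rewrite -exprD subnK//; lia.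
rewrite invfM mulrA ler_wpM2r ?invr_ge0 ?exprn_ge0 ?(ltW a0)//.
rewrite ler_pdivrMr ?exprn_gt0//.
have h1 : (kap * s) ^+ (l - q) <= a ^+ (l - q).
  by apply: lerXn2r; rewrite ?nnegrE ?(ltW ks) ?(ltW a0).
have c0 : 0 <= kap ^- (l - q) * s ^- 4 by rewrite mulr_ge0 ?invr_ge0 ?exprn_ge0 ?(ltW k0) ?(ltW s0).
apply: le_trans (ler_wpM2l c0 h1).
rewrite exprMn [X in _ <= X](_ : _ = s ^+ (l - q) / s ^+ 4); last first.
  by field; rewrite !expf_neq0 ?gt_eqF.
rewrite ler_pdivlMr ?exprn_gt0// -exprD; apply: ler_weXn2l => //; lia.
Qed.

Variables (t : nat) (m : 'I_t -> nat).
Local Notation p := (\sum_(r < t) m r)%N.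
Variables (rho : SL2Z -> 'M[C]_p) (mu : 'I_t -> R) (nu : 'I_t -> int).
Hypothesis rho_rep : is_representation rho.
Hypothesis rho_T : rho SL2Z_T = \mxdiag_(r < t) jordan (m r) (e2pi (mu r)%:C).

Lemma Vmax_ge0 : 0 <= Vmax mu nu.
Proof. by apply: sumr_ge0. Qed.

Lemma poincare_term_dominated : exists K : nat, forall k : 'I_p -> int,
  (forall n, Posz K <= k n) -> forall n (X y0 : R), 0 <= X -> 0 < y0 ->
  (forall y1 : R, exists2 B : R, 0 <= B & forall (M : SL2Z) i (tau : C), `|Re tau| <= X ->
     y0 <= Im tau -> Im tau <= y1 ->
     normc (poincare_term rho mu nu k M tau i n) <= B * inv_sq2 R (M 1 0, M 1 1)) /\
  (exists2 B : R, 0 <= B & forall (M : SL2Z) i (tau : C), `|Re tau| <= X ->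
     y0 <= Im tau -> M 1 0 != 0 ->
     normc (poincare_term rho mu nu k M tau i n) <=
     B * inv_sq2 R (M 1 0, M 1 1) / Im tau ^+ p.+1).
Proof.
have V0 := Vmax_ge0.
have EV0 : 0 <= 2 * pi * Vmax mu nu by rewrite mulr_ge0// mulr_ge0// pi_ge0.
have [K0 [al [K00 HK]]] := poincare_term_bound nu rho_rep rho_T.
exists (al + 4 + p.+1)%N => k hk n X y0 X0 y00.
  have [l kn] : exists l, k n = Posz l by exists (absz (k n)); have := hk n; lia.
  have hl : (al + 4 + p.+1 <= l)%N by have := hk n; rewrite kn.
  have [kap [kap0 Hkap]] := automorphy_lower X0 y00.
  (* E and U stand for bounds of the exponential factor and of the Moebius image. A strip of bounded
     height takes q = 0, the cusp takes q = p + 1. *)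
  have main (E U : R) q : (q <= p.+1)%N -> 0 <= E -> 0 <= U -> forall (M : SL2Z) i (tau : C),
    `|Re tau| <= X -> y0 <= Im tau ->
    expR (2 * pi * Vmax mu nu * (Im tau / normc (automorphy M tau) ^+ 2)) <= E ->
    (normc tau + 1) / normc (automorphy M tau) <= U ->
    normc (poincare_term rho mu nu k M tau i n) <=
    K0 * E * (1 + U) ^+ p * kap ^- (l - q) * 16 * inv_sq2 R (M 1 0, M 1 1) / normc (automorphy M tau) ^+ q.
    move=> hq E0 U0 M i tau hX hy hE hU.
    have hlq : (al + 4 + q <= l)%N by apply: leq_trans hl; rewrite leq_add2l.
    have t0 : uhp tau by rewrite /uhp/=; lra.
    have s1 : 1 <= (bottom_size M)%:R :> R by rewrite ler1n bottom_size_gt0.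
    have ap : 0 < normc (automorphy M tau) by rewrite normc_gt0 automorphy_neq0.
    have nt := normc_ge0 tau.
    have u0 : 0 <= (normc tau + 1) / normc (automorphy M tau) by rewrite divr_ge0 ?(ltW ap)//; lra.
    apply: (le_trans (HK k l n kn M i tau t0)); rewrite -[X in X <= _]mulrA.
    set Ex := expR _ in hE *; set u := (normc tau + 1) / _ in hU u0 *.
    have h1 : K0 * Ex * (1 + u) ^+ p <= K0 * E * (1 + U) ^+ p.
      apply: ler_pM; rewrite ?mulr_ge0 ?expR_ge0 ?exprn_ge0//; first by lra.
        by rewrite ler_wpM2l.
      by apply: lerXn2r; rewrite ?nnegrE; lra.
    have h2a := Hkap M tau hX hy.
    have h2 : (bottom_size M)%:R ^+ al / normc (automorphy M tau) ^+ l <=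
      kap ^- (l - q) * (bottom_size M)%:R ^- 4 / normc (automorphy M tau) ^+ q.
      move: (normc (automorphy M tau)) h2a => aa h2a.
      exact: (power_tradeoff kap0 s1 h2a hlq).
    have h3 : kap ^- (l - q) * (bottom_size M)%:R ^- 4 / normc (automorphy M tau) ^+ q <=
      kap ^- (l - q) * (16 * inv_sq2 R (M 1 0, M 1 1)) / normc (automorphy M tau) ^+ q.
      rewrite ler_wpM2r ?invr_ge0 ?exprn_ge0 ?(ltW ap)// ler_wpM2l ?inv_bottom_size_le//.
      by rewrite invr_ge0 exprn_ge0// ltW.
    have h4 : 0 <= (bottom_size M)%:R ^+ al / normc (automorphy M tau) ^+ l.
      by rewrite divr_ge0 ?exprn_ge0 ?(ltW ap)//; lra.
    have h5 : 0 <= K0 * Ex * (1 + u) ^+ p.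
      by rewrite !mulr_ge0 ?expR_ge0 ?exprn_ge0//; lra.
    apply: le_trans (ler_pM h5 h4 h1 (le_trans h2 h3)) _.
    by rewrite le_eqVlt; apply/orP; left; apply/eqP; ring.
  split=> [y1|].
    have [y10|y10] := leP y0 y1; last first.
      by exists 0 => // M i tau _ h1 h2; have := lt_le_trans y10 h1; lra.
    have y1p : 0 <= y1 by lra.
    pose E := expR (2 * pi * Vmax mu nu * (y1 / kap ^+ 2)).
    pose U := (X + y1 + 1) / kap.
    have E0 : 0 <= E := expR_ge0 _.
    have U0 : 0 <= U by rewrite divr_ge0 ?(ltW kap0)//; lra.
    exists (K0 * E * (1 + U) ^+ p * kap ^- (l - 0) * 16).
      by rewrite !mulr_ge0 ?exprn_ge0 ?invr_ge0 ?exprn_ge0 ?(ltW kap0)//; lra.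
    move=> M i tau hX hy hy1.
    have s1 : 1 <= (bottom_size M)%:R :> R by rewrite ler1n bottom_size_gt0.
    have ka : kap <= normc (automorphy M tau).
      by apply: le_trans (Hkap M tau hX hy); rewrite ler_peMr// ltW.
    have := main E U 0%N isT E0 U0 M i tau hX hy; rewrite expr0 divr1; apply.
      rewrite ler_expR ler_wpM2l//; apply: ler_pM; rewrite ?invr_ge0 ?exprn_ge0 ?normc_ge0//; first by lra.
      rewrite lef_pV2 ?posrE ?exprn_gt0//; last by lra.
      by apply: lerXn2r; rewrite ?nnegrE; lra.
    apply: ler_pM; rewrite ?invr_ge0 ?addr_ge0 ?normc_ge0//.
      have := normc_ReIm tau; have : `|Im tau| <= y1 by rewrite ger0_norm//; lra.
      by lra.
    by rewrite lef_pV2 ?posrE; lra.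
  (* For c <> 0 one has |c tau + d| >= Im tau: the image has imaginary part at most 1 / y0 however
     high tau lies, and p + 1 powers of the automorphy factor turn into powers of Im tau. *)
  pose E := expR (2 * pi * Vmax mu nu * y0^-1).
  pose U := (X + 1) / y0 + 1.
  have E0 : 0 <= E := expR_ge0 _.
  have U0 : 0 <= U by rewrite addr_ge0// divr_ge0; lra.
  exists (K0 * E * (1 + U) ^+ p * kap ^- (l - p.+1) * 16).
    by rewrite !mulr_ge0 ?exprn_ge0 ?invr_ge0 ?exprn_ge0 ?(ltW kap0)//; lra.
  move=> M i tau hX hy c0.
  have yp : 0 < Im tau by lra.
  have ya : Im tau <= normc (automorphy M tau).
    apply: le_trans (Im_normc _); rewrite /automorphy Im_int_affine normrM.
    rewrite (gtr0_norm yp) ler_peMl ?(ltW yp)// -intr_norm -natr_absz.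
    by rewrite ler1n lt0n absz_eq0.
  have ap : 0 < normc (automorphy M tau) by lra.
  apply: le_trans (main E U p.+1 (leqnn _) E0 U0 M i tau hX hy _ _) _.
  - rewrite ler_expR ler_wpM2l//.
    apply: (@le_trans _ _ (Im tau / Im tau ^+ 2)).
      rewrite ler_wpM2l ?(ltW yp)// lef_pV2 ?posrE ?exprn_gt0//.
      by apply: lerXn2r; rewrite ?nnegrE; lra.
    have -> : Im tau / Im tau ^+ 2 = (Im tau)^-1.
      by field; rewrite gt_eqF.
    by rewrite lef_pV2 ?posrE.
  - apply: (@le_trans _ _ ((X + 1 + Im tau) / Im tau)).
      apply: ler_pM; rewrite ?invr_ge0 ?addr_ge0 ?normc_ge0//.
        have := normc_ReIm tau; rewrite (gtr0_norm yp).
        by lra.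
      by rewrite lef_pV2 ?posrE.
    rewrite mulrDl divff ?gt_eqF// lerD2r ler_wpM2l//; first by lra.
    by rewrite lef_pV2 ?posrE.
  rewrite ler_wpM2l//.
    rewrite !mulr_ge0 ?inv_sq2_ge0 ?exprn_ge0 ?invr_ge0 ?exprn_ge0 ?(ltW kap0)//; lra.
  rewrite lef_pV2 ?posrE ?exprn_gt0//.
  by apply: lerXn2r; rewrite ?nnegrE; lra.
Qed.

End UniformBounds.

(** * Bases of chains *)

Section ChainBasis.
Variable R : realType.
Local Notation C := R[i].
Variables (p u : nat) (f : 'I_p -> C -> C) (mu : 'I_u -> R).
Implicit Types (d : 'I_u -> nat) (g : 'I_u -> nat -> C -> C) (c : 'I_u -> nat -> C).
Local Notation lam r := (e2pi (mu r)%:C).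

Definition comb d g c (tau : C) : C := \sum_(r < u) \sum_(j < d r) c r j * g r j tau.

Definition in_span d g (h : C -> C) := exists c, forall tau, uhp tau -> h tau = comb d g c tau.

Definition in_range (h : C -> C) := exists a : 'I_p -> C, forall tau, uhp tau ->
  h tau = \sum_(i < p) a i * f i tau.

(** The invariant of the shortening process; the chains may be linearly dependent and may have
    length 0. *)
Definition spanning_chains d g :=
  [/\ forall r, is_chain (d r) (mu r) (g r),
      forall r j, (j < d r)%N -> in_range (g r j) &
      forall i, in_span d g (f i)].

Lemma comb_sum d g (I : Type) (s : seq I) (P : pred I) (a : I -> C) (c : I -> 'I_u -> nat -> C) tau :
  \sum_(i <- s | P i) a i * comb d g (c i) tau =
  comb d g (fun r j => \sum_(i <- s | P i) a i * c i r j) tau.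
Proof.
rewrite /comb.
under [RHS]eq_bigr do under eq_bigr do rewrite mulr_suml.
under [RHS]eq_bigr do rewrite exchange_big/=.
rewrite exchange_big/=; apply: eq_bigr => i _; rewrite mulr_sumr; apply: eq_bigr => r _.
by rewrite mulr_sumr; apply: eq_bigr => j _; rewrite mulrA.
Qed.

Lemma in_span_sum d g (I : finType) (P : pred I) (a : I -> C) (h : I -> C -> C) :
  (forall i, P i -> in_span d g (h i)) -> in_span d g (fun tau => \sum_(i | P i) a i * h i tau).
Proof.
move=> H; have /choice[c Hc] : forall i, exists c, P i -> forall tau, uhp tau -> h i tau = comb d g c tau.
  move=> i; case Pi : (P i); last by exists (fun _ _ => 0).
  by have [c Hc] := H i Pi; exists c.
exists (fun r j => \sum_(i | P i) a i * c i r j) => tau t0.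
by rewrite -comb_sum; apply: eq_bigr => i Pi; rewrite Hc.
Qed.

Lemma in_range_sum (I : finType) (P : pred I) (a : I -> C) (h : I -> C -> C) :
  (forall i, P i -> in_range (h i)) -> in_range (fun tau => \sum_(i | P i) a i * h i tau).
Proof.
move=> H; have /choice[c Hc] : forall i, exists c : 'I_p -> C, P i ->
    forall tau, uhp tau -> h i tau = \sum_(n < p) c n * f n tau.
  move=> i; case Pi : (P i); last by exists (fun=> 0).
  by have [c Hc] := H i Pi; exists c.
exists (fun n => \sum_(i | P i) a i * c i n) => tau t0.
under [RHS]eq_bigr do rewrite mulr_suml.
rewrite exchange_big/=; apply: eq_bigr => i Pi; rewrite Hc// mulr_sumr.
by apply: eq_bigr => n _; rewrite mulrA.
Qed.

Lemma in_span_mem d g r j : (j < d r)%N -> in_span d g (g r j).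
Proof.
move=> jd; exists (fun r' j' => ((r' == r) && (j' == j))%:R) => tau _.
rewrite /comb (bigD1 r)//= (bigD1 (Ordinal jd))//= !eqxx mul1r.
rewrite big1 => [|i]; last by rewrite -val_eqE/= => /negbTE ->; rewrite mul0r.
rewrite big1 ?addr0// => r' /negbTE r'r; rewrite big1// => i _.
by rewrite r'r mul0r.
Qed.

Lemma in_span_trans d g d' g' h : (forall r j, (j < d r)%N -> in_span d' g' (g r j)) ->
  in_span d g h -> in_span d' g' h.
Proof.
move=> H [c Hc].
have : in_span d' g' (fun tau => \sum_(r < u) 1 * (\sum_(j < d r) c r j * g r j tau)).
  apply: in_span_sum => r _; apply: in_span_sum => j _; exact: H.
move=> [c' Hc']; exists c' => tau t0; rewrite Hc// -Hc'//.
by apply: eq_bigr => r _; rewrite mul1r.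
Qed.

Definition relation d g c := forall tau, uhp tau -> comb d g c tau = 0.

Definition trivial_on d c := forall r j, (j < d r)%N -> c r j = 0.

Definition height d c r : nat := \max_(j < d r | c r j != 0) j.+1.

(** A termination measure: it drops when [derived] is taken at a chain carrying a nonzero
    coefficient. *)
Definition weight d c : nat := \sum_(r < u) height d c r.

Definition shift_coef d c r j : C := if (j.+1 < d r)%N then c r j.+1 else 0.

(* Coefficients of the relation obtained by applying T / lam r0 - 1, where T is the
   translation by 1; it lowers the height at r0 and raises none. *)
Definition derived d c r0 r j : C :=
  (lam r / lam r0 - 1) * c r j + lam r / lam r0 * shift_coef d c r j.

Lemma uhpD1 (tau : C) : uhp tau -> uhp (tau + 1).
Proof. by rewrite /uhp/= ImD /= addr0. Qed.

Lemma relation_derived d g c r0 : (forall r, is_chain (d r) (mu r) (g r)) ->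
  relation d g c -> relation d g (derived d c r0).
Proof.
move=> ch rel tau t0; have E1 := rel _ (uhpD1 t0); rewrite /comb in E1.
have l0 : lam r0 != 0 := e2pi_neq0 _.
have E2 : \sum_(r < u) \sum_(j < d r) lam r * (c r j + shift_coef d c r j) * g r j tau = 0.
  rewrite -[RHS]E1; apply: eq_bigr => r _.
  have Eg (j : 'I_(d r)) : c r j * g r j (tau + 1) =
     lam r * (c r j * g r j tau) + lam r * (c r j * (if nat_of_ord j is j'.+1 then g r j' tau else 0)).
    by rewrite (ch r j (ltn_ord j) tau t0) mulrCA !mulrDr.
  under [RHS]eq_bigr do rewrite Eg.
  have El (j : 'I_(d r)) : lam r * (c r j + shift_coef d c r j) * g r j tau =
     lam r * (c r j * g r j tau) + lam r * (shift_coef d c r j * g r j tau) by ring.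
  rewrite [LHS](eq_bigr _ (fun j _ => El j)).
  rewrite !big_split/= -!mulr_sumr; congr (_ + _ * _).
  rewrite /shift_coef; case: (d r) => [|n]; first by rewrite !big_ord0.
  rewrite big_ord_recr/= ltnn mul0r addr0 [RHS]big_ord_recl/= mulr0 add0r.
  by apply: eq_bigr => j _; rewrite ltnS ltn_ord.
have E3 : comb d g (derived d c r0) tau =
  (lam r0)^-1 * (\sum_(r < u) \sum_(j < d r) lam r * (c r j + shift_coef d c r j) * g r j tau)
  + (-1) * comb d g c tau.
  rewrite /comb !mulr_sumr -big_split/=; apply: eq_bigr => r _.
  rewrite !mulr_sumr -big_split/=; apply: eq_bigr => j _.
  by rewrite /derived; field.
by rewrite E3 E2 rel// !mulr0 addr0.
Qed.

Lemma leq_height d c r j : (j < d r)%N -> c r j != 0 -> (j < height d c r)%N.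
Proof.
move=> jd cj; rewrite /height.
exact: (@leq_bigmax_cond _ (fun j : 'I_(d r) => c r j != 0) (fun j : 'I_(d r) => j.+1) (Ordinal jd)).
Qed.

Lemma height_leP d c r n : (forall j, (j < d r)%N -> c r j != 0 -> (j < n)%N) ->
  (height d c r <= n)%N.
Proof. by move=> H; apply/bigmax_leqP => j; apply: H. Qed.

Lemma height_derived d c r0 r : (height d (derived d c r0) r <= height d c r)%N.
Proof.
apply: height_leP => j jd; rewrite /derived /shift_coef => nz.
have [cj|cj] := eqVneq (c r j) 0; last exact: leq_height.
move: nz; rewrite cj mulr0 add0r; case: ifP => [jd1 nz|]; last by rewrite mulr0 eqxx.
apply: ltnW; apply: leq_height => //.
by apply: contraNneq nz => ->; rewrite mulr0.
Qed.

Lemma height_derived_lt d c r0 j : (j < d r0)%N -> c r0 j != 0 ->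
  (height d (derived d c r0) r0 < height d c r0)%N.
Proof.
move=> jd cj; have h0 := leq_height jd cj.
rewrite -(ltn_predK h0) ltnS; apply: height_leP => j' jd'.
rewrite /derived divff ?e2pi_neq0// subrr mul0r add0r mul1r /shift_coef.
by case: ifP => [jd1 nz|]; [have := leq_height jd1 nz; lia|rewrite eqxx].
Qed.

(** Descent by [derived] until it gives the trivial relation. Then, read from the top of a chain
    downwards, its equations kill all coefficients of chains with another eigenvalue, and in chains
    with the eigenvalue of [r0] all but the bottom one. *)
Lemma minimal_relation d g : (forall r, is_chain (d r) (mu r) (g r)) ->
  (exists2 c, relation d g c & ~ trivial_on d c) ->
  exists c r0, [/\ relation d g c, (0 < d r0)%N, c r0 0%N != 0 &
    forall r j, (j < d r)%N -> c r j != 0 -> j = 0%N /\ lam r = lam r0].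
Proof.
move=> ch [c0 rel0 nt0].
have [n] := ubnP (weight d c0); elim: n c0 rel0 nt0 => // n IH c rel nt wn.
have [r0 [j0 [jd0 cj0]]] : exists r0 j0, (j0 < d r0)%N /\ c r0 j0 != 0.
  apply: contrapT => H; apply: nt => r j jd; apply/eqP; apply: contrapT => /negP nz.
  by apply: H; exists r, j.
have [tr|ntr] := pselect (trivial_on d (derived d c r0)); last first.
  apply: IH ntr _; first exact: relation_derived.
  rewrite -ltnS; apply: leq_trans wn; rewrite ltnS.
  rewrite /weight (bigD1 r0)//= [X in (_ < X)%N](bigD1 r0)//=.
  rewrite -addSn leq_add ?height_derived_lt//; first exact: height_derived_lt cj0.
  by apply: leq_sum => r _; apply: height_derived.
have l0 : lam r0 != 0 := e2pi_neq0 _.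
have other r : lam r != lam r0 -> forall j, (j < d r)%N -> c r j = 0.
  move=> lr; have nz : lam r / lam r0 - 1 != 0.
    by apply: contraNneq lr => /eqP; rewrite subr_eq0 => /eqP h; rewrite -[lam r](divfK l0) h mul1r.
  suff H k j : (d r - j)%N = k -> (j < d r)%N -> c r j = 0 by move=> j; apply: H erefl.
  elim: k j => [|k IHk] j Ek jd; first lia.
  have := tr r j jd; rewrite /derived /shift_coef; case: ifP => jd1.
    rewrite (IHk j.+1) ?mulr0 ?addr0//; last by lia.
    by move/eqP; rewrite mulf_eq0 (negbTE nz) => /eqP.
  by rewrite mulr0 addr0 => /eqP; rewrite mulf_eq0 (negbTE nz) => /eqP.
have same r : lam r = lam r0 -> forall j, (j.+1 < d r)%N -> c r j.+1 = 0.
  move=> lr j jd1; have := tr r j (ltnW jd1).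
  by rewrite /derived /shift_coef jd1 lr divff// subrr mul0r add0r mul1r.
have key r j : (j < d r)%N -> c r j != 0 -> j = 0%N /\ lam r = lam r0.
  move=> jd nz; have [lr|lr] := eqVneq (lam r) (lam r0); last by rewrite other ?eqxx in nz.
  by split=> //; case: j jd nz => // j jd; rewrite same ?eqxx.
have [j00 _] := key _ _ jd0 cj0; rewrite j00 in jd0 cj0.
by exists c, r0.
Qed.

(* A minimal relation involves only bottoms of chains with a common eigenvalue; the
   same combination of these chains, cut at the shortest one, has bottom 0. *)
Lemma shorten_chains d g : spanning_chains d g ->
  (exists2 c, relation d g c & ~ trivial_on d c) ->
  exists d' g', [/\ spanning_chains d' g', (\sum_r d' r < \sum_r d r)%N &
    forall r, (d' r <= d r)%N].
Proof.
move=> [ch rg sp] /(minimal_relation ch)[c [r1 [rel d1 c1 Hc]]].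
pose S r := (0 < d r)%N && (c r 0%N != 0).
have S1 : S r1 by rewrite /S d1 c1.
(* Taking a shortest contributing chain makes the combination [h j] meaningful for every j below its
   length. *)
have [r0 S0 min0] := arg_minnP d S1.
have /andP[d0 c0] := S0.
have lamS r : S r -> lam r = lam r0.
  by move=> /andP[dr cr]; rewrite (Hc _ _ dr cr).2 (Hc _ _ d0 c0).2.
pose h j tau := \sum_(r | S r) c r 0%N / c r0 0%N * g r j tau.
have h0 tau : uhp tau -> h 0%N tau = 0.
  move=> t0; have := rel tau t0; rewrite /comb => E.
  apply: (mulfI c0); rewrite mulr0 -[RHS]E /h mulr_sumr.
  rewrite [RHS](bigID S)/= [X in _ = _ + X]big1 ?addr0 => [|r].
    apply: eq_bigr => r /andP[dr cr]; rewrite (bigD1 (Ordinal dr))//= big1 ?addr0.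
      by rewrite mulrA mulrCA divff// mulr1.
    move=> j jn; have [->|nz] := eqVneq (c r j) 0; first by rewrite mul0r.
    have [j00 _] := Hc _ _ (ltn_ord j) nz.
    by move: jn; rewrite -val_eqE /= j00.
  move=> nS; apply: big1 => j _; have [->|nz] := eqVneq (c r j) 0; first by rewrite mul0r.
  have [j00 _] := Hc _ _ (ltn_ord j) nz; rewrite j00 in nz.
  by rewrite /S nz (leq_ltn_trans (leq0n _) (ltn_ord j)) in nS.
pose d' r := if r == r0 then (d r0).-1 else d r.
(* As [h 0] vanishes, h 1, h 2, ... is again a chain, one step shorter; it replaces the chain
   [r0]. *)
pose g' r j := if r == r0 then h j.+1 else g r j.
exists d', g'; split; last first.
- by move=> r; rewrite /d'; case: eqP => // ->; exact: leq_pred.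
- rewrite (bigD1 r0)//= [X in (_ < X)%N](bigD1 r0)//= /d' eqxx.
  rewrite (eq_bigr d) => [|r /negbTE ->//].
  by rewrite -addSn leq_add// prednK.
have hch j tau : (j < d r0)%N -> uhp tau -> h j (tau + 1) =
    lam r0 * (h j tau + if j is j'.+1 then h j' tau else 0).
  move=> jd t0; rewrite /h.
  under eq_bigr => r Sr do rewrite (ch r j (leq_trans jd (min0 r Sr)) tau t0) (lamS r Sr).
  case: j jd => [|j] jd.
    by rewrite addr0 mulr_sumr; apply: eq_bigr => r _; rewrite addr0 mulrCA.
  by rewrite -big_split/= mulr_sumr; apply: eq_bigr => r _; ring.
split.
- move=> r; rewrite /d' /g'; case: eqVneq => [->|_]; last exact: ch.
  move=> j jd tau t0; rewrite hch//; last by lia.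
  by case: j {jd} => [|j] //; rewrite h0.
- move=> r j; rewrite /d' /g'; case: eqVneq => [_ jd|_ jd]; last exact: rg.
  apply: in_range_sum => r' Sr'; apply: rg.
  by apply: leq_trans (min0 r' Sr'); lia.
(* Nothing is lost: [h j] contains [g r0 j] with coefficient 1, so the latter is [h j] minus members
   of untouched chains. *)
- move=> i; apply: in_span_trans (sp i) => r j jd.
  have [Er|nr] := eqVneq r r0; last first.
    have -> : g r j = g' r j by rewrite /g' (negbTE nr).
    by apply: in_span_mem; rewrite /d' (negbTE nr).
  have hin : in_span d' g' (h j).
    case: j jd => [|j] jd.
      exists (fun _ _ => 0) => tau t0; rewrite h0// /comb big1// => r' _.
      by rewrite big1// => j' _; rewrite mul0r.
    have -> : h j.+1 = g' r0 j by rewrite /g' eqxx.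
    by apply: in_span_mem; rewrite /d' eqxx; move: jd; rewrite Er; lia.
  have rest : in_span d' g' (fun tau => \sum_(r' | S r' && (r' != r0)) (- (c r' 0%N / c r0 0%N)) * g r' j tau).
    apply: in_span_sum => r' /andP[Sr' nr'].
    have -> : g r' j = g' r' j by rewrite /g' (negbTE nr').
    by apply: in_span_mem; rewrite /d' (negbTE nr'); apply: leq_trans (min0 r' Sr'); rewrite -Er.
  have [a Ha] := hin; have [b Hb] := rest.
  exists (fun r j => a r j + b r j) => tau t0.
  have -> : comb d' g' (fun r j => a r j + b r j) tau = comb d' g' a tau + comb d' g' b tau.
    rewrite /comb -big_split/=; apply: eq_bigr => r' _; rewrite -big_split/=.
    by apply: eq_bigr => j' _; rewrite mulrDl.
  rewrite -Ha// -Hb// /h (bigD1 r0)//= divff// mul1r Er -addrA -big_split/= big1 ?addr0// => r' _.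
  by rewrite mulNr subrr.
Qed.

Lemma independent_chains d g : spanning_chains d g ->
  exists d' g', [/\ spanning_chains d' g', forall r, (d' r <= d r)%N &
    forall c, relation d' g' c -> trivial_on d' c].
Proof.
have [n] := ubnP (\sum_r d r); elim: n d g => // n IH d g dn sc.
have [H|H] := pselect (exists2 c, relation d g c & ~ trivial_on d c); last first.
  exists d, g; split => // c rel; apply: contrapT => nt.
  by apply: H; exists c.
have [d' [g' [sc' lt le]]] := shorten_chains sc H.
have [|d2 [g2 [h1 h2 h3]]] := IH d' g' _ sc'; first by apply: leq_trans lt _; rewrite -ltnS.
by exists d2, g2; split => // r; apply: leq_trans (h2 r) (le r).
Qed.

End ChainBasis.

Section ChainBasisNonempty.
Variable R : realType.
Local Notation C := R[i].

(** Shortening can exhaust a chain, and a basis must consist of nonempty ones; the surviving chains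
    are renumbered. Their lengths stay controlled by the original ones. *)
Lemma chain_basis (p u : nat) (F : C -> 'cV[C]_p) (mu : 'I_u -> R) d g :
  spanning_chains (fun i tau => F tau i 0) mu d g ->
  exists (u' : nat) (d' : 'I_u' -> nat) (mu' : 'I_u' -> R) (g' : 'I_u' -> nat -> C -> C),
    is_basis_of_span d' g' F /\ forall r,
    [/\ (0 < d' r)%N, exists r', (d' r <= d r')%N & is_chain (d' r) (mu' r) (g' r)].
Proof.
move=> /independent_chains[d1 [{}g [[ch rg sp] dd ind]]].
pose U := [set r : 'I_u | (0 < d1 r)%N]%SET.
pose e := @enum_val _ (mem U); have eU i : (0 < d1 (e i))%N.
  by have := enum_valP i; rewrite inE.
have E (c : 'I_u -> nat -> C) tau : comb d1 g c tau =
    \sum_(i < #|U|) \sum_(j < d1 (e i)) c (e i) j * g (e i) j tau.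
  rewrite /comb (bigID (mem U))/= [X in _ + X]big1 ?addr0; last first.
    move=> r; rewrite inE -eqn0Ngt => /eqP ->; by rewrite big_ord0.
  by rewrite big_enum_val.
exists #|U|, (fun i => d1 (e i)), (fun i => mu (e i)), (fun i => g (e i)); split; last first.
  by move=> i; split; [exact: eU|exists (e i); exact: dd|exact: ch].
split.
- move=> c Hc i j jd.
  pose c' r j := if [pick i | e i == r] is Some i then c i j else 0.
  have Ec' i' j' : c' (e i') j' = c i' j'.
    rewrite /c'; case: pickP => [i'' /eqP /enum_val_inj ->//|/(_ i')].
    by rewrite eqxx.
  have rel : relation d1 g c'.
    move=> tau t0; rewrite E -[RHS](Hc tau t0); apply: eq_bigr => i' _.
    by apply: eq_bigr => j' _; rewrite Ec'.
  by have := ind c' rel (e i) j jd; rewrite Ec'.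
- by move=> i j jd; apply: rg.
- move=> i; have [c Hc] := sp i; exists (fun r => c (e r)) => tau t0.
  by rewrite Hc// E.
Qed.

End ChainBasisNonempty.

(** * Logarithmic q-expansions *)

Section LogExpansion.
Variable R : realType.
Local Notation C := R[i].

Lemma uhp_Im (tau : C) : uhp tau -> 0 < Im tau.
Proof. by []. Qed.

(** The functions h_s of the logarithmic expansion: convolution with binomials in - tau inverts
    convolution with binomials in tau. *)
Definition periodic_part (g : nat -> C -> C) (s : nat) (tau : C) : C :=
  \sum_(i < s.+1) binomC (- tau) i * g (s - i)%N tau.

Lemma periodic_partK g j tau :
  \sum_(s < j.+1) binomC tau s * periodic_part g (j - s) tau = g j tau.
Proof.
pose T (s l : nat) := binomC tau s * (binomC (- tau) l * g (j - s - l)%N tau).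
have -> : \sum_(s < j.+1) binomC tau s * periodic_part g (j - s) tau =
   \sum_(n < j.+1) (\sum_(s < n.+1) binomC tau s * binomC (- tau) (n - s)) * g (j - n)%N tau.
  rewrite /periodic_part.
  under eq_bigr do rewrite mulr_sumr.
  under [RHS]eq_bigr do rewrite mulr_suml.
  (* The double sum is regrouped along n = s + l, so that Vandermonde at tau + (- tau) = 0 leaves
     only n = 0. *)
  transitivity (\sum_(s < j.+1) \sum_(n < j.+1 | (s <= n)%N) T s (n - s)%N).
    apply: eq_bigr => s _; rewrite -(big_mkord xpredT (fun l => T s l)).
    rewrite -(big_mkord (fun n => (s <= n)%N) (fun n => T s (n - s)%N)).
    have sj := ltn_ord s.
    rewrite [RHS](big_cat_nat (n := s))//=; last exact: ltnW.
    rewrite [X in _ = X + _]big_nat_cond [X in _ = X + _]big1 ?add0r; last first.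
      by move=> n /andP[/andP[_ ns] sn]; rewrite leqNgt ns in sn.
    have -> : \sum_(s <= n < j.+1 | (s <= n)%N) T s (n - s)%N = \sum_(s <= n < j.+1) T s (n - s)%N.
      rewrite big_nat_cond [RHS]big_nat; apply: eq_bigl => n.
      by case: (s <= n)%N; rewrite ?andbT ?andbF.
    have -> : \sum_(s <= n < j.+1) T s (n - s)%N = \sum_(0 + s <= n < j.+1) T s (n - s)%N by rewrite add0n.
    rewrite big_addn subSn -1?ltnS//.
    by apply: eq_bigr => l _; rewrite addnK.
  rewrite (exchange_big_dep xpredT)//=; apply: eq_bigr => n _.
  rewrite -(big_mkord (fun s => (s <= n)%N) (fun s => T s (n - s)%N)).
  rewrite -(big_mkord xpredT (fun s => binomC tau s * binomC (- tau) (n - s) * g (j - n)%N tau)).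
  have nj := ltn_ord n.
  rewrite (big_cat_nat (n := n.+1))//= [X in _ + X]big_nat_cond [X in _ + X]big1 ?addr0; last first.
    by move=> s /andP[/andP[ns _] sn]; rewrite ltnNge sn in ns.
  rewrite big_nat_cond [RHS]big_nat; apply: eq_big => s; first by rewrite ltnS; case: (s <= n)%N.
  move=> /andP[/andP[_ sn] _]; rewrite /T mulrA; congr (_ * g _ tau); lia.
under eq_bigr do rewrite binomC_vandermonde subrr binomC0n.
rewrite big_ord_recl/= subn0 mul1r big1 ?addr0// => i _.
by rewrite /bump/= mul0r.
Qed.

(** The extra term of the chain law moves the index by one, and Pascal's rule merges binomials in -
    (tau + 1) into binomials in - tau. *)
Lemma periodic_part_shift d mu g s tau : is_chain d mu g -> (s < d)%N -> uhp tau ->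
  periodic_part g s (tau + 1) = e2pi mu%:C * periodic_part g s tau.
Proof.
move=> ch sd t0; rewrite /periodic_part mulr_sumr.
have E (i : 'I_s.+1) : binomC (- (tau + 1)) i * g (s - i)%N (tau + 1) =
   e2pi mu%:C * (binomC (- (tau + 1)) i * g (s - i)%N tau) +
   e2pi mu%:C * (binomC (- (tau + 1)) i * (if (i < s)%N then g (s - i.+1)%N tau else 0)).
  rewrite ch//; last by apply: leq_ltn_trans sd; apply: leq_subr.
  rewrite mulrCA !mulrDr; congr (_ + _ * (_ * _)).
  case: ltnP => [si|si].
    by have -> : (s - i = (s - i.+1).+1)%N by lia.
  by have -> : (s - i = 0)%N by lia.
under eq_bigr do rewrite E.
rewrite big_split/= [X in _ + X]big_ord_recr/= ltnn !mulr0 addr0.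
rewrite [X in X + _]big_ord_recl [RHS]big_ord_recl/= !binomC0 -addrA; congr (_ + _).
rewrite -big_split/=; apply: eq_bigr => i _; rewrite ltn_ord /bump /= add1n.
rewrite -mulrDr -mulrDl -binomC_pascal; congr (_ * (binomC _ _ * _)); ring.
Qed.

Lemma periodic_part_hol d g s (tau : C) :
  (forall j, (j < d)%N -> forall z, uhp z -> hol (g j) z) -> (s < d)%N -> uhp tau ->
  hol (periodic_part g s) tau.
Proof.
move=> hg sd t0; apply: hol_sum => i _; apply: holM; last first.
  by apply: hg => //; apply: leq_ltn_trans sd; apply: leq_subr.
apply: (@hol_comp R (fun x => binomC x i) (fun z => - z)); first by apply: holN; exact: hol_id.
rewrite /binomC; apply: holM; last exact: hol_cst.
by apply: hol_prod => l _; apply: holD; [exact: hol_id|exact: hol_cst].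
Qed.

(** One height y for each e is enough, as a Fourier coefficient is bounded on a single line. The
    power y^P pays for the binomials in the periodic parts. *)
Definition decays (P D : nat) (g : nat -> C -> C) (x0 : R) := forall e : R, 0 < e ->
  exists2 y : R, 1 <= y & forall (x : R) j, 0 <= x <= 1 -> (j < D)%N ->
    y ^+ P * normc (g j (x +i* y)) * expR (2 * pi * x0 * y) <= e.

Lemma chain_expansion (P D : nat) (mu : R) (g : nat -> C -> C) : (D <= P)%N ->
  is_chain D mu g -> (forall j, (j < D)%N -> forall z, uhp z -> hol (g j) z) ->
  exists a : nat -> int -> C, log_q_expansion D mu g a /\
    forall s n, (s < D)%N -> decays P D g (n%:~R + mu) -> a s n = 0.
Proof.
move=> DP ch hg.
(* Dividing by e(mu tau) makes the periodic part 1-periodic; the value 0 elsewhere makes this true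
   on the whole plane, as [periodic1] requires. *)
pose f s (tau : C) : C := if 0 < Im tau
  then periodic_part g s tau * e2pi (- (mu%:C * tau)) else 0.
have fper s : (s < D)%N -> periodic1 (f s).
  move=> sd tau; rewrite /f ImD/= addr0; case: ifP => // t0.
  rewrite (periodic_part_shift ch)// mulrDr mulr1 opprD e2piD.
  rewrite -[RHS]mul1r -(e2piNK mu%:C); ring.
have fhol s : (s < D)%N -> forall z, 0 < Im z -> hol (f s) z.
  move=> sd z z0.
  have H : hol (fun tau => periodic_part g s tau * e2pi (- (mu%:C * tau))) z.
    apply: holM; first exact: periodic_part_hol hg sd _.
    apply: (@hol_comp R (@e2pi R) (fun u => - (mu%:C * u))); last exact: hol_e2pi.
    by apply/holN/holM; [exact: hol_cst|exact: hol_id].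
  apply: eq_hol z0 _ H => w wz; rewrite /f.
  have -> : 0 < Im w; last by [].
  have := le_lt_trans (Im_normc (w - z)) wz; rewrite ImD ImN ltr_norml; lra.
have /choice[a Ha] : forall s, exists a : int -> C, (s < D)%N ->
  (forall z, 0 < Im z -> usum (fun n => a n * e2pi (n%:~R * z)) (f s z)) /\
  (forall n (y M : R), 0 < y -> (forall x : R, normc (f s (x +i* y)) <= M) ->
     normc (a n) <= M * expR (2 * pi * n%:~R * y)).
  move=> s; case sd : (s < D)%N; last by exists (fun=> 0).
  by have [a Ha] := fourier_expansion (fper s sd) (fhol s sd); exists a.
exists a; split.
  exists (periodic_part g); split; last by move=> j jd tau t0; rewrite periodic_partK.
  move=> s sd tau t0; apply/sums_toP.
  have := usumZ (e2pi (mu%:C * tau)) ((Ha s sd).1 tau t0).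
  rewrite /f (uhp_Im t0) mulrCA e2piNK mulr1.
  apply: eq_usum => n; rewrite in_setT.
  rewrite mulrCA -e2piD; congr (_ * e2pi _).
  by rewrite rmorphD/= mulrDl addrC rmorph_int.
move=> s n sd dec; apply/eq0_small => e e0.
(* s + 1 terms, each with a binomial of size at most ((2 + P) y)^P on 0 <= x <= 1, y >= 1. *)
pose c : R := s.+1%:R * (2 + P%:R) ^+ P.
have c0 : 0 < c by rewrite mulr_gt0 ?ltr0n// exprn_gt0// ltr_wpDr.
have [y y1 Hy] := dec (e / 2 / c) (divr_gt0 (divr_gt0 e0 (ltr0Sn _ 1)) c0).
have y0 : 0 < y by lra.
pose B : R := e / 2 / c / (y ^+ P * expR (2 * pi * (n%:~R + mu) * y)).
have yP : 0 < y ^+ P by rewrite exprn_gt0.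
have B0 : 0 < B by rewrite !divr_gt0// mulr_gt0// expR_gt0.
have gB x j : 0 <= x <= 1 -> (j < D)%N -> normc (g j (x +i* y)) <= B.
  move=> hx jd; rewrite ler_pdivlMr; last by rewrite mulr_gt0// expR_gt0.
  by rewrite mulrA [_ * y ^+ P]mulrC; apply: Hy.
have hM x : 0 <= x <= 1 -> normc (f s (x +i* y)) <= c * y ^+ P * B * expR (2 * pi * mu * y).
  move=> hx; rewrite /f /= y0 normcM; apply: ler_pM; rewrite ?normc_ge0//; last first.
    by rewrite normc_e2pi ImN ImMr /= ler_expR; lra.
  apply: (le_trans (normc_sum _ _ _)).
  apply: (@le_trans _ _ (\sum_(i < s.+1) ((2 + P%:R) * y) ^+ P * B)); last first.
    by rewrite sumr_const card_ord exprMn -[leLHS]mulr_natl /c !mulrA.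
  apply: ler_sum => i _; rewrite normcM.
  have iP : (i <= P)%N by apply: leq_trans DP; apply: leq_trans sd; rewrite ltnW.
  apply: ler_pM; rewrite ?normc_ge0//; last first.
    by apply: gB => //; apply: leq_ltn_trans sd; apply: leq_subr.
  apply: (le_trans (normc_binomC_le _ _)); rewrite normcN.
  have nx : normc (x +i* y) <= 1 + y.
    apply: (le_trans (normc_ReIm _)) => /=; case/andP: hx => x0 x1.
    by rewrite !ger0_norm//; lra.
  have P0 : 0 <= P%:R :> R by [].
  have iPr : i%:R <= P%:R :> R by rewrite ler_nat.
  have b1 : 1 <= (2 + P%:R) * y by nra.
  apply: (@le_trans _ _ (((2 + P%:R) * y) ^+ i)); last exact: ler_weXn2l.
  by apply: lerXn2r; rewrite ?nnegrE ?addr_ge0 ?normc_ge0//; [lra|nra].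
have hM' x : normc (f s (x +i* y)) <= c * y ^+ P * B * expR (2 * pi * mu * y).
  pose k := Num.floor x; have -> : x +i* y = ((x - k%:~R) +i* y) + k%:~R.
    rewrite -(rmorph_int (real_complex R)); congr (_ +i* _) => /=; first by rewrite subrK.
    by rewrite addr0.
  rewrite periodic1_int; last exact: fper.
  apply: hM; have := floor_le_tmp x; have := floorD1_gt x.
  by rewrite -/k intrD; lra.
have := (Ha s sd).2 n y _ y0 hM'.
have -> : c * y ^+ P * B * expR (2 * pi * mu * y) * expR (2 * pi * n%:~R * y) = e / 2.
  rewrite -[_ * expR (2 * pi * mu * y) * _]mulrA -expRD.
  have -> : 2 * pi * mu * y + 2 * pi * n%:~R * y = 2 * pi * (n%:~R + mu) * y by ring.
  rewrite /B; have := expR_gt0 (2 * pi * (n%:~R + mu) * y); move: (expR _) => E E0.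
  by field; rewrite !gt_eqF.
by lra.
Qed.

End LogExpansion.

(** * From decay of components to absent exponents *)

Section ExpansionCriterion.
Variable R : realType.
Local Notation C := R[i].
Variables (t : nat) (m : 'I_t -> nat) (mu : 'I_t -> R).
Local Notation p := (\sum_(r < t) m r)%N.

(* Component [j] of block [r]; the sum over the indices at that position avoids
   casts between index types, and is 0 when [m r <= j]. *)
Definition component_chain (F : C -> 'cV[C]_p) (r : 'I_t) (j : nat) (tau : C) : C :=
  \sum_(s < p | (tagnat.sig1 s == r) && (tagnat.sig2 s == j :> nat)) F tau s 0.

Lemma tagnat_sig_inj (s s' : 'I_p) :
  tagnat.sig1 s = tagnat.sig1 s' -> tagnat.sig2 s = tagnat.sig2 s' :> nat -> s = s'.
Proof.
move=> h1 h2; rewrite -(tagnat.sig2K s) -(tagnat.sig2K s').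
by apply/val_inj/eqP; rewrite tagnat.eq_Rank; apply/andP; split; apply/eqP.
Qed.

Lemma component_chainE F r j tau (s0 : 'I_p) :
  tagnat.sig1 s0 = r -> tagnat.sig2 s0 = j :> nat -> component_chain F r j tau = F tau s0 0.
Proof.
move=> E1 E2; rewrite /component_chain (big_pred1 s0)// => s /=.
apply/andP/eqP => [[/eqP h1 /eqP h2]|->]; last by split; apply/eqP.
by apply: tagnat_sig_inj; [rewrite h1 E1|rewrite h2 E2].
Qed.

Lemma component_index r j : (j < m r)%N ->
  exists s0 : 'I_p, tagnat.sig1 s0 = r /\ tagnat.sig2 s0 = j :> nat.
Proof.
move=> jm; exists (tagnat.Rank r (Ordinal jm)); split; first exact: tagnat.Rank1K.
by rewrite tagnat.Rank2K.
Qed.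

Variable F : C -> 'cV[C]_p.
Hypothesis F_hol : forall i z, uhp z -> hol (fun tau => F tau i 0) z.
Hypothesis F_T : forall tau, uhp tau ->
  F (tau + 1) = Lambda m (fun r => e2pi (mu r)%:C) *m bidiag m 1 *m F tau.

Lemma component_shift s0 tau : uhp tau -> F (tau + 1) s0 0 =
  e2pi (mu (tagnat.sig1 s0))%:C *
  (F tau s0 0 + if nat_of_ord (tagnat.sig2 s0) is j.+1
                then component_chain F (tagnat.sig1 s0) j tau else 0).
Proof.
move=> t0; rewrite F_T// -mulmxA Lambda_diag mul_diag_mx mxE [X in X * _]mxE; congr (_ * _).
rewrite mxE; under eq_bigr do rewrite bidiag_entry binomC1n.
rewrite (bigD1 s0)//= eqxx leqnn subnn/= mul1r; congr (_ + _).
pose P (s : 'I_p) := (tagnat.sig1 s == tagnat.sig1 s0) && ((tagnat.sig2 s).+1 == tagnat.sig2 s0 :> nat).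
transitivity (\sum_(s < p | P s) F tau s 0).
  rewrite [LHS]big_mkcond [RHS]big_mkcond; apply: eq_bigr => s _; rewrite /P.
  have [->|ns] := eqVneq s s0; first by rewrite eqxx /= gtn_eqF.
  rewrite eq_sym; case: eqVneq => [E1|_] /=; last by rewrite mul0r.
  have nE : (tagnat.sig2 s != tagnat.sig2 s0 :> nat).
    apply: contraNneq ns => E2.
    by apply/eqP/tagnat_sig_inj.
  case: leqP => [le|gt]; last by rewrite mul0r ifF//; lia.
  case: eqP => [E|nE'].
    by rewrite (_ : (_ <= 1)%N = true) ?mul1r//; lia.
  by rewrite (_ : (_ <= 1)%N = false) ?mul0r//; lia.
rewrite /P /component_chain; case: (nat_of_ord (tagnat.sig2 s0)) => [|j].
  by rewrite big_pred0// => s; rewrite andbF.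
by apply: eq_bigl => s; rewrite eqSS.
Qed.

Lemma component_spanning :
  spanning_chains (fun i tau => F tau i 0) mu m (component_chain F).
Proof.
split.
- move=> r j jd tau t0; have [s0 [E1 E2]] := component_index jd.
  by rewrite !(component_chainE _ _ E1 E2) component_shift// E2 E1.
- move=> r j jd; have [s0 [E1 E2]] := component_index jd.
  exists (fun i => (i == s0)%:R) => tau t0; rewrite (component_chainE _ _ E1 E2).
  rewrite (bigD1 s0)//= eqxx mul1r [X in _ + X]big1 ?addr0// => i /negbTE ->.
  by rewrite mul0r.
- move=> i; have [c Hc] := @in_span_mem R t m (component_chain F) (tagnat.sig1 i) (tagnat.sig2 i) (ltn_ord _).
  by exists c => tau t0; rewrite -Hc// (component_chainE _ _ erefl erefl).
Qed.

(** Each basis function is a combination of components and inherits their decay; lengths at most p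
    make the power y^p sufficient for every chain. *)
Lemma expansions_avoidI (Z : set R) :
  (forall x0, Z x0 -> forall e : R, 0 < e -> exists2 y : R, 1 <= y &
     forall (x : R) i, 0 <= x <= 1 ->
     y ^+ p * normc (F (x +i* y) i 0) * expR (2 * pi * x0 * y) <= e) ->
  expansions_avoid Z F.
Proof.
move=> dec; have [u [d [mu' [g [basis Hd]]]]] := chain_basis component_spanning.
have [ind rg sp] := basis.
have dp r : (d r <= p)%N.
  have [_ [r' le] _] := Hd r; apply: leq_trans le _.
  by rewrite (bigD1 r')//= leq_addr.
have ghol r j : (j < d r)%N -> forall z, uhp z -> hol (g r j) z.
  move=> jd z z0; have [c Hc] := rg r j jd.
  have H : hol (fun tau => \sum_(i < p) c i * F tau i 0) z.
    by apply: hol_sum => i _; apply: holM; [exact: hol_cst|exact: F_hol].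
  apply: (eq_hol (uhp_Im z0) _ H) => w wz; rewrite Hc// /uhp/=.
  have := le_lt_trans (Im_normc (w - z)) wz; rewrite ImD ImN ltr_norml.
  by have := uhp_Im z0; lra.
have gdec r x0 : Z x0 -> decays p (d r) (g r) x0.
  move=> Zx e e0.
  have /choice[c Hc] : forall j, exists c : 'I_p -> C, (j < d r)%N ->
      forall tau, uhp tau -> g r j tau = \sum_(i < p) c i * F tau i 0.
    move=> j; case jd : (j < d r)%N; last by exists (fun=> 0).
    by have [c Hc] := rg r j jd; exists c.
  pose B : R := 1 + \sum_(j < d r) \sum_(i < p) normc (c j i).
  have S0 (j : 'I_(d r)) : 0 <= \sum_(i < p) normc (c j i).
    by apply: sumr_ge0 => i _; apply: normc_ge0.
  have B0 : 0 < B by rewrite ltr_pwDl// sumr_ge0.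
  have [y y1 Hy] := dec x0 Zx (e / B) (divr_gt0 e0 B0).
  exists y => // x j hx jd.
  have t0 : uhp (x +i* y) by rewrite /uhp/=; lra.
  rewrite (Hc j jd _ t0).
  have yP : 0 <= y ^+ p by rewrite exprn_ge0//; lra.
  apply: (@le_trans _ _ (\sum_(i < p) normc (c j i) * (e / B))).
    rewrite [leLHS](_ : _ = normc (\sum_(i < p) c j i * F (x +i* y) i 0) * (y ^+ p * expR (2 * pi * x0 * y))); last by ring.
    apply: (@le_trans _ _ ((\sum_(i < p) normc (c j i * F (x +i* y) i 0)) * (y ^+ p * expR (2 * pi * x0 * y)))).
      by rewrite ler_wpM2r ?normc_sum// mulr_ge0// expR_ge0.
    rewrite mulr_suml; apply: ler_sum => i _; rewrite normcM -[leLHS]mulrA.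
    apply: ler_wpM2l; first exact: normc_ge0.
    by rewrite mulrA [normc _ * _]mulrC; apply: Hy.
  rewrite -mulr_suml mulrA ler_pdivrMr// mulrC ler_wpM2l ?(ltW e0)//.
  rewrite /B (bigD1 (Ordinal jd))//=.
  have : 0 <= \sum_(i < d r | i != Ordinal jd) \sum_(i0 < p) normc (c i i0) by apply: sumr_ge0.
  by lra.
have /choice[a Ha] r := chain_expansion (dp r) (let: And3 _ _ h := Hd r in h) (@ghol r).
exists u, d, mu', g, a; split => //.
  by move=> r; have [h1 _ h2] := Hd r; split => //; exact: (Ha r).1.
by move=> r s n sd Zn; apply: (Ha r).2 => //; apply: gdec.
Qed.

End ExpansionCriterion.

(** * The Poincare series *)

Section PoincareSeries.
Variable R : realType.
Local Notation C := R[i].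

Lemma sum_overE (I : choiceType) (D : set I) (f : I -> C) l :
  usum (fun i => if i \in D then f i else 0) l -> is_summable D f /\ sum_over D f = l.
Proof.
move=> /sums_toP H; split; first by apply: cvgP H.
exact: (@cvg_lim _ (@norm_hausdorff _ _) _ _ summability.totally_filter _ _ H).
Qed.

(** One term of the exponential series, that of degree q + 1, already gives y^q e^(- del y) <= c /
    y; then y is chosen against (A c + B) / y. *)
Lemma expR_decay (A B del : R) (q : nat) : 0 <= A -> 0 <= B -> 0 < del -> forall e : R, 0 < e ->
  exists2 y : R, 1 <= y & A * y ^+ q * expR (- (del * y)) + B / y <= e.
Proof.
move=> A0 B0 del0 e e0.
pose c : R := q.+1`!%:R / del ^+ q.+1.
have f0 : 0 < q.+1`!%:R :> R by rewrite ltr0n fact_gt0.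
have c0 : 0 < c by rewrite divr_gt0// exprn_gt0.
have S0 : 0 <= A * c + B by rewrite addr_ge0// mulr_ge0// ltW.
pose y : R := 1 + (A * c + B) / e.
have y1 : 1 <= y by rewrite lerDl divr_ge0// ltW.
have y0 : 0 < y by lra.
exists y => //.
have h : y ^+ q * expR (- (del * y)) <= c / y.
  rewrite expRN ler_pdivrMr ?expR_gt0// mulrAC ler_pdivlMr//.
  have := expR_ge1Dxn q (mulr_ge0 (ltW del0) (ltW y0)).
  set E := expR _ => hE; have : (del * y) ^+ q.+1 / q.+1`!%:R <= E by lra.
  rewrite ler_pdivrMr// exprMn => h2.
  rewrite -exprSr /c mulrAC ler_pdivlMr ?exprn_gt0//.
  by rewrite [leLHS]mulrC [leRHS]mulrC.
have h2 := ler_wpM2l A0 h.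
apply: (@le_trans _ _ ((A * c + B) / y)); first by rewrite mulrDl -mulrA; lra.
rewrite ler_pdivrMr//; have -> : e * y = e + (A * c + B).
  by rewrite /y; move: (A * c + B) => z; field; rewrite gt_eqF.
by lra.
Qed.

Variables (t : nat) (m : 'I_t -> nat).
Local Notation p := (\sum_(r < t) m r)%N.
Variables (rho : SL2Z -> 'M[C]_p) (mu : 'I_t -> R) (nu : 'I_t -> int).
Hypothesis rho_rep : is_representation rho.
Hypothesis rho_T : rho SL2Z_T = \mxdiag_(r < t) jordan (m r) (e2pi (mu r)%:C).

Lemma automorphy_hol (M : SL2Z) (tau : C) : hol (fun z => automorphy M z) tau.
Proof.
by apply: holD; [apply: holM; [exact: hol_cst|exact: hol_id]|exact: hol_cst].
Qed.

Lemma moebius_hol (M : SL2Z) (tau : C) : uhp tau -> hol (fun z => moebius M z) tau.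
Proof.
move=> t0; apply: holM.
  by apply: holD; [apply: holM; [exact: hol_cst|exact: hol_id]|exact: hol_cst].
apply: (@hol_comp R (fun z => z^-1) _ _ (automorphy_hol M tau)).
by apply: hol_inv; exact: automorphy_neq0.
Qed.

Lemma Phi_hol (i j : 'I_p) (x : C) : hol (fun x => Phi m mu nu x i j) x.
Proof.
pose v : C := ((nu (tagnat.sig1 i))%:~R + mu (tagnat.sig1 i))%:C.
have hexp : hol (fun x => e2pi (v * x)) x.
  apply: (@hol_comp R (@e2pi R) (fun x => v * x)); last exact: hol_e2pi.
  by apply: holM; [exact: hol_cst|exact: hol_id].
have hb : hol (fun x => bidiag m x i j) x.
  apply: (eq_hol (f := fun x => if tagnat.sig1 i == tagnat.sig1 j then
    (if (tagnat.sig2 j <= tagnat.sig2 i)%N then binomC x (tagnat.sig2 i - tagnat.sig2 j) else 0)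
    else 0) ltr01) => [z _|]; first by rewrite bidiag_entry.
  case: (tagnat.sig1 i == tagnat.sig1 j); last exact: hol_cst.
  case: (tagnat.sig2 j <= tagnat.sig2 i)%N; last exact: hol_cst.
  rewrite /binomC; apply: holM; last exact: hol_cst.
  by apply: hol_prod => l _; apply: holD; [exact: hol_id|exact: hol_cst].
apply: (eq_hol ltr01 _ (holM hexp hb)) => z _.
by rewrite /Phi Lambda_diag mul_diag_mx [RHS]mxE [X in _ = X * _]mxE.
Qed.

Variable k : 'I_p -> int.
Hypothesis k_ge0 : forall n, 0 <= k n.

Lemma poincare_term_hol (M : SL2Z) i n (tau : C) : uhp tau ->
  hol (fun z => poincare_term rho mu nu k M z i n) tau.
Proof.
move=> t0.
have [l kn] : exists l, k n = Posz l by exists (absz (k n)); have := k_ge0 n; lia.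
have h1 : hol (fun z => \sum_j rho M^-1%g i j * Phi m mu nu (moebius M z) j n) tau.
  apply: hol_sum => j _; apply: holM; first exact: hol_cst.
  apply: (@hol_comp R (fun x => Phi m mu nu x j n) (fun z => moebius M z)).
      exact: moebius_hol.
    exact: Phi_hol.
have h2 : hol (fun z => (automorphy M z)^-1 ^+ l) tau.
  apply: holX; apply: (@hol_comp R (fun z => z^-1) _ _ (automorphy_hol M tau)).
  by apply: hol_inv; exact: automorphy_neq0.
apply: (eq_hol (uhp_Im t0) _ (holM h1 h2)) => z zt.
have z0 : uhp z.
  have := le_lt_trans (Im_normc (z - tau)) zt; rewrite /uhp/= ImD ImN ltr_norml.
  by have := uhp_Im t0; lra.
by rewrite poincare_termE// mxE kn -exprz_inv.
Qed.

Lemma poincare_term1 (tau : C) : uhp tau -> poincare_term rho mu nu k 1%g tau = Phi m mu nu tau.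
Proof.
move=> t0; apply/matrixP => i n; rewrite poincare_termE// invg1 rho_rep.1 mul1mx.
by rewrite -SL2Z_trans0 moebius_trans automorphy_trans addr0 exp1rz mulr1.
Qed.

Variable eps : C.
Hypothesis eps_pm1 : eps = 1 \/ eps = -1.
Hypothesis rho_S2 : rho (SL2Z_S ^+ 2)%g = eps%:M.

Lemma eps_sqr : eps * eps = 1.
Proof. by case: eps_pm1 => ->; rewrite ?mulr1// mulrNN mulr1. Qed.

Lemma S2E (i j : 'I_2) : (SL2Z_S ^+ 2)%g i j = - (i == j)%:R.
Proof.
have ord2 (x : 'I_2) : x = 0 \/ x = 1.
  by case: x => [[|[|//]] lt]; [left|right]; apply: val_inj.
rewrite expgS expg1 SL2Z_mulE !SL2Z_SE.
by case: (ord2 i) => ->; case: (ord2 j) => -> /=; ring.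
Qed.

(** S^2 = -I acts trivially on the half-plane, so only [rho] (factor eps) and the weight (factor
    (-1)^k) notice it. *)
Lemma poincare_term_neg M i n (tau : C) : uhp tau ->
  poincare_term rho mu nu k (SL2Z_S ^+ 2 * M)%g tau i n =
  eps * (-1) ^ k n * poincare_term rho mu nu k M tau i n.
Proof.
move=> t0; have Mt0 := uhp_moebius M t0.
have E1 (z : C) : automorphy (SL2Z_S ^+ 2)%g z = -1.
  by rewrite /automorphy !S2E /= oppr0 mul0r add0r.
have E2 (z : C) : moebius (SL2Z_S ^+ 2)%g z = z.
  by rewrite /moebius E1 !S2E /= oppr0 addr0 mulN1r invrN1 mulrN1 opprK.
have E3 : rho (SL2Z_S ^+ 2)^-1%g = eps%:M.
  rewrite -rhoV// rho_S2; apply: invmx_unique.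
  by rewrite -scalar_mxM eps_sqr.
rewrite (poincare_termE mu nu rho_rep k M i n t0) (poincare_termE mu nu rho_rep k _ i n t0).
rewrite (automorphyM _ _ t0) (moebiusM _ t0 Mt0) E1 E2 invgM (rhoM rho_rep) E3.
rewrite scalar_mxC mul_scalar_mx -scalemxAl mxE expfzMl.
have -> : (-1 : C) ^ (- k n) = (-1) ^ k n by rewrite -exprz_inv invrN1.
by ring.
Qed.

Variable Reps : set SL2Z.
Hypothesis HReps : is_transversal_T Reps.

Lemma transversal_rep : exists rp : SL2Z -> SL2Z,
  [/\ forall g, Reps (rp g), forall g, exists n, rp g = (SL2Z_trans n * g)%g &
   forall M n, Reps M -> rp (SL2Z_trans n * M)%g = M].
Proof.
have /choice[rp Hrp] := HReps.
have tr g : exists n, rp g = (SL2Z_trans n * g)%g.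
  have [[_ /cycleTP[n En]] _] := Hrp g; exists (- n).
  by rewrite SL2Z_transN -En invgM invgK mulgVK.
exists rp; split => //; first by move=> g; have [[]] := Hrp g.
move=> M n RM; have [_ uniq] := Hrp (SL2Z_trans n * M)%g.
by apply: uniq; split => //; apply/cycleTP; exists n; rewrite mulgK.
Qed.

Lemma transversal_bottom_inj M M' : Reps M -> Reps M' ->
  M 1 0 = M' 1 0 -> M 1 1 = M' 1 1 -> M = M'.
Proof.
move=> RM RM' h0 h1; have [rp [_ _ H]] := transversal_rep.
have [n En] := same_bottom h0 h1.
by rewrite -(H M' n RM') -En -{1}(H M 0 RM) SL2Z_trans0 mul1g.
Qed.

(** Cosets of the translations inject into bottom rows, so a sum over any transversal is at most a
    sum over pairs of integers. *)
Lemma bounded_transversal (B : R) : 0 <= B ->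
  bounded_sums (fun M => if M \in Reps then B * inv_sq2 R (M 1 0, M 1 1) else 0) (B * 16).
Proof.
move=> B0.
apply: (@bounded_sums_inj R _ _ _ (fun c => B * inv_sq2 R c) (fun M : SL2Z => (M 1 0, M 1 1))).
- by move=> c; rewrite mulr_ge0// inv_sq2_ge0.
- by move=> M; case: ifP => // _; rewrite eqxx.
- move=> M M'; case: ifP => [/set_mem RM _|]; last by rewrite eqxx.
  case: ifP => [/set_mem RM' _ [h0 h1]|]; last by rewrite eqxx.
  exact: transversal_bottom_inj.
- by move=> A; rewrite -mulr_sumr ler_wpM2l// bounded_inv_sq2.
Qed.

(** Right multiplication by g permutes the cosets; M g need not lie in the transversal, so it is
    replaced by the representative of its coset. *)
Lemma usum_right_translate g (f : SL2Z -> C) l :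
  (forall M n, f (SL2Z_trans n * M)%g = f M) ->
  usum (fun M => if M \in Reps then f M else 0) l ->
  usum (fun M => if M \in Reps then f (M * g)%g else 0) l.
Proof.
move=> fT; have [rp [rpR rpn rpM]] := transversal_rep.
have frp M : f (rp M) = f M by have [n ->] := rpn M.
apply: (@usum_reindex R _ _ _ _ (fun N => rp (N * g^-1)%g) (fun M => rp (M * g)%g)).
- move=> M; case: ifP => [/set_mem RM _|]; last by rewrite eqxx.
  rewrite mem_set ?rpR// frp; split => //; have [n ->] := rpn (M * g)%g.
  by rewrite -mulgA mulgK rpM.
- move=> N; case: ifP => [/set_mem RN _|]; last by rewrite eqxx.
  rewrite mem_set ?rpR//; have [n ->] := rpn (N * g^-1)%g.
  by rewrite -mulgA mulgVK rpM// fT.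
Qed.

(** Multiplication by a central s permutes the cosets and also scales each term by c; unicity of the
    sum equates the results. *)
Lemma usum_left_eigen s (f : SL2Z -> C) c l :
  (forall M n, f (SL2Z_trans n * M)%g = f M) -> (forall M, s * M = M * s)%g ->
  (forall M, f (s * M)%g = c * f M) ->
  usum (fun M => if M \in Reps then f M else 0) l -> l = c * l.
Proof.
move=> fT sC fs U; have U2 := usum_right_translate s fT U.
have U3 : usum (fun M => if M \in Reps then f (M * s)%g else 0) (c * l).
  apply: eq_usum (usumZ c U) => M; case: ifP => _; last by rewrite mulr0.
  by rewrite -(sC M) fs.
exact: (usum_unique U2 U3).
Qed.

End PoincareSeries.

(** * Modularity, behaviour at the cusp, nonvanishing *)

Section PoincareModular.
Variable R : realType.
Local Notation C := R[i].
Variables (t : nat) (m : 'I_t -> nat).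
Local Notation p := (\sum_(r < t) m r)%N.
Variables (rho : SL2Z -> 'M[C]_p) (mu : 'I_t -> R) (nu : 'I_t -> int).
Hypothesis rho_rep : is_representation rho.
Hypothesis rho_T : rho SL2Z_T = \mxdiag_(r < t) jordan (m r) (e2pi (mu r)%:C).
Variable k : 'I_p -> int.
Hypothesis k_ge0 : forall n, 0 <= k n.
Hypothesis dominated_strip : forall n (X y0 : R), 0 <= X -> 0 < y0 -> forall y1 : R,
  exists2 B : R, 0 <= B & forall (M : SL2Z) i (tau : C), `|Re tau| <= X ->
     y0 <= Im tau -> Im tau <= y1 ->
     normc (poincare_term rho mu nu k M tau i n) <= B * inv_sq2 R (M 1 0, M 1 1).
Hypothesis dominated_cusp : forall n (X y0 : R), 0 <= X -> 0 < y0 ->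
  exists2 B : R, 0 <= B & forall (M : SL2Z) i (tau : C), `|Re tau| <= X ->
     y0 <= Im tau -> M 1 0 != 0 ->
     normc (poincare_term rho mu nu k M tau i n) <=
     B * inv_sq2 R (M 1 0, M 1 1) / Im tau ^+ p.+1.
Variable eps : C.
Hypothesis eps_pm1 : eps = 1 \/ eps = -1.
Hypothesis rho_S2 : rho (SL2Z_S ^+ 2)%g = eps%:M.
Variable Reps : set SL2Z.
Hypothesis HReps : is_transversal_T Reps.

Local Notation P := (poincare rho mu nu k Reps).
Local Notation term := (poincare_term rho mu nu k).

Lemma poincare_usum (tau : C) i n : uhp tau ->
  is_summable Reps (fun M => term M tau i n) /\
  usum (fun M => if M \in Reps then term M tau i n else 0) (2 * P tau i n).
Proof.
move=> t0.
have [B B0 HB] := dominated_strip n (normr_ge0 (Re tau)) (uhp_Im t0) (Im tau).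
have [|l Hl] := @usum_exists R _ (fun M => if M \in Reps then term M tau i n else 0) _ _ _ (bounded_transversal HReps B0).
  by move=> M; case: ifP => _; rewrite ?normc0// HB.
have [s1 s2] := sum_overE Hl; split => //.
by rewrite /poincare !mxE s2 mulrA divff ?mul1r// pnatr_eq0.
Qed.

Lemma poincare_hol i n (tau : C) : uhp tau -> hol (fun z => P z i n) tau.
Proof.
move=> t0; have y0 := uhp_Im t0; set y := Im tau in y0.
have r0 : 0 < y / 2 by lra.
have X0 : 0 <= `|Re tau| + y / 2 by rewrite addr_ge0// ltW.
have [B B0 HB] := dominated_strip n X0 r0 (2 * y).
have nearb z : normc (z - tau) < y / 2 -> [/\ `|Re z| <= `|Re tau| + y / 2,
    y / 2 <= Im z & Im z <= 2 * y].
  move=> zt; have := le_lt_trans (Im_normc (z - tau)) zt.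
  have := le_lt_trans (Re_normc (z - tau)) zt; rewrite ReD ImD ReN ImN -/y => h1.
  rewrite ltr_norml => /andP[h2 h3]; split; [|lra|lra].
  by rewrite -[Re z](subrK (Re tau)) addrC (le_trans (ler_normD _ _))// lerD2l ltW.
have S : hol (fun z => 2 * P z i n) tau.
  apply: (hol_usum (F := fun M z => if M \in Reps then term M z i n else 0) r0 (bounded_transversal HReps B0)).
    move=> z /nearb[h1 h2 h3]; apply: (poincare_usum i n _).2.
    by rewrite /uhp/=; lra.
  move=> M z /nearb[h1 h2 h3]; have z0 : uhp z by rewrite /uhp/=; lra.
  have [RM|RM] := boolP (M \in Reps).
    split; last exact: HB.
    exact: (poincare_term_hol mu nu rho_rep k_ge0 M i n z0).
  split; last by rewrite normc0.
  by apply: (eq_hol ltr01 _ (hol_cst 0 z)).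
apply: (eq_hol ltr01 _ (holM (hol_cst 2^-1 tau) S)) => z _.
by rewrite mulrA mulVf ?mul1r// pnatr_eq0.
Qed.

Lemma poincare_modular (g : SL2Z) (tau : C) : uhp tau ->
  rho g *m P tau = P (moebius g tau) *m invmx (Jmx k g tau).
Proof.
move=> t0; have gt0 := uhp_moebius g t0.
have n2 : (2 : C) != 0 by rewrite pnatr_eq0.
apply/matrixP => i n; apply: (mulfI n2).
have U1 : usum (fun M => if M \in Reps then (rho g *m term (M * g)%g tau) i n else 0)
    (2 * (rho g *m P tau) i n).
  rewrite mxE mulr_sumr.
  have -> : \sum_j 2 * (rho g i j * P tau j n) = \sum_j rho g i j * (2 * P tau j n).
    by apply: eq_bigr => j _; rewrite mulrCA.
  have Uj j := usumZ (rho g i j) (usum_right_translate HReps g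
    (fun M a => congr1 (fun A : 'M[C]_p => A j n) (poincare_term_coset nu rho_rep rho_T k a M t0))
    (poincare_usum j n t0).2).
  apply: eq_usum (usum_sum (index_enum 'I_p) Uj) => M; case: ifP => _.
    by rewrite mxE.
  by rewrite big1// => j _; rewrite mulr0.
apply: (usum_unique U1).
rewrite Jmx_inv// mulmx_diag_entry mulrA mulrC.
apply: eq_usum (usumZ (automorphy g tau ^ (- k n)) (poincare_usum i n gt0).2) => M.
case: ifP => _; last by rewrite mulr0.
rewrite -(poincare_term_modular mu nu rho_rep)// Jmx_inv// mulmx_diag_entry.
exact: mulrC.
Qed.

Lemma poincare_shift (tau : C) : uhp tau ->
  P (tau + 1) = Lambda m (fun r => e2pi (mu r)%:C) *m bidiag m 1 *m P tau.
Proof.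
move=> t0; have := poincare_modular (SL2Z_trans 1) t0.
rewrite moebius_trans SL2Z_trans1 rho_T jordan_bidiag => ->.
rewrite Jmx_inv//; have -> : (\row_n automorphy SL2Z_T tau ^ (- k n)) = const_mx 1 :> 'rV[C]_p.
  by apply/rowP => n; rewrite !mxE -SL2Z_trans1 automorphy_trans exp1rz.
by rewrite diag_const_mx mulmx1.
Qed.

Lemma poincare_sign (tau : C) i n : uhp tau -> P tau i n = eps * (-1) ^ k n * P tau i n.
Proof.
move=> t0; have n2 : (2 : C) != 0 by rewrite pnatr_eq0.
apply: (mulfI n2).
have [s Es hs] : exists2 s : SL2Z, s = (SL2Z_S ^+ 2)%g & forall i j : 'I_2, s i j = - (i == j)%:R.
  by exists (SL2Z_S ^+ 2)%g => //; exact: S2E.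
have S2C M : (SL2Z_S ^+ 2 * M = M * SL2Z_S ^+ 2)%g.
  by rewrite -Es; apply: SL2Z_eq; rewrite !SL2Z_mulE !hs /=; ring.
have := @usum_left_eigen R Reps HReps (SL2Z_S ^+ 2)%g (fun M => term M tau i n)
  (eps * (-1) ^ k n) (2 * P tau i n) _ S2C _ (poincare_usum i n t0).2.
rewrite mulrCA; apply => [M a|M].
  by rewrite (poincare_term_coset nu rho_rep rho_T k a M t0).
exact: (poincare_term_neg mu nu rho_rep k eps_pm1 rho_S2 M i n t0).
Qed.

(** Two unequal signs have product -1, so [poincare_sign] says that each entry is its own
    opposite. *)
Lemma poincare_col0 (tau : C) n : uhp tau -> eps <> (-1) ^ k n -> col n (P tau) = 0.
Proof.
move=> t0 ne; apply/colP => i; rewrite [LHS]mxE [RHS]mxE.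
have E : eps * (-1) ^ k n = -1 :> C.
  have : ((-1) ^ k n : C) = 1 \/ ((-1) ^ k n : C) = -1.
    have [l ->] : exists l, k n = Posz l by exists (absz (k n)); have := k_ge0 n; lia.
    rewrite -exprnP -signr_odd; case: (odd l); [right|left]; by rewrite ?expr1.
  case: eps_pm1 => e1 [] h; rewrite e1 h in ne *; first by case: ne.
  - by rewrite mul1r.
  - by rewrite mulr1.
  - by case: ne.
have := poincare_sign i n t0; rewrite E mulN1r => /eqP.
by rewrite -addr_eq0 -mulr2n mulrn_eq0/= => /eqP.
Qed.

Lemma cusp_term (M : SL2Z) (tau : C) i n : uhp tau -> M 1 0 = 0 ->
  normc (term M tau i n) = normc (Phi m mu nu tau i n).
Proof.
move=> t0 c0; case: (SL2Z_lower_right c0) => d1.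
  have [a ->] : exists a, M = (SL2Z_trans a * 1)%g by apply: same_bottom; rewrite SL2Z_1E.
  by rewrite poincare_term_coset// poincare_term1.
have [a ->] : exists a, M = (SL2Z_trans a * (SL2Z_S ^+ 2 * 1))%g.
  by apply: same_bottom; rewrite mulg1 S2E ?c0 ?d1.
rewrite poincare_term_coset// (poincare_term_neg mu nu rho_rep k eps_pm1 rho_S2)// poincare_term1//.
have [l ->] : exists l, k n = Posz l by exists (absz (k n)); have := k_ge0 n; lia.
rewrite -exprnP !normcM normcX normcN normc1 expr1n mulr1.
by case: eps_pm1 => ->; rewrite ?normcN normc1 mul1r.
Qed.

Lemma cusp_inv_sq2 (M : SL2Z) : M 1 0 = 0 -> inv_sq2 R (M 1 0, M 1 1) = 4^-1.
Proof.
move=> c0; have d1 : absz (M 1 1) = 1%N by case: (SL2Z_lower_right c0) => ->.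
rewrite /inv_sq2 /inv_sq /= d1 c0 absz0 add0r expr1n invr1 mul1r.
by congr (_^-1); ring.
Qed.

Lemma Phi_decay (v : R) i n (x y : R) : (forall r, v <= (nu r)%:~R + mu r) -> 0 <= x <= 1 -> 1 <= y ->
  normc (Phi m mu nu (x +i* y) i n) <= expR (- (2 * pi * v * y)) * ((3 + p%:R) * y) ^+ p.
Proof.
move=> hv /andP[x0 x1] y1; rewrite /Phi Lambda_diag mul_diag_mx mxE [X in normc (X * _)]mxE normcM.
apply: ler_pM; rewrite ?normc_ge0//.
  rewrite normc_e2pi ImMr /= ler_expR lerN2 -!mulrA ler_wpM2l// ler_wpM2l ?pi_ge0//.
  by rewrite ler_wpM2r ?hv//; lra.
apply: (le_trans (bidiag_bound _ _ _)).
have P0 : 0 <= p%:R :> R by [].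
have := normc_ReIm (x +i* y) => /=; rewrite !ger0_norm//; last by lra.
move=> h; apply: lerXn2r; rewrite ?nnegrE; [|nra|nra].
by rewrite !addr_ge0// normc_ge0.
Qed.

(** The cosets with c = 0 decay like e^(-2 pi v y) up to powers of y, which x0 < v beats. The others
    are O(y^(-p-1)), leaving 1 / y after multiplication by y^p; for them e^(2 pi x0 y) must not
    grow, hence x0 <= 0. *)
Lemma poincare_decay (v x0 : R) n : (forall r, v <= (nu r)%:~R + mu r) -> x0 < v -> x0 <= 0 ->
  forall e : R, 0 < e -> exists2 y : R, 1 <= y & forall (x : R) i, 0 <= x <= 1 ->
    y ^+ p * normc (P (x +i* y) i n) * expR (2 * pi * x0 * y) <= e.
Proof.
move=> hv xv xle0 e e0.
have [B B0 HB] := dominated_cusp n ler01 ltr01.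
pose A : R := 64 * (3 + p%:R) ^+ p.
have A0 : 0 <= A by rewrite mulr_ge0// exprn_ge0// addr_ge0.
have B16 : 0 <= 16 * B by rewrite mulr_ge0.
have pi0 := @pi_gt0 R.
have del0 : 0 < 2 * pi * (v - x0) by rewrite !mulr_gt0//; lra.
have [y y1 Hy] := expR_decay (p + p) A0 B16 del0 e0.
exists y => // x i hx; apply: le_trans Hy.
have y0 : 0 < y by lra.
have t0 : uhp (x +i* y) by rewrite /uhp/=.
pose b := normc (Phi m mu nu (x +i* y) i n).
have b0 : 0 <= b by apply: normc_ge0.
have yp1 : 0 < y ^+ p.+1 by rewrite exprn_gt0.
have B1 : 0 <= B / y ^+ p.+1 by rewrite divr_ge0// ltW.
have Q0 : 0 <= 4 * b + B / y ^+ p.+1 by lra.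
(* One majorant for all cosets: where c = 0 the weight [inv_sq2] equals 1/4, which the factor 4
   offsets; elsewhere [dominated_cusp] applies. 16 is the total of the weights. *)
have h2P : normc (2 * P (x +i* y) i n) <= (4 * b + B / y ^+ p.+1) * 16.
  apply: (usum_le (poincare_usum i n t0).2 _ (bounded_transversal HReps Q0)) => M.
  case: ifP => _; last by rewrite normc0.
  have iq := inv_sq2_ge0 R (M 1 0, M 1 1).
  have [c0|c0] := eqVneq (M 1 0) 0.
    by rewrite cusp_term// cusp_inv_sq2// -/b; lra.
  have h : `|Re (x +i* y)| <= 1 by case/andP: hx => h1 h2 /=; rewrite ger0_norm.
  have := HB M i (x +i* y) h y1 c0; move=> /= /le_trans; apply.
  rewrite mulrAC mulrDl lerDr mulr_ge0//; lra.
have h2 : normc (P (x +i* y) i n) <= (4 * b + B / y ^+ p.+1) * 16.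
  apply: le_trans h2P; rewrite normcM normc_nat; have := normc_ge0 (P (x +i* y) i n); lra.
have hb := Phi_decay i n hv hx y1; rewrite -/b in hb.
have yp : 0 < y ^+ p by rewrite exprn_gt0.
have E1 : 0 < expR (2 * pi * x0 * y) by apply: expR_gt0.
have E2 : expR (2 * pi * x0 * y) <= 1.
  rewrite expR_le1 pmulr_lle0// pmulr_rle0//; lra.
have h3 : y ^+ p * normc (P (x +i* y) i n) * expR (2 * pi * x0 * y) <=
  y ^+ p * ((4 * b + B / y ^+ p.+1) * 16) * expR (2 * pi * x0 * y).
  by rewrite ler_wpM2r ?(ltW E1)// ler_wpM2l// ltW.
apply: (le_trans h3).
have -> : y ^+ p * ((4 * b + B / y ^+ p.+1) * 16) * expR (2 * pi * x0 * y) =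
  64 * y ^+ p * expR (2 * pi * x0 * y) * b + 16 * B / y * expR (2 * pi * x0 * y).
  by rewrite exprS; field; rewrite !gt_eqF.
apply: lerD; last by rewrite ler_piMr// divr_ge0// ltW.
have c0 : 0 <= 64 * y ^+ p * expR (2 * pi * x0 * y).
  by rewrite mulr_ge0 ?(ltW E1)// mulr_ge0// ltW.
apply: (le_trans (ler_wpM2l c0 hb)).
have -> : - (2 * pi * (v - x0) * y) = 2 * pi * x0 * y + - (2 * pi * v * y) by ring.
rewrite expRD /A exprMn exprD le_eqVlt; apply/orP; left; apply/eqP; ring.
Qed.

Lemma poincare_expansions n (Z : set R) (v : R) : (forall r, v <= (nu r)%:~R + mu r) ->
  (forall x, Z x -> x < v /\ x <= 0) -> expansions_avoid Z (fun tau => col n (P tau)).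
Proof.
move=> hv hZ; apply: (@expansions_avoidI R t m mu).
- move=> i z z0; apply: (eq_hol ltr01 _ (poincare_hol i n z0)) => w _.
  by rewrite [RHS]mxE.
- move=> tau t0; rewrite (poincare_shift t0) !colE; exact/esym/mulmxA.
move=> x0 /hZ[h1 h2] e e0; have [y y1 H] := poincare_decay n hv h1 h2 e0.
by exists y => // x i hx; rewrite mxE; apply: H.
Qed.

Lemma poincare_mv_modular : mv_modular rho k P.
Proof.
split; last by move=> g tau; exact: poincare_modular.
by move=> i j tau t0; apply: hol_derivable; exact: poincare_hol.
Qed.

Lemma poincare_vv_modular n : vv_modular rho (k n) (fun tau => col n (P tau)).
Proof.
split=> [i tau t0|g tau t0].
  apply: hol_derivable; apply: (eq_hol ltr01 _ (poincare_hol i n t0)) => w _.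
  by rewrite [RHS]mxE.
have /matrixP E := poincare_modular g t0; apply/colP => i.
have := E i n; rewrite Jmx_inv// mulmx_diag_entry mulrC => En.
rewrite [LHS]mxE [X in _ * X]mxE -En [LHS]mxE [RHS]mxE; apply: eq_bigr => j _.
by rewrite [X in _ = _ * X]mxE.
Qed.

(** A diagonal entry in the block [r0] is tested high on the imaginary axis: a nonpositive exponent
    makes the main term at least 1 in norm, while the cosets with c <> 0 become small. *)
Lemma poincare_nonzero r0 : (0 < m r0)%N -> (nu r0)%:~R + mu r0 <= 0 ->
  (forall n, eps = (-1) ^ k n) -> nonzero_on_uhp P.
Proof.
move=> m0 v0 heps.
have [s0 [E1 E2]] := component_index m0.
have [B B0 HB] := dominated_cusp s0 ler01 ltr01.
(* Makes the remainder 16 B / y^(p+1) at most 1, against a main term of norm 2 |c| >= 2. *)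
pose y : R := 16 * B + 1; have y1 : 1 <= y by rewrite /y; lra.
have y0 : 0 < y by lra.
pose tau : C := 0 +i* y; have t0 : uhp tau by rewrite /uhp/=.
exists tau => //; apply/eqP => P0.
have U := (poincare_usum s0 s0 t0).2; rewrite P0 mxE mulr0 in U.
pose c := Phi m mu nu tau s0 s0.
have c1 : 1 <= normc c.
  rewrite /c /Phi Lambda_diag mul_diag_mx mxE [X in normc (X * _)]mxE bidiag_entry.
  rewrite eqxx leqnn subnn binomC0 mulr1 normc_e2pi ImMr E1 /=.
  rewrite -[X in X <= _]expR0 ler_expR oppr_ge0 pmulr_rle0; first by rewrite (pmulr_lle0 _ y0).
  by rewrite mulr_gt0// pi_gt0.
have [rp [rpR rpn rpM]] := transversal_rep HReps.
(* The sign condition enters here: eps (-1)^k = eps^2 = 1, so the cosets of I and -I contribute the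
   same value. *)
have tpos M : M = 1%g \/ M = (SL2Z_S ^+ 2 * 1)%g -> term (rp M) tau s0 s0 = c.
  move=> hM; have [a ->] := rpn M; rewrite poincare_term_coset//.
  case: hM => ->; first by rewrite poincare_term1.
  rewrite (poincare_term_neg mu nu rho_rep k eps_pm1 rho_S2)// poincare_term1//.
  by rewrite -heps (eps_sqr eps_pm1) mul1r.
have two M : Reps M -> M 1 0 = 0 -> M = rp 1%g \/ M = rp (SL2Z_S ^+ 2 * 1)%g.
  move=> RM c0; case: (SL2Z_lower_right c0) => d1; [left|right].
    have [a ->] : exists a, 1%g = (SL2Z_trans a * M)%g by apply: same_bottom; rewrite SL2Z_1E.
    by rewrite rpM.
  have [a ->] : exists a, (SL2Z_S ^+ 2 * 1)%g = (SL2Z_trans a * M)%g.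
    by apply: same_bottom; rewrite mulg1 S2E ?c0 ?d1// oppr0.
  by rewrite rpM.
(* Adding [h] to the series removes the main term, and the series was assumed to vanish; so - 2 c is
   a sum over cosets with c <> 0 only. *)
pose h (M : SL2Z) : C := if (M \in Reps) && (M 1 0 == 0) then - c else 0.
have bot1 a : (SL2Z_trans a * 1)%g 1 1 = 1 by rewrite trans_mul_bottom SL2Z_1E.
have bot2 a : (SL2Z_trans a * (SL2Z_S ^+ 2 * 1))%g 1 1 = -1 by rewrite trans_mul_bottom mulg1 S2E.
have Uh : usum h (- (2 * c)).
  have := @usum_fin R _ [fset rp 1%g; rp (SL2Z_S ^+ 2 * 1)%g]%fset h.
  rewrite big_fsetU1/=; last first.
    rewrite inE; apply/eqP => /(congr1 (fun M : SL2Z => M 1 1)).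
    by have [a ->] := rpn 1%g; have [b ->] := rpn (SL2Z_S ^+ 2 * 1)%g; rewrite bot1 bot2.
  rewrite big_seq_fset1.
  have h1 : h (rp 1%g) = - c.
    rewrite /h mem_set ?rpR//; have [a ->] := rpn 1%g.
    by rewrite trans_mul_bottom SL2Z_1E eqxx.
  have h2 : h (rp (SL2Z_S ^+ 2 * 1)%g) = - c.
    rewrite /h mem_set ?rpR//; have [a ->] := rpn (SL2Z_S ^+ 2 * 1)%g.
    by rewrite trans_mul_bottom mulg1 S2E oppr0 eqxx.
  rewrite h1 h2; have -> : - c - c = - (2 * c) by ring.
  apply=> M; rewrite !inE negb_or => /andP[n1 n2]; rewrite /h.
  case: ifP => // /andP[/set_mem RM /eqP c0].
  by have [E|E] := two M RM c0; [rewrite E eqxx in n1|rewrite E eqxx in n2].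
have B1 : 0 <= B / y ^+ p.+1 by rewrite divr_ge0// exprn_ge0// ltW.
have : normc (0 + - (2 * c)) <= B / y ^+ p.+1 * 16.
  apply: (usum_le (usumD U Uh) _ (bounded_transversal HReps B1)) => M; rewrite /h.
  case: (boolP (M \in Reps)) => [/set_mem RM|_]; rewrite ?andTb ?andFb; last by rewrite addr0 normc0.
  have [c0|c0] := eqVneq (M 1 0) 0.
    have -> : term M tau s0 s0 = c.
      by have [->|->] := two M RM c0; apply: tpos; [left|right].
    by rewrite subrr normc0 mulr_ge0// inv_sq2_ge0.
  rewrite addr0; apply: le_trans (HB M s0 tau _ y1 c0) _; first by rewrite /= normr0.
  by rewrite /= mulrAC.
rewrite add0r normcN normcM normc_nat.
have : B / y ^+ p.+1 * 16 <= 1.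
  have yp : y <= y ^+ p.+1 by rewrite exprS ler_peMr ?(ltW y0)// exprn_ege1.
  rewrite mulrAC ler_pdivrMr ?exprn_gt0// mul1r; apply: le_trans yp.
  by rewrite /y; lra.
by lra.
Qed.

End PoincareModular.

Theorem theorem3p10 (R : realType) (t : nat) (m : 'I_t -> nat)
    (rho : SL2Z -> 'M[R[i]]_(\sum_(r < t) m r)) (eps : R[i])
    (lam : 'I_t -> R[i]) (mu : 'I_t -> R) (nu : 'I_t -> int)
    (m_gt0 : forall r, (0 < m r)%N)
    (rho_rep : is_representation rho)
    (eps_pm1 : eps = 1 \/ eps = -1)
    (rho_S2 : rho (SL2Z_S ^+ 2)%g = eps%:M)
    (rho_T : rho SL2Z_T = \mxdiag_(r < t) jordan (m r) (lam r))
    (lam_norm : forall r, `|lam r| = 1)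
    (lam_mu : forall r, lam r = e2pi (mu r)%:C) :
  exists K : int, forall k : 'I_(\sum_(r < t) m r) -> int,
    (forall n, K <= k n) ->
    forall Reps : set SL2Z, is_transversal_T Reps ->
    let P := poincare rho mu nu k Reps in
    [/\ forall tau, uhp tau -> poincare_converges rho mu nu k Reps tau,
        mv_meromorphic rho k P,
        (forall n, eps = (-1) ^ k n) ->
          exactly_one_of3
            ((forall r, 0 < (nu r)%:~R + mu r) /\ mv_cuspidal rho k P)
            [/\ forall r, 0 <= (nu r)%:~R + mu r,
                exists r, (nu r)%:~R + mu r = 0,
                nonzero_on_uhp P & mv_holomorphic rho k P]
            [/\ exists r, (nu r)%:~R + mu r < 0,
                nonzero_on_uhp P & mv_meromorphic rho k P]
      & forall n, eps <> (-1) ^ k n ->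
          forall tau, uhp tau -> col n (P tau) = 0].
Proof.
have rho_T' : rho SL2Z_T = \mxdiag_(r < t) jordan (m r) (e2pi (mu r)%:C).
  by rewrite rho_T; apply: eq_mxdiag => r; rewrite lam_mu.
have [K dom] := poincare_term_dominated nu rho_rep rho_T'.
exists (Posz K) => k hk Reps HR P.
have k0 n : 0 <= k n by apply: le_trans (hk n).
have strip n (X y0 : R) (hX : 0 <= X) (hy : 0 < y0) := (dom k hk n X y0 hX hy).1.
have cusp n (X y0 : R) (hX : 0 <= X) (hy : 0 < y0) := (dom k hk n X y0 hX hy).2.
have mvP : mv_modular rho k P by apply: poincare_mv_modular.
have vvP n : vv_modular rho (k n) (fun tau => col n (P tau)) by apply: poincare_vv_modular.
have expan n := poincare_expansions rho_rep rho_T' k0 strip cusp eps_pm1 rho_S2 HR n.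
have mero : mv_meromorphic rho k P.
  split => // n; split; first exact: vvP.
  (* - [Vmax] is a lower bound of all nu_r + mu_r that is at most 0, so it works both as n0 and as
     v. *)
  exists (- Vmax mu nu); apply: (expan n _ (- Vmax mu nu)) => [r|x /= xV].
    rewrite /Vmax (bigD1 r)//=; have := ler_norm (- ((nu r)%:~R + mu r)).
    have : 0 <= \sum_(i < t | i != r) `|(nu i)%:~R + mu i| by apply: sumr_ge0.
    by rewrite normrN; lra.
  by split=> //; have := Vmax_ge0 mu nu; lra.
split => //.
- by move=> tau t0 i n; have [] := poincare_usum strip HR i n t0.
- move=> heps.
  have nonzero r : (nu r)%:~R + mu r <= 0 -> nonzero_on_uhp P.
    by move=> hr; apply: (poincare_nonzero rho_rep rho_T' strip cusp eps_pm1 rho_S2 HR (m_gt0 r) hr).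
  split.
  + have [pos|npos] := pselect (forall r, 0 < (nu r)%:~R + mu r).
      left; split=> //; split=> // n; split; first exact: vvP.
      (* 1 / w is a positive lower bound of all exponents, obtained without a minimum; being
         positive, it also excludes the exponent 0. *)
      pose w := 1 + \sum_(r < t) ((nu r)%:~R + mu r)^-1.
      have s0 : 0 <= \sum_(r < t) ((nu r)%:~R + mu r)^-1.
        by apply: sumr_ge0 => r _; rewrite invr_ge0 ltW.
      have w0 : 0 < w by rewrite /w; lra.
      apply: (expan n _ w^-1) => [r|x /= x0].
        rewrite -[leRHS]invrK lef_pV2 ?posrE ?invr_gt0// /w (bigD1 r)//=.
        have : 0 <= \sum_(i < t | i != r) ((nu i)%:~R + mu i)^-1.
          by apply: sumr_ge0 => i _; rewrite invr_ge0 ltW.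
        by lra.
      by split=> //; apply: (le_lt_trans x0); rewrite invr_gt0.
    right; have [nonneg|nneg] := pselect (forall r, 0 <= (nu r)%:~R + mu r).
      left; have [r hr] : exists r, (nu r)%:~R + mu r = 0.
        apply: contrapT => H; apply: npos => r; rewrite lt_def nonneg andbT.
        by apply/eqP => E; apply: H; exists r.
      split=> //; [by exists r|by apply: (nonzero r); rewrite hr|split=> // n].
      split; first exact: vvP.
      by apply: (expan n _ 0) => // x /= x0; rewrite x0 ltW.
    right; have [r hr] : exists r, (nu r)%:~R + mu r < 0.
      apply: contrapT => H; apply: nneg => r; rewrite leNgt; apply/negP => h.
      by apply: H; exists r.
    by split=> //; [exists r|apply: (nonzero r); apply: ltW].
  + by move=> [[pos _] [_ [r hr] _ _]]; have := pos r; rewrite hr ltxx.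
  + by move=> [[pos _] [[r hr] _ _]]; have := pos r; lra.
  + by move=> [[nonneg _ _ _] [[r hr] _ _]]; have := nonneg r; lra.
- by move=> n hn tau t0; apply: (poincare_col0 rho_rep rho_T' k0 strip eps_pm1 rho_S2 HR t0 hn).
Qed.
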